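(* Let $N\ge1$, $d\ge1$, $0\le k\le d$ be integers and $f\in\mathcal B_N$. Let $f^*$ and $f^{\bar*}$ be the dual and the contradual of $f$, respectively. Then, as functions on $(\mathbb R^d)^N$, $$V_{f^*,k}=-V_{f^{\bar*},k}=(-1)^kV_{f,k}\quad\text{and}\quad W^d_{f^*,k}=-W^d_{f^{\bar*},k}=(-1)^{d-k}W^d_{f,k}.$$
   Context: $\mathcal B_N$ is the free Boolean algebra generated by $x_1,\dots,x_N$, with operations $\cup,\cap$, complement $f\mapsto\bar f$, greatest element $X$, least element $\emptyset$; $f\setminus g=f\cap\bar g$. The contradual $f^{\bar*}$ of $f\in\mathcal B_N$ is formed by replacing each variable $x_i$ by its complement $\bar x_i$; the dual $f^*=\overline{f^{\bar*}}$ is the complement of the contradual. Put $[N]=\{1,\dots,N\}$. $\mathcal C_N\subset\mathcal B_N$ is the set of elements that can be built from $x_1,\dots,x_N$ using only $\cup,\cap,\setminus$. For $\emptyset\ne I\subseteq[N]$ let $u_I=\bigcup_{i\in I}x_i$. $\mathcal M_N$ is the space of functions $\mu:\mathcal C_N\to\mathbb R$ with $\mu(f\cup g)=\mu(f)+\mu(g)$ whenever $f\cap g=\emptyset$. For each $f\in\mathcal C_N$, the integers $m_{f,I}$ ($\emptyset\neq I\subseteq[N]$) are the unique ones such that $\mu(f)=\sum_{\emptyset\ne I\subseteq[N]}m_{f,I}\,\mu(u_I)$ for all $\mu\in\mathcal M_N$. The $0$-weight extension of $\mu\in\mathcal M_N$ is its unique extension $\mu:\mathcal B_N\to\mathbb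 R$ with $\mu(f\cup g)=\mu(f)+\mu(g)-\mu(f\cap g)$ for all $f,g\in\mathcal B_N$ and $\mu(X)=0$. Let $\kappa_n$ be the volume of the unit ball of $\mathbb R^n$ ($\kappa_0=1$) and $B^d(\mathbf 0,r)$ the closed ball of radius $r$ about the origin. For a nonempty compact convex $K\subset\mathbb R^d$, the quermassintegrals $W_k^d(K)$ and intrinsic volumes $V_k(K)$ are defined by $\mathrm{vol}_d(K+B^d(\mathbf 0,r))=\sum_{k=0}^d\binom dk W^d_k(K)r^k=\sum_{k=0}^d\kappa_{d-k}V_k(K)r^{d-k}$, $r\ge0$. For $\mathbf p\in(\mathbb R^d)^N$, $K_I(\mathbf p)$ is the convex hull of $\{\mathbf p_i:i\in I\}$. For $f\in\mathcal C_N$, $W^d_{f,k}(\mathbf p)=\sum_{\emptyset\ne I\subseteq[N]}m_{f,I}W^d_k(K_I(\mathbf p))$ and $V_{f,k}(\mathbf p)=\sum_{\emptyset\ne I\subseteq[N]}m_{f,I}V_k(K_I(\mathbf p))$. For fixed $k,\mathbf p$, the maps $f\mapsto W^d_{f,k}(\mathbf p)$ and $f\mapsto V_{f,k}(\mathbf p)$ on $\mathcal C_N$ belong to $\mathcal M_N$; for arbitrary $f\in\mathcal B_N$, $W^d_{f,k}(\mathbf p)$ and $V_{f,k}(\mathbf p)$ are defined by their $0$-weight extensions. *)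

(* Defs.v *)
From HB Require Import structures.
From mathcomp Require Import all_boot all_order all_algebra.
From mathcomp Require Import all_classical all_reals all_analysis.
Set Implicit Arguments.
Unset Strict Implicit.
Unset Printing Implicit Defensive.
Import Order.Theory GRing.Theory Num.Theory.
Import numFieldNormedType.Exports.
Local Open Scope classical_set_scope.
Local Open Scope ring_scope.

(* An element f of the free Boolean algebra on N generators is encoded by its
   truth table, namely the set of those S : {set 'I_N} for which f evaluates to
   true when exactly the variables indexed by S are true.  Freeness is
   [freeBA_universal] below. *)
Definition freeBA (N : nat) := {set {set 'I_N}}.

Section BooleanAlgebra.
Variable N : nat.
Implicit Types (f g : freeBA N) (i : 'I_N).

Definition bvar i : freeBA N := [set S : {set 'I_N} | i \in S]%SET.

Definition bsubst (h : 'I_N -> freeBA N) f : freeBA N :=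
  [set S : {set 'I_N} | [set i | S \in h i]%SET \in f]%SET.

Lemma bsubst_var h i : bsubst h (bvar i) = h i.
Proof. by apply/finset.setP => S; rewrite !finset.inE. Qed.

Lemma bsubstU h f g : bsubst h (f :|: g)%SET = (bsubst h f :|: bsubst h g)%SET.
Proof. by apply/finset.setP => S; rewrite !finset.inE. Qed.

Lemma bsubstI h f g : bsubst h (f :&: g)%SET = (bsubst h f :&: bsubst h g)%SET.
Proof. by apply/finset.setP => S; rewrite !finset.inE. Qed.

Lemma bsubstC h f : bsubst h (~: f)%SET = (~: bsubst h f)%SET.
Proof. by apply/finset.setP => S; rewrite !finset.inE. Qed.

Definition contradual f : freeBA N := bsubst (fun i => ~: bvar i)%SET f.

Definition dual f : freeBA N := (~: contradual f)%SET.

Inductive inC : freeBA N -> Prop :=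
| inC_var i : inC (bvar i)
| inC_cup f g : inC f -> inC g -> inC (f :|: g)%SET
| inC_cap f g : inC f -> inC g -> inC (f :&: g)%SET
| inC_diff f g : inC f -> inC g -> inC (f :\: g)%SET.

Definition bjoin (I : {set 'I_N}) : freeBA N := (\bigcup_(i in I) bvar i)%SET.

End BooleanAlgebra.

Lemma freeBA_universal (N : nat) (disp : Order.disp_t)
    (L : ctbDistrLatticeType disp) (h : 'I_N -> L) :
  exists! phi : freeBA N -> L,
    [/\ forall i, phi (bvar i) = h i,
        forall f g, phi (f :|: g)%SET = (phi f `|` phi g)%O,
        forall f g, phi (f :&: g)%SET = (phi f `&` phi g)%O &
        forall f, phi (~: f)%SET = (~` phi f)%O].
Proof.
pose join_law : Monoid.add_law (\bot%O : L) (@Order.meet disp L) :=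
  HB.pack (@Order.join disp L)
    (Monoid.isAddLaw.Build L (@Order.meet disp L) (@Order.join disp L)
       (@meetUl disp L) (@meetUr disp L)).
pose lit (i : 'I_N) (S : {set 'I_N}) : freeBA N :=
  if i \in S then bvar i else (~: bvar i)%SET.
pose e (S : {set 'I_N}) : L := (\meet_i if i \in S then h i else ~` h i)%O.
pose phi (f : freeBA N) : L := (\join_(S in f) e S)%O.
have eI (S T : {set 'I_N}) : S != T -> (e S `&` e T = \bot)%O.
  move=> ST; apply/eqP; rewrite -lex0.
  have [i iST] : exists i, (i \in S) != (i \in T).
    apply/existsP; apply: contraNT ST => /existsPn ST.
    by apply/eqP/finset.setP => i; apply/eqP; move/negPn: (ST i).
  apply: (@le_trans _ _ ((if i \in S then h i else ~` h i) `&`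
                         (if i \in T then h i else ~` h i))%O).
    by apply: leI2; apply: meets_inf.
  by case: (i \in S) (i \in T) iST => [] [] //= _; rewrite ?meetxC // meetC meetxC.
have eT : (\join_S e S = \top)%O.
  apply: le_anti; rewrite lex1 /=.
  have -> : (\top = \meet_(i < N) \join_(b : bool) if b then h i else ~` h i)%O.
    by rewrite big1 // => i _; rewrite big_bool /= joinxC.
  rewrite (@bigA_distr_bigA L \bot%O \top%O (@Order.meet disp L) join_law) /=.
  apply/joinsP => c _.
  apply: (@joins_min _ _ _ [set i | c i]%SET) => //.
  by rewrite /e; under [leRHS]eq_bigr do rewrite finset.inE.
have phiU f g : phi (f :|: g)%SET = (phi f `|` phi g)%O by exact: joins_setU.
have phiI f g : phi (f :&: g)%SET = (phi f `&` phi g)%O.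
  apply: le_anti; apply/andP; split.
    by apply/joinsP => S; rewrite finset.inE lexI => /andP[Sf Sg];
      rewrite !(@joins_sup _ _ _ S).
  rewrite /phi (@big_distrlr L \bot%O (@Order.meet disp L) join_law) /=; apply/joinsP => S Sf; apply/joinsP => T Tg.
  have [ST|/eI ->] := eqVneq S T; last exact: le0x.
  rewrite -ST in Tg *; rewrite meetxx.
  by apply: joins_sup; rewrite finset.inE Sf.
have phi0 : phi finset.set0 = (\bot)%O by exact: finset.big_set0.
have phiT : phi finset.setT = (\top)%O.
  by rewrite -eT; apply: eq_bigl => S; rewrite finset.inE.
have phiC f : phi (~: f)%SET = (~` phi f)%O.
  apply: le_anti; apply/andP; split.
    by rewrite -disj_leC -phiI finset.setIC finset.setICr phi0.
  have : (phi f `|` phi (~: f)%SET = \top)%O by rewrite -phiU finset.setUCr.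
  move=> H; rewrite -[leLHS]meetx1 -H meetUr [X in (X `|` _)%O]meetC meetxC join0x.
  exact: leIr.
have phiV i : phi (bvar i) = h i.
  apply: le_anti; apply/andP; split.
    apply/joinsP => S; rewrite finset.inE => iS; rewrite /e.
    by have := @meets_inf _ L _ i xpredT
      (fun i => if i \in S then h i else ~` h i)%O isT; rewrite iS.
  rewrite -[leLHS]meetx1 -eT (@big_distrr L \bot%O (@Order.meet disp L) join_law) /=; apply/joinsP => S _.
  have [iS|iS] := boolP (i \in S).
    by rewrite (le_trans (leIr _ _))// joins_sup// finset.inE.
  apply: (@le_trans _ _ (h i `&` ~` h i)%O); last by rewrite meetxC le0x.
  apply: leI2 => //; rewrite /e.
  by have := @meets_inf _ L _ i xpredT
    (fun i => if i \in S then h i else ~` h i)%O isT; rewrite (negbTE iS).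
exists phi; split => // psi [psiV psiU psiI psiC]; apply/funext => f.
have psi0 : psi finset.set0 = (\bot)%O.
  by rewrite -(finset.setICr (finset.set0 : freeBA N)) psiI psiC meetxC.
have psiT : psi finset.setT = (\top)%O.
  by rewrite -finset.setC0 psiC psi0 compl0.
have -> : f = (\bigcup_(S in f) \bigcap_i lit i S)%SET.
  apply/finset.setP => S; apply/idP/finset.bigcupP => [Sf|[T Tf /finset.bigcapP TS]].
    exists S => //; apply/finset.bigcapP => i _; rewrite /lit.
    by case: ifP => iS; rewrite !finset.inE iS.
  suff -> : S = T by [].
  apply/finset.setP => i; have := TS i isT.
  by rewrite /lit; case: ifP => iT; rewrite !finset.inE; [move->|move/negbTE->].
rewrite (big_morph _ psiU psi0) (big_morph _ phiU phi0).
apply: eq_bigr => S _.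
rewrite (big_morph _ psiI psiT) (big_morph _ phiI phiT).
by apply: eq_bigr => i _; rewrite /lit; case: ifP => _; rewrite ?psiC ?phiC psiV phiV.
Qed.

Section Measures.
Variables (R : realType) (N : nat).
Implicit Types (mu nu : freeBA N -> R) (f : freeBA N).

(* Real functions on the subset [inC] are represented by total functions whose
   values outside [inC] are never used. *)
Definition additive_on_C mu := forall f g, inC f -> inC g ->
  (f :&: g = finset.set0)%SET -> mu (f :|: g)%SET = mu f + mu g.

(* Below, [xget] selects the object determined by the stated property; the
   default 0 is used only when nothing satisfies it.  The value of [coef f] at
   the empty set is unconstrained and never used. *)
Definition coef f : {set 'I_N} -> int :=
  xget (fun=> 0) [set m : {set 'I_N} -> int | forall mu, additive_on_C mu ->
    mu f = \sum_(I : {set 'I_N} | I != finset.set0) (m I)%:~R * mu (bjoin I)].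

Definition zero_weight_ext mu : freeBA N -> R :=
  xget (fun=> 0) [set nu : freeBA N -> R |
    [/\ forall f, inC f -> nu f = mu f,
        forall f g, nu (f :|: g)%SET = nu f + nu g - nu (f :&: g)%SET &
        nu finset.setT = 0]].

End Measures.

Section ConvexGeometry.
Variable R : realType.

(* Iterated product of the one-dimensional Lebesgue measure, in the form used
   by the product measure [\x]: integrate the volume of the sections along the
   first coordinate.  It is the Lebesgue measure on Borel sets. *)
Fixpoint vol (n : nat) : set 'rV[R]_n -> \bar R :=
  match n return set 'rV[R]_n -> \bar R with
  | 0 => fun A => (\1_A 0)%:E
  | n'.+1 => fun A =>
      (\int[lebesgue_measure]_x
         vol [set v : 'rV[R]_n' | A (row_mx (x%:M : 'rV[R]_1) v)])%E
  end.

(* The library norm on row vectors is the sup norm. *)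
Definition enorm n (v : 'rV[R]_n) : R := Num.sqrt (\sum_i v 0 i ^+ 2).

Definition cball0 (n : nat) (r : R) : set 'rV[R]_n := [set v | enorm v <= r].

Definition kappa (n : nat) : R := fine (vol (@cball0 n 1)).

Definition parallel_body n (K : set 'rV[R]_n) (r : R) : set 'rV[R]_n :=
  [set x + y | x in K & y in @cball0 n r].

Definition conv_hull n (A : set 'rV[R]_n) : set 'rV[R]_n :=
  smallest (@convex_set R 'rV[R]_n) A.

(* The coefficients of Steiner's formula determine these for K nonempty, compact
   and convex; they are not meant to be used for other K. *)
Definition quermass d (K : set 'rV[R]_d) : 'I_d.+1 -> R :=
  xget (fun=> 0) [set W : 'I_d.+1 -> R | forall r : R, 0 <= r ->
    vol (parallel_body K r) =
      (\sum_(k < d.+1) 'C(d, k)%:R * W k * r ^+ k)%:E].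

Definition intrinsic_vol d (K : set 'rV[R]_d) : 'I_d.+1 -> R :=
  xget (fun=> 0) [set V : 'I_d.+1 -> R | forall r : R, 0 <= r ->
    vol (parallel_body K r) =
      (\sum_(k < d.+1) kappa (d - k) * V k * r ^+ (d - k))%:E].

Variables (N d : nat).
Implicit Types (p : 'I_N -> 'rV[R]_d) (k : 'I_d.+1) (f : freeBA N).

Definition hull_of p (I : {set 'I_N}) : set 'rV[R]_d :=
  conv_hull [set p i | i in [set` I]].

Definition bool_quermass f k p : R :=
  zero_weight_ext (fun g => \sum_(I : {set 'I_N} | I != finset.set0)
    (coef R g I)%:~R * quermass (hull_of p I) k) f.

Definition bool_intrinsic_vol f k p : R :=
  zero_weight_ext (fun g => \sum_(I : {set 'I_N} | I != finset.set0)
    (coef R g I)%:~R * intrinsic_vol (hull_of p I) k) f.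

End ConvexGeometry.

(* Main.v *)
Require Import Defs.
From mathcomp Require Import all_boot all_order all_algebra.
From mathcomp Require Import all_classical all_reals all_analysis.
From mathcomp Require Import measurable_realfun qpoly lra ring.
From HB Require Import structures.
Set Implicit Arguments.
Unset Strict Implicit.
Unset Printing Implicit Defensive.
Import Order.Theory GRing.Theory Num.Theory.
Import numFieldNormedType.Exports.
Local Open Scope ring_scope.

(** For fixed points, let [w J] be the polynomial r |-> vol (K_J + r B) of
Steiner's formula, where B is the unit ball of dimension d and K_J the convex
hull of the points with index in J; it vanishes when J is empty.  The geometric
content of the theorem is the reciprocity law

  sum over J \subset I of (-1)^|J| w_J(t)  =  - (-1)^d w_I(-t)

of [steiner_ball].  Reading off one coefficient gives, for U(I) = V_k(K_I) or
W_k(K_I),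

  sum over J \subset I of (-1)^|J| U(J)  =  - sigma U(I),

where sigma is the sign in the theorem, (-1)^k or (-1)^(d-k).

From this law to the theorem.  A zero-weight extension is the sum of a weight
over the atoms of the free Boolean algebra, with total mass 0; its values U(I)
on the joins of variables determine the weights by Moebius inversion
([zero_weight_extE]).  Since the total mass is 0, complementing f changes the
sign, which gives the equality between dual and contradual ([weightedC]).  The
contradual replaces each atom by the opposite one, so the other equality is a
relation between the weights of opposite atoms.  The atoms inside the complement
of I have mass - U(I); by inclusion-exclusion the atoms containing I have mass
- sum_J (-1)^|J| U(J), which is sigma U(I) by the law.  By Moebius inversion, the
weights of opposite atoms differ by the factor - sigma ([weighted_contradual]).

The law for volumes (t = 0).  A point x lies in K_J when the vectors p_i - x,
i in J, admit a nonzero relation with nonnegative coefficients.  Counting these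
J with sign is a matter of Euler's relation for a family of vectors
([cone_euler]): if K_I has interior points, the count is - (-1)^d on its interior
and 0 elsewhere.  Integrating over x gives [fvol_hull_euler].  Euler's relation
itself is proved by reversing the vectors one at a time until no relation with
nonnegative coefficients is left.

The law for zonotopes.  Adding a segment of half-length t in direction a to a
convex body K increases its volume by t times a constant times the volume of the
projection of K along a ([vol_seg_sum]).  Projections commute with convex hulls
and with sums, and lower the dimension by one, so an induction on the number of
segments extends the law from volumes to K_J + t Z for every zonotope Z
([steiner_zonotope]).

The law for balls.  Zonotopes approximate the ball.  A zonotope with generators
a lies between the balls of radii 1 - eps and 1 + eps as soon as its support
function, the sum of the |<u, a>|, does so on the unit sphere
([zonotope_sub_ball], [ball_sub_zonotope]).  Taking for the generators the end
points of a long random walk with small steps along the axes, this sum is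
proportional to the first absolute moment of a walk on the line, and Lindeberg's
replacement method shows that it hardly depends on the unit vector u
([almost_euclidean]).  The volumes of K_J + r Z then converge to those of
K_J + r B; being polynomials of bounded degree in r, they converge at every real
number, and the law passes to the limit. *)

(** * Alternating sums over subsets *)

Section AlternatingSums.
Variables (T : finType) (V : zmodType).
Implicit Types (I J : {set T}) (G : {set T} -> V).

Lemma sum_subset_setU1 (a : T) I G : a \notin I ->
  \sum_(J : {set T} | J \subset a |: I) G J =
  \sum_(J : {set T} | J \subset I) G J +
  \sum_(J : {set T} | J \subset I) G (a |: J)%SET.
Proof.
move=> aI; rewrite (bigID (fun J : {set T} => a \in J)) /= addrC; congr (_ + _).
  by apply: eq_bigl => J; rewrite -subsetD1 finset.setU1K.
rewrite (reindex_onto (fun J => a |: J)%SET (fun J => J :\ a)%SET); last first.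
  by move=> J /andP[_ aJ]; rewrite finset.setD1K.
apply: eq_bigl => J; rewrite finset.setU11 andbT.
have [aJ|aJ] := boolP (a \in J).
  rewrite (_ : (_ == J) = false) /=; last first.
    by apply/eqP => E; move: aJ; rewrite -E finset.setD11.
  rewrite andbF; apply/esym/negP => /fintype.subsetP/(_ _ aJ); exact/negP.
rewrite finset.setU1K // eqxx andbT; apply/idP/idP; last exact: finset.setUS.
move/(finset.setSD [set a]%SET); rewrite !finset.setU1K//.
Qed.

End AlternatingSums.

Lemma setU1_ind (T : finType) (P : {set T} -> Prop) : P finset.set0 ->
  (forall (a : T) (I : {set T}), a \notin I -> P I -> P (a |: I)%SET) -> forall I, P I.
Proof.
move=> P0 PS I; elim: {I}#|I| {-2}I (erefl #|I|) => [I /eqP|m IH I mI].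
  by rewrite finset.cards_eq0 => /eqP ->.
have /card_gt0P[a aI] : (0 < #|I|)%N by rewrite mI.
rewrite -(finset.setD1K aI); apply: PS; rewrite ?finset.setD11//.
by apply: IH; move: mI; rewrite (finset.cardsD1 a) aI add1n => -[].
Qed.

Lemma alternating_sum_subset (T : finType) (R : pzRingType) (I : {set T}) :
  \sum_(J : {set T} | J \subset I) (-1) ^+ #|J| = (I == finset.set0)%:R :> R.
Proof.
have [->|[a aI]] := finset.set_0Vmem I.
  by rewrite eqxx (eq_bigl _ _ (fun J => finset.subset0 J)) big_pred1_eq finset.cards0 expr0.
rewrite -(finset.setD1K aI) sum_subset_setU1 ?finset.setD11// -big_split /=.
rewrite big1 => [|J JI].
  by rewrite (_ : (_ == _) = false)//; apply/negbTE/finset.set0Pn; exists a; rewrite finset.setU11.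
rewrite finset.cardsU1 (_ : a \notin J) ?add1n ?exprS ?mulN1r ?subrr//.
by apply: contraTN JI => aJ; apply/fintype.subsetPn; exists a; rewrite ?finset.setD11.
Qed.

(** * Euler's relation for families of vectors *)

Section ConeEuler.
Variables (F : realFieldType) (N n : nat).
Implicit Types (q : 'I_N -> 'rV[F]_n) (W : 'M[F]_n) (I J s : {set 'I_N}) (a : 'I_N).

(** Relations are taken modulo the row space of [W], so that eliminating a vector
amounts to enlarging [W] by it.  For [W = 0], the origin lies in the convex hull
of the [q i], [i \in J]. *)
Definition dependent q W J := exists l : 'I_N -> F,
  [/\ forall i, i \in J -> 0 <= l i, exists2 i, i \in J & l i != 0
    & ((\sum_(i in J) l i *: q i)%R <= W)%MS].

(** For [W = 0] and [J] nonempty, the origin lies in the relative interior of the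
convex hull of the [q i], [i \in J]. *)
Definition balanced q W J := exists2 l : 'I_N -> F,
  forall i, i \in J -> 0 < l i & ((\sum_(i in J) l i *: q i)%R <= W)%MS.

Definition flip a q : 'I_N -> 'rV[F]_n := fun i => if i == a then - q i else q i.

Lemma sum_flip a q (l : 'I_N -> F) J : a \notin J ->
  \sum_(i in J) l i *: flip a q i = \sum_(i in J) l i *: q i.
Proof.
move=> aJ; apply: eq_bigr => i iJ; rewrite /flip; case: eqP => // ia.
by move: aJ; rewrite -ia iJ.
Qed.

Lemma dependent_flip a q W J : a \notin J ->
  dependent (flip a q) W J <-> dependent q W J.
Proof.
by move=> aJ; split => -[l [l0 l1 lW]]; exists l; split=> //; move: lW; rewrite sum_flip.
Qed.

Lemma dependentS q W J J' : J \subset J' -> dependent q W J -> dependent q W J'.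
Proof.
move=> /fintype.subsetP JJ' [l [l0 [i iJ li] lW]].
exists (fun i => if i \in J then l i else 0); split.
- by move=> j _; case: ifP => // /l0.
- by exists i; [exact: JJ'|rewrite iJ].
- rewrite (bigID (mem J)) /= [X in _ + X]big1 ?addr0; last first.
    by move=> j /andP[_ /negbTE jJ]; rewrite jJ scale0r.
  rewrite (eq_bigl (fun j => j \in J)); last first.
    by move=> j /=; case: (boolP (j \in J)) => [/JJ' ->|]; rewrite ?andbF.
  by under eq_bigr => j jJ do rewrite jJ.
Qed.

Section Insert.
Variables (a : 'I_N) (q : 'I_N -> 'rV[F]_n) (W : 'M[F]_n) (J : {set 'I_N}).
Hypotheses (aJ : a \notin J) (qaW : ~~ (q a <= W)%MS).

Let sum_split (l : 'I_N -> F) (p : 'I_N -> 'rV[F]_n) :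
  \sum_(i in (a |: J)%SET) l i *: p i = l a *: p a + \sum_(i in J) l i *: p i.
Proof. by rewrite big_setU1. Qed.

Let W' := (W + q a)%MS.

Let upd (l : 'I_N -> F) c := fun i => if i == a then c else l i.

Let sum_upd l c (p : 'I_N -> 'rV[F]_n) :
  \sum_(i in (a |: J)%SET) upd l c i *: p i = c *: p a + \sum_(i in J) l i *: p i.
Proof.
rewrite sum_split /upd eqxx; congr (_ + _); apply: eq_bigr => i iJ.
by case: eqP => // ia; move: aJ; rewrite -ia iJ.
Qed.

Let upd_in l c i : i \in J -> upd l c i = l i.
Proof. by move=> iJ; rewrite /upd; case: eqP => // ia; move: aJ; rewrite -ia iJ. Qed.

Let flip_a : flip a q a = - q a. Proof. by rewrite /flip eqxx. Qed.

Let addsub (c : F) (v : 'rV[F]_n) : ((c *: q a + v)%R <= W)%MS -> (v <= W')%MS.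
Proof.
move=> h; rewrite (_ : v = (c *: q a + v) - c *: q a); last by rewrite addrAC subrr add0r.
apply: addmx_sub; first exact: submx_trans h (addsmxSl _ _).
by rewrite -scaleNr scalemx_sub // addsmxSr.
Qed.

Let splitW' (v : 'rV[F]_n) : (v <= W')%MS -> exists c, ((c *: q a + v)%R <= W)%MS.
Proof.
move=> /sub_addsmxP[[u1 u2] /= ->]; exists (- u2 0 0).
rewrite [u2]mx11_scalar mul_scalar_mx !mxE /= mulr1n addrC -addrA scaleNr subrr addr0.
exact: submxMl.
Qed.

Lemma dependent_setU1 : dependent q W J -> dependent q W (a |: J)%SET.
Proof. exact/dependentS/finset.subsetUr. Qed.

Lemma dependent_quot : dependent q W J -> dependent q W' J.
Proof.
by move=> [l [? ? h]]; exists l; split => //; exact: submx_trans h (addsmxSl _ _).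
Qed.

Let dep_quot (p : 'I_N -> 'rV[F]_n) (e : F) : p a = e *: q a -> e != 0 ->
  (forall i, i \in J -> p i = q i) -> dependent p W (a |: J)%SET ->
  dependent q W' J.
Proof.
move=> pa e0 pJ [l [l0 [i iJ li]]]; rewrite sum_split => h.
have h' : ((l a * e *: q a + \sum_(i in J) l i *: q i)%R <= W)%MS.
  by rewrite -scalerA -pa; under [X in _ + X]eq_bigr => j jJ do rewrite -pJ//.
exists l; split; last exact: addsub h'.
- by move=> j jJ; apply: l0; rewrite finset.inE jJ orbT.
- have [/forallP lJ|] := boolP [forall (j | j \in J), l j == 0]; last first.
    by move=> /forallPn[j]; rewrite negb_imply => /andP[jJ lj]; exists j.
  have la : l a != 0.
    move: iJ; rewrite !finset.inE => /orP[/eqP <-//|iJ].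
    by move: (lJ i); rewrite iJ (negbTE li).
  exfalso; move/negP: qaW; apply.
  move: h'; rewrite big1 ?addr0; last first.
    by move=> j jJ; move: (lJ j); rewrite jJ => /eqP ->; rewrite scale0r.
  by rewrite (eqmx_scale (q a) (mulf_neq0 la e0)).
Qed.

Lemma dependent_quotP : dependent q W' J ->
  dependent q W (a |: J)%SET \/ dependent (flip a q) W (a |: J)%SET.
Proof.
move=> [l [l0 [i iJ li] /splitW'[c cW]]].
have [c0|c0] := leP 0 c; [left; exists (upd l c)|right; exists (upd l (- c))]; split.
- by move=> j; rewrite !finset.inE /upd; case: eqP => //= _ /l0.
- by exists i; [rewrite finset.inE iJ orbT|rewrite upd_in].
- by rewrite sum_upd.
- by move=> j; rewrite !finset.inE /upd; case: eqP => //= _ => [_|/l0//]; rewrite oppr_ge0 ltW.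
- by exists i; [rewrite finset.inE iJ orbT|rewrite upd_in].
- by rewrite sum_upd sum_flip// flip_a scaleNr scalerN opprK.
Qed.

Lemma dependent_both : dependent q W (a |: J)%SET ->
  dependent (flip a q) W (a |: J)%SET -> dependent q W J.
Proof.
move=> [l [l0 [i iJ li] lW]] [m [m0 [j jJ mj] mW]].
have la0 : 0 <= l a by apply: l0; rewrite finset.setU11.
have ma0 : 0 <= m a by apply: m0; rewrite finset.setU11.
move: lW mW; rewrite !sum_split flip_a sum_flip// scalerN => lW mW.
have [la|la] := eqVneq (l a) 0.
  exists l; split; first by move=> k kJ; apply: l0; rewrite finset.inE kJ orbT.
    exists i => //; move: iJ; rewrite !finset.inE => /orP[/eqP E|//].
    by rewrite E la eqxx in li.
  by move: lW; rewrite la scale0r add0r.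
have [ma|ma] := eqVneq (m a) 0.
  exists m; split; first by move=> k kJ; apply: m0; rewrite finset.inE kJ orbT.
    exists j => //; move: jJ; rewrite !finset.inE => /orP[/eqP E|//].
    by rewrite E ma eqxx in mj.
  by move: mW; rewrite ma scale0r oppr0 add0r.
have [/forallP lJ|] := boolP [forall (j | j \in J), l j == 0].
  exfalso; move/negP: qaW; apply.
  move: lW; rewrite big1 ?addr0; last first.
    by move=> k kJ; move: (lJ k); rewrite kJ => /eqP ->; rewrite scale0r.
  by rewrite (eqmx_scale (q a) la).
move=> /forallPn[k]; rewrite negb_imply => /andP[kJ lk].
have lk0 x : x \in J -> 0 <= l x by move=> xJ; apply: l0; rewrite finset.inE xJ orbT.
have mk0 x : x \in J -> 0 <= m x by move=> xJ; apply: m0; rewrite finset.inE xJ orbT.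
(* The multiples by [m a] and [l a] of the two relations cancel on [q a]. *)
exists (fun x => m a * l x + l a * m x); split.
- by move=> x xJ; rewrite addr_ge0// mulr_ge0// ?lk0 ?mk0.
- exists k => //; rewrite gt_eqF// ltr_wpDr ?mulr_ge0 ?mk0//.
  by rewrite mulr_gt0// lt_def ?ma ?lk ?lk0.
- rewrite (_ : \sum_(_ in J) _ = m a *: (l a *: q a + \sum_(i in J) l i *: q i)
     + l a *: (- (m a *: q a) + \sum_(i in J) m i *: q i)).
    by apply: addmx_sub; exact: scalemx_sub.
  rewrite !scalerDr !scalerN !scalerA addrACA (mulrC (l a)) subrr add0r.
  rewrite !scaler_sumr -big_split /=; apply: eq_bigr => x _.
  by rewrite !scalerA -scalerDl.
Qed.

(** A relation modulo [q a] lifts to a relation in which [q a] has some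
coefficient.  Its sign decides whether [q] or the reversed family is dependent,
and if both are, a positive combination of their relations eliminates [q a]. *)
Lemma dependent_insert :
  (~~ `[< dependent q W (a |: J)%SET >])%:R +
  (~~ `[< dependent (flip a q) W (a |: J)%SET >])%:R =
  (~~ `[< dependent q W J >])%:R + (~~ `[< dependent q W' J >])%:R :> F.
Proof.
have h1 := dependent_setU1.
have h2 : dependent q W J -> dependent (flip a q) W (a |: J)%SET.
  by move/(dependent_flip q W aJ)/(dependentS (finset.subsetUr [set a] J)).
have h3 := dependent_quot.
have h4 : dependent q W (a |: J)%SET -> dependent q W' J.
  by apply: (dep_quot (e := 1)); rewrite ?scale1r ?oner_eq0.
have h5 : dependent (flip a q) W (a |: J)%SET -> dependent q W' J.
  apply: (dep_quot (e := -1)); rewrite ?scaleN1r ?flip_a ?oppr_eq0 ?oner_eq0// => i iJ.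
  by rewrite /flip; case: eqP => // ia; move: aJ; rewrite -ia iJ.
have h6 := dependent_quotP; have h7 := dependent_both.
do 4 case: asboolP => //; rewrite /= ?addr0 ?add0r//; tauto.
Qed.

Let span : 'M[F]_n := (\sum_(i in J) <<q i>>)%MS.

Lemma balanced_quot (p : 'I_N -> 'rV[F]_n) (e : F) : p a = e *: q a ->
  (forall i, i \in J -> p i = q i) -> balanced p W (a |: J)%SET -> balanced q W' J.
Proof.
move=> pa pJ [l l0]; rewrite sum_split => h.
exists l; first by move=> j jJ; apply: l0; rewrite finset.inE jJ orbT.
apply: (addsub (c := l a * e)).
by rewrite -scalerA -pa; under [X in _ + X]eq_bigr => j jJ do rewrite -pJ//.
Qed.

Lemma balanced_quotP : balanced q W' J ->
  [\/ balanced q W J, balanced q W (a |: J)%SET | balanced (flip a q) W (a |: J)%SET].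
Proof.
move=> [l l0 /splitW'[c cW]].
have [c0|c0|c0] := ltgtP 0 c; [constructor 2|constructor 3|constructor 1].
- exists (upd l c); last by rewrite sum_upd.
  by move=> j; rewrite !finset.inE /upd; case: eqP => //= _ /l0.
- exists (upd l (- c)); last by rewrite sum_upd sum_flip// flip_a scaleNr scalerN opprK.
  by move=> j; rewrite !finset.inE /upd; case: eqP => //= _ => [_|/l0//]; rewrite oppr_gt0.
- by exists l => //; move: cW; rewrite -c0 scale0r add0r.
Qed.

Lemma balanced_both : balanced q W (a |: J)%SET ->
  balanced (flip a q) W (a |: J)%SET -> balanced q W J.
Proof.
move=> [l l0 lW] [m m0 mW].
have la0 : 0 < l a by apply: l0; rewrite finset.setU11.
have ma0 : 0 < m a by apply: m0; rewrite finset.setU11.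
move: lW mW; rewrite !sum_split flip_a sum_flip// scalerN => lW mW.
(* The multiples by [m a] and [l a] of the two relations cancel on [q a]. *)
exists (fun x => m a * l x + l a * m x).
  move=> x xJ; have xaJ : x \in (a |: J)%SET by rewrite finset.inE xJ orbT.
  by rewrite addr_gt0// mulr_gt0// ?l0 ?m0.
rewrite (_ : \sum_(_ in J) _ = m a *: (l a *: q a + \sum_(i in J) l i *: q i)
     + l a *: (- (m a *: q a) + \sum_(i in J) m i *: q i)).
  by apply: addmx_sub; exact: scalemx_sub.
rewrite !scalerDr !scalerN !scalerA addrACA (mulrC (l a)) subrr add0r.
rewrite !scaler_sumr -big_split /=; apply: eq_bigr => x _.
by rewrite !scalerA -scalerDl.
Qed.

Let spanP (v : 'rV[F]_n) : (v <= W + span)%MS ->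
  exists c : 'I_N -> F, ((v - \sum_(i in J) c i *: q i)%R <= W)%MS.
Proof.
move=> /sub_addsmxP[[u1 u2] /= ->].
have /sub_sumsmxP[u E] : (u2 *m span <= span)%MS by exact: submxMl.
have : forall i, exists c, u i *m <<q i>>%MS = c *: q i.
  by move=> i; apply/sub_rVP/(submx_trans (submxMl _ _)); rewrite genmxE.
move=> /choice[c cE]; exists c; rewrite E.
rewrite (eq_bigr (fun i => c i *: q i)) => [|i _]; last exact: cE.
by rewrite addrK submxMl.
Qed.

(** A large multiple of a relation with positive coefficients absorbs the
coefficients of any other relation. *)
Lemma balanced_span (p : 'I_N -> 'rV[F]_n) : (p a <= W + span)%MS ->
  (forall i, i \in J -> p i = q i) ->
  balanced q W J -> balanced p W (a |: J)%SET.
Proof.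
move=> /spanP[c cW] pJ [l l0 lW].
(* [M * l i] exceeds [c i] for every [i] in [J]. *)
pose M := \sum_(i in J) `|c i| / l i + 1.
have Ml i : i \in J -> 0 < M * l i - c i.
  move=> iJ; rewrite subr_gt0; apply: le_lt_trans (ler_norm _) _.
  rewrite -ltr_pdivrMr ?l0// /M (bigD1 i)//= -addrA ltrDl ltr_wpDl// sumr_ge0//.
  by move=> j /andP[jJ _]; rewrite divr_ge0// ltW// l0.
exists (upd (fun i => M * l i - c i) 1).
  by move=> j; rewrite !finset.inE /upd; case: eqP => //= _ /Ml.
rewrite sum_upd scale1r.
rewrite (_ : \sum_(_ in J) _ = M *: (\sum_(i in J) l i *: q i) - \sum_(i in J) c i *: q i).
  by rewrite addrCA; apply: addmx_sub => //; exact: scalemx_sub.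
rewrite scaler_sumr -sumrB; apply: eq_bigr => i iJ.
by rewrite scalerBl scalerA pJ.
Qed.

Lemma balanced_nospan (p : 'I_N -> 'rV[F]_n) : ~~ (p a <= W + span)%MS ->
  (forall i, i \in J -> p i = q i) -> ~ balanced p W (a |: J)%SET.
Proof.
move=> /negP paW pJ [l l0]; rewrite sum_split => h; apply: paW.
have la0 : l a != 0 by rewrite gt_eqF// l0// finset.setU11.
rewrite -(eqmx_scale (p a) la0).
rewrite -[_ *: _](addrK (\sum_(i in J) l i *: p i)).
apply: addmx_sub; first exact: submx_trans h (addsmxSl _ _).
rewrite -scaleN1r; apply/scalemx_sub/(submx_trans _ (addsmxSr _ _)).
apply: summx_sub => i iJ; apply: scalemx_sub; rewrite pJ//.
by apply: (sumsmx_sup i) => //; rewrite genmxE.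
Qed.

(** The relations are lifted as in [dependent_insert].  The sign on the right comes
from the case where [J] is balanced: then both [a |: J] and its reversal are
balanced if [q a] is spanned, and neither of them is otherwise. *)
Lemma balanced_insert :
  (`[< balanced q W (a |: J)%SET >])%:R +
  (`[< balanced (flip a q) W (a |: J)%SET >])%:R =
  (`[< balanced q W' J >])%:R +
  (if (q a <= W + span)%MS then 1 else -1) * (`[< balanced q W J >])%:R :> F.
Proof.
have flipJ i : i \in J -> flip a q i = q i.
  by move=> iJ; rewrite /flip; case: eqP => // ia; move: aJ; rewrite -ia iJ.
have h1 : balanced q W (a |: J)%SET -> balanced q W' J.
  by apply: (balanced_quot (e := 1)); rewrite ?scale1r.
have h2 : balanced (flip a q) W (a |: J)%SET -> balanced q W' J.
  by apply: (balanced_quot (e := -1)); rewrite ?scaleN1r ?flip_a.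
have h3 := balanced_both; have h4 := balanced_quotP.
have h0 : balanced q W J -> balanced q W' J.
  by move=> [l ? h]; exists l => //; exact: submx_trans h (addsmxSl _ _).
case: ifPn => [qs|qs]; rewrite ?mul1r ?mulN1r.
  have h5 := balanced_span qs (fun _ _ => erefl).
  have h6 : balanced q W J -> balanced (flip a q) W (a |: J)%SET.
    by apply: balanced_span => //; rewrite flip_a eqmx_opp.
  have h7 := balanced_quotP.
  do 4 case: asboolP => //; rewrite /= ?addr0 ?add0r//; try tauto.
  move=> p1 p2 p3 p4; exfalso; move: (h7 p2); case; tauto.
have h5 := balanced_nospan qs (fun _ _ => erefl).
have h6 : ~ balanced (flip a q) W (a |: J)%SET.
  by apply: balanced_nospan => //; rewrite flip_a eqmx_opp.
do 4 case: asboolP => //; rewrite /= ?addr0 ?add0r ?subrr ?oppr0//; try tauto.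
by move=> p1 p2 p3 p4; exfalso; move: (h4 p2); case; tauto.
Qed.

End Insert.

Lemma rank_adds1 (A : 'M[F]_n) (v : 'rV[F]_n) :
  \rank (A + v)%MS = (\rank A + ~~ (v <= A)%MS)%N.
Proof.
have [vA|vA] := boolP (v <= A)%MS; first by rewrite addn0 (addsmx_idPl vA).
have := mxrank_sum_cap A v.
have rv : \rank v = 1%N.
  by rewrite rank_rV (_ : v != 0)//; apply: contraNneq vA => ->; exact: sub0mx.
suff -> : \rank (A :&: v)%MS = 0%N by rewrite addn0 rv.
apply/eqP; rewrite mxrank_eq0; apply/eqP/eqmx0P; rewrite andbC sub0mx /=.
apply: contraNT vA => nz.
have le1 : (\rank v <= \rank (A :&: v))%N.
  by rewrite rv lt0n mxrank_eq0; apply: contraNneq nz => ->; exact: submx_refl.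
have := capmxSr A v; move=> /mxrank_leqif_sup/geq_leqif; rewrite le1 => /esym vA.
exact: submx_trans vA (capmxSl _ _).
Qed.

Definition span_over q W I : 'M[F]_n := (W + \sum_(i in I) <<q i>>)%MS.

Lemma span_over_setU1 q W a I : a \notin I ->
  (span_over q W (a |: I)%SET :=: span_over q (W + q a)%MS I)%MS.
Proof.
move=> aI; rewrite /span_over big_setU1//=.
apply: eqmx_trans (adds_eqmx (eqmx_refl W) (adds_eqmx (genmxE _) (eqmx_refl _))) _.
by rewrite addsmxA.
Qed.

Lemma rank_span_over_setU1 q W a I : a \notin I ->
  \rank (span_over q W (a |: I)%SET) =
  (\rank (span_over q W I) + ~~ (q a <= span_over q W I)%MS)%N.
Proof.
move=> aI; rewrite span_over_setU1// -rank_adds1 /span_over -!addsmxA.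
by rewrite [(q a + _)%MS]addsmxC.
Qed.

Definition euler_sum q W I : F := \sum_(J : {set 'I_N} | J \subset I)
  (-1) ^+ #|J| * (~~ `[< dependent q W J >])%:R.

Lemma euler_sum_flip q W a I : a \notin I -> ~~ (q a <= W)%MS ->
  euler_sum q W (a |: I)%SET + euler_sum (flip a q) W (a |: I)%SET =
  euler_sum q W I - euler_sum q (W + q a)%MS I.
Proof.
move=> aI qaW.
have aJ (J : {set 'I_N}) : J \subset I -> a \notin J.
  by move=> JI; apply: contraNN aI => /(fintype.subsetP JI).
rewrite /euler_sum !sum_subset_setU1// -!big_split -sumrB /=; apply: eq_bigr => J JI.
have -> : `[< dependent (flip a q) W J >] = `[< dependent q W J >].
  exact/asbool_equiv_eq/dependent_flip/aJ.
have := dependent_insert (aJ _ JI) qaW.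
rewrite finset.cardsU1 (aJ _ JI) exprS mulN1r.
set x := (_ : F) ^+ _.
set y1 := (~~ _)%:R; set y2 := (~~ _)%:R; set y3 := (~~ _)%:R; set y4 := (~~ _)%:R.
move=> E; have -> : y1 = y3 + y4 - y2 by rewrite -E addrK.
ring.
Qed.

(** The exponent has the parity of the dimension of the span of the family modulo
[W]. *)
Definition cone_euler_at q W I := euler_sum q W I =
  (-1) ^+ (\rank (span_over q W I) + \rank W) * (`[< balanced q W I >])%:R.

(** By [dependent_insert] and [balanced_insert], both sides of the relation change
in the same way when [q a] is reversed, the difference being expressed by the
relations for [I]. *)
Lemma cone_euler_flip q W a I : a \notin I -> ~~ (q a <= W)%MS ->
  cone_euler_at q W I -> cone_euler_at q (W + q a)%MS I ->
  cone_euler_at (flip a q) W (a |: I)%SET -> cone_euler_at q W (a |: I)%SET.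
Proof.
rewrite /cone_euler_at => aI qaW E1 E2 E3.
have := euler_sum_flip aI qaW; rewrite {}E1 {}E2 {}E3.
have -> : \rank (span_over (flip a q) W (a |: I)%SET) = \rank (span_over q W (a |: I)%SET).
  have sf : span_over (flip a q) W I = span_over q W I.
    rewrite /span_over; congr (_ + _)%MS; apply: eq_bigr => i iI.
    by rewrite /flip; case: eqP => // ia; move: aI; rewrite -ia iI.
  by rewrite !rank_span_over_setU1// sf /flip eqxx eqmx_opp.
rewrite -(span_over_setU1 _ _ aI) rank_adds1 qaW.
have := balanced_insert q W aI.
rewrite rank_span_over_setU1// -/(span_over q W I).
rewrite !exprD.
set x := (-1) ^+ _; set y := (-1) ^+ \rank W.
set S1 := euler_sum _ _ _.
move: (`[< balanced q W (a |: I)%SET >]) (`[< balanced (flip a q) W (a |: I)%SET >])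
  (`[< balanced q (W + q a)%MS I >]) (`[< balanced q W I >]) => b1 b2 b3 b4.
move=> bal /(canRL (addrK _)) ->.
have -> : b1%:R = b3%:R + (if (q a <= span_over q W I)%MS then 1 else -1) * b4%:R - b2%:R :> F.
  by rewrite -bal addrK.
case: (q a <= _)%MS => /=; rewrite ?expr0 ?expr1; ring.
Qed.

Definition flips (s : {set 'I_N}) q : 'I_N -> 'rV[F]_n :=
  fun i => if i \in s then - q i else q i.

Lemma flips_setU1 s a q : a \notin s -> flips (a |: s)%SET q = flip a (flips s q).
Proof.
move=> asn; apply/funext => i; rewrite /flips /flip !finset.inE.
by case: eqP => //= ->; rewrite (negbTE asn).
Qed.

(** The signs are chosen one vector at a time: by [dependent_both], a new vector or
its opposite can be added without creating a relation. *)
Lemma exists_independent_flips q W I : (forall i, i \in I -> ~~ (q i <= W)%MS) ->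
  exists2 s : {set 'I_N}, s \subset I & ~ dependent (flips s q) W I.
Proof.
elim/setU1_ind : I => [|a I aI IH] qW.
  by exists finset.set0; rewrite ?finset.sub0set// => -[l [_ [i]]]; rewrite finset.inE.
have [i iI|s sI ds] := IH; first by apply: qW; rewrite finset.inE iI orbT.
have as_ : a \notin s by apply: contraNN aI => /(fintype.subsetP sI).
have qa : flips s q a = q a by rewrite /flips (negbTE as_).
have qaW : ~~ (flips s q a <= W)%MS by rewrite qa qW// finset.setU11.
have [d|d] := pselect (dependent (flips s q) W (a |: I)%SET); last first.
  by exists s => //; apply: fintype.subset_trans sI (finset.subsetUr _ _).
exists (a |: s)%SET; first exact: finset.setUS.
by rewrite flips_setU1// => /(dependent_both aI qaW d).
Qed.

(** A vector that vanishes modulo [W] makes every subfamily containing it dependent,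
so it changes neither side. *)
Lemma cone_euler_mem q W a I : a \notin I -> (q a <= W)%MS ->
  cone_euler_at q W I -> cone_euler_at q W (a |: I)%SET.
Proof.
rewrite /cone_euler_at => aI qaW E.
rewrite /euler_sum sum_subset_setU1// [X in _ + X]big1 ?addr0 => [|J JI].
  rewrite -/(euler_sum q W I) E rank_span_over_setU1//.
  rewrite (_ : (q a <= span_over q W I)%MS) ?addn0; last exact: submx_trans qaW (addsmxSl _ _).
  congr (_ * _%:R); congr nat_of_bool; apply: asbool_equiv_eq; split.
    move=> [l l0 lW]; exists (fun i => if i == a then 1 else l i).
      by move=> i; rewrite !finset.inE; case: eqP => // _ /l0.
    rewrite big_setU1//= eqxx scale1r; apply: addmx_sub => //.
    rewrite (eq_bigr (fun i => l i *: q i)) => [//|i iI].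
    by case: eqP => // ia; move: aI; rewrite -ia iI.
  move=> [l l0 lW]; exists l; first by move=> i iI; apply: l0; rewrite finset.inE iI orbT.
  move: lW; rewrite big_setU1//= addrC => lW.
  rewrite -[X in (X <= _)%MS](addrK (l a *: q a)); apply: addmx_sub => //.
  by rewrite eqmx_opp scalemx_sub.
rewrite (_ : `[< _ >]) ?mulr0//; apply/asboolP.
have aJ : a \notin J by apply: contraNN aI => /(fintype.subsetP JI).
exists (fun i => (i == a)%:R); split=> //.
- by exists a; rewrite ?finset.setU11// eqxx oner_eq0.
- rewrite big_setU1//= eqxx scale1r big1 ?addr0// => i iJ.
  by case: eqP => ia; rewrite ?scale0r//; move: aJ; rewrite -ia iJ.
Qed.

Lemma balanced_dependent q W I : I != finset.set0 -> balanced q W I -> dependent q W I.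
Proof.
move=> /finset.set0Pn[a aI] [l l0 lW]; exists l; split=> // [i /l0/ltW//|].
by exists a => //; rewrite gt_eqF// l0.
Qed.

Lemma cone_euler_independent q W I : ~ dependent q W I -> cone_euler_at q W I.
Proof.
move=> nd; rewrite /cone_euler_at /euler_sum.
under eq_bigr => J JI.
  rewrite (_ : `[< _ >] = false) ?mulr1; last by apply/asboolPn => /(dependentS JI).
  over.
rewrite alternating_sum_subset; have [->|I0] := eqVneq I finset.set0.
  rewrite (_ : `[< _ >]) ?mulr1; last first.
    by apply/asboolP; exists (fun=> 0) => [i|]; rewrite ?finset.inE// big_set0 sub0mx.
  by rewrite /span_over big_set0 addsmx0 addnn -signr_odd odd_double.
rewrite (_ : `[< _ >] = false) ?mulr0//; apply/asboolPn.
by move=> /(balanced_dependent I0).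
Qed.

(** For an independent family the left-hand side is the alternating sum over all
subsets.  The general case follows by reversing vectors, with the relations for
smaller index sets supplied by induction. *)
Theorem cone_euler q W I : cone_euler_at q W I.
Proof.
move: {2}#|I| (leqnn #|I|) => m; elim: m q W I => [|m IH] q W I mI.
  apply: cone_euler_independent => -[l [_ [i iI]]].
  by move: mI; rewrite leqNgt (cardD1 i) iI.
have [/exists_inP[a aI qaW]|/exists_inPn qW] := boolP [exists a in I, (q a <= W)%MS].
  rewrite -(finset.setD1K aI); apply: cone_euler_mem; rewrite ?finset.setD11//.
  by apply: IH; rewrite -ltnS (leq_trans _ mI)// [X in (_ < X)%N](finset.cardsD1 a) aI.
have [s sI /cone_euler_independent] := exists_independent_flips qW.
elim/setU1_ind : s sI => [_|a s as_ IHs asI].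
  by congr cone_euler_at; apply/funext => i; rewrite /flips finset.inE.
rewrite flips_setU1// => E; apply: IHs.
  exact: fintype.subset_trans (finset.subsetUr _ _) asI.
have aI : a \in I by apply: (fintype.subsetP asI); rewrite finset.setU11.
rewrite -(finset.setD1K aI) in E *.
have Im : (#|I :\ a| <= m)%N.
  by rewrite -ltnS (leq_trans _ mI)// [X in (_ < X)%N](finset.cardsD1 a) aI.
apply: cone_euler_flip E; rewrite ?finset.setD11//; try exact: IH.
by rewrite /flips (negbTE as_) qW.
Qed.

End ConeEuler.

(** * Volume as a product measure *)

Section VolumeMeasure.
Local Open Scope classical_set_scope.
Local Open Scope ring_scope.
Variable R : realType.
Let mR := measurableTypeR R.

Definition row_of n (t : n.-tuple mR) : 'rV[R]_n := \row_i tnth t i.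
Definition tuple_of_row n (v : 'rV[R]_n) : n.-tuple mR := [tuple v 0 i | i < n].

Lemma tuple_of_rowK n : cancel (@tuple_of_row n) (@row_of n).
Proof. by move=> v; apply/rowP => i; rewrite mxE tnth_mktuple. Qed.

Definition pt n (x : R) (v : 'rV[R]_n) : 'rV[R]_n.+1 :=
  row_mx (x%:M : 'rV[R]_1) v.

Lemma pt0 n x (v : 'rV[R]_n) : pt x v 0 ord0 = x.
Proof.
transitivity ((row_mx (x%:M : 'rV[R]_1) v) 0 (lshift n ord0)).
  by congr (row_mx _ _ _ _); apply: val_inj.
by rewrite row_mxEl mxE.
Qed.

Lemma ptS n x (v : 'rV[R]_n) i : pt x v 0 (lift ord0 i) = v 0 i.
Proof.
rewrite -(row_mxEr (x%:M : 'rV[R]_1) v 0 i).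
by congr (row_mx _ _ _ _); apply: val_inj.
Qed.

Lemma row_of_cons n (x : mR) (t : n.-tuple mR) : row_of [tuple of x :: t] = pt x (row_of t).
Proof.
apply/rowP => i; rewrite mxE; case: (unliftP ord0 i) => [j ->|->].
  by rewrite ptS mxE tnthS.
by rewrite pt0.
Qed.

Definition cons_pair n (xt : mR * n.-tuple mR) : n.+1.-tuple mR :=
  [tuple of xt.1 :: xt.2].

Lemma measurable_cons_pair n : measurable_fun setT (@cons_pair n).
Proof. by apply: measurable_cons. Qed.

Lemma sigma_finite_measure_pack d d' (T : measurableType d) (T' : measurableType d')
    (m : {measure set T -> \bar R}) (f : T -> T') :
  measurable_fun setT f -> sigma_finite setT (pushforward m f) ->
  exists m' : {sigma_finite_measure set T' -> \bar R},
    m' = pushforward m f :> (set T' -> \bar R).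
Proof.
move=> mf sM.
pose s := Measure_isSigmaFinite.Build _ _ _ (pushforward m f) sM.
pose M' : {sigma_finite_measure set T' -> \bar R} := HB.pack (pushforward m f) (s mf).
by exists (M' mf).
Qed.

(** Unfolding the definition of [vol] once gives the product of the Lebesgue measure
with the measure obtained in one dimension less, carried over to tuples by
[cons_pair]. *)
Lemma vol_measure n : exists m : {sigma_finite_measure set (n.-tuple mR) -> \bar R},
  forall A : set 'rV[R]_n, vol A = m (@row_of n @^-1` A).
Proof.
elim: n => [|n [m mE]].
  exists (\d_ ([tuple] : 0.-tuple mR)) => A /=.
  rewrite diracE indicE; congr (_%:R%:E); congr nat_of_bool.
  by apply/idP/idP; rewrite !inE /=; congr (A _); apply/rowP => -[].
pose M := pushforward (@lebesgue_measure R \x m)%E (@cons_pair n).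
have sM : sigma_finite setT M.
  have /sigma_finiteP[F [FT ndF Foo]] := sigma_finiteT (@lebesgue_measure R).
  have /sigma_finiteP[G [GT ndG Goo]] := sigma_finiteT m.
  exists (fun k => [set t : n.+1.-tuple mR | F k (thead t) /\ G k [tuple of behead t]]).
    apply/esym; rewrite -subTset => t _.
    have : [set: mR] (thead t) by []; rewrite FT => -[j _ Fj].
    have : [set: n.-tuple mR] [tuple of behead t] by []; rewrite GT => -[k _ Gk].
    exists (maxn j k) => //; split.
    - by move: (thead t) Fj; exact/subsetPset/ndF/leq_maxl.
    - by move: [tuple of behead t] Gk; exact/subsetPset/ndG/leq_maxr.
  move=> k; have [mF Fk] := Foo k; have [mG Gk] := Goo k; split.
    apply: (measurableI (@thead n mR @^-1` F k)).
      rewrite -[X in measurable X]setTI.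
      by apply: (@measurable_tnth _ mR n.+1 ord0).
    rewrite -[X in measurable X]setTI.
    by apply: (@measurable_behead _ mR n).
  rewrite /M /pushforward.
  rewrite [X in (_ X < _)%E](_ : _ = F k `*` G k).
    by rewrite product_measure1E// lte_mul_pinfty// ge0_fin_numE.
  apply/seteqP; split=> -[x t] /=; rewrite /cons_pair/= theadE;
    by rewrite (_ : [tuple of behead [tuple of x :: t]] = t :> n.-tuple mR)//; exact: val_inj.
have [M' M'E] : exists M' : {sigma_finite_measure set (n.+1.-tuple mR) -> \bar R},
    M' = M :> (set (n.+1.-tuple mR) -> \bar R).
  exact: (@sigma_finite_measure_pack _ _ _ _ (@lebesgue_measure R \x m)%E _
    (@measurable_cons_pair n) sM).
exists M' => A; rewrite M'E /= /M /pushforward /product_measure1 /=.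
apply: eq_integral => x _; rewrite mE /=; congr (m _).
by apply/seteqP; split => t; rewrite /xsection /= inE /= /cons_pair/= row_of_cons.
Qed.

(** The tuples carry the product sigma-algebra, in which the measurability of a set
of rows is tested. *)
Definition borel n (A : set 'rV[R]_n) := measurable (@row_of n @^-1` A).

Lemma borel_pair n (A : set 'rV[R]_n.+1) : borel A ->
  measurable [set xt : mR * n.-tuple mR | A (pt xt.1 (row_of xt.2))].
Proof.
move=> mA; rewrite (_ : mkset _ = @cons_pair n @^-1` (@row_of n.+1 @^-1` A)).
  by rewrite -[X in measurable X]setTI; apply: measurable_cons_pair.
by apply/seteqP; split=> -[x t] /=; rewrite /cons_pair/= row_of_cons.
Qed.

Lemma vol_pair n : exists m : {sigma_finite_measure set (n.-tuple mR) -> \bar R},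
  (forall A : set 'rV[R]_n, vol A = m (@row_of n @^-1` A)) /\
  (forall A : set 'rV[R]_n.+1, vol A =
    (\int[@lebesgue_measure R]_x m [set t | A (pt x (row_of t))])%E).
Proof.
have [m mE] := vol_measure n; exists m; split => // A /=.
by apply: eq_integral => x _; rewrite mE.
Qed.

Lemma borel_section n (A : set 'rV[R]_n.+1) x : borel A -> borel [set v | A (pt x v)].
Proof.
move=> /borel_pair/(measurable_xsection x); rewrite /borel; congr (measurable _).
by apply/seteqP; split => t; rewrite /xsection/= inE.
Qed.

Lemma measurable_vol_section n (A : set 'rV[R]_n.+1) : borel A ->
  measurable_fun setT ((fun x => vol [set v | A (pt x v)]) : mR -> \bar R).
Proof.
move=> /borel_pair mA; have [m [mE _]] := vol_pair n.
have := measurable_fun_xsection m mA.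
apply: eq_measurable_fun => x _ /=; rewrite mE /=; congr (m _).
by apply/seteqP; split => t; rewrite /xsection/= inE.
Qed.

Lemma vol_ge0 n (A : set 'rV[R]_n) : (0 <= vol A)%E.
Proof. by have [m ->] := vol_measure n. Qed.

Lemma vol_set0 n : vol (set0 : set 'rV[R]_n) = 0%E.
Proof. by have [m ->] := vol_measure n; rewrite preimage_set0 measure0. Qed.

Lemma le_vol n (A B : set 'rV[R]_n) : borel A -> borel B -> A `<=` B ->
  (vol A <= vol B)%E.
Proof.
move=> mA mB AB; have [m mE] := vol_measure n; rewrite !mE.
by apply: le_measure; rewrite ?inE// => t /AB.
Qed.

(** The integral is taken along the lines parallel to the first axis, whereas [vol]
slices by hyperplanes orthogonal to it. *)
Lemma vol_fubini n :
  exists m : {sigma_finite_measure set (n.-tuple mR) -> \bar R},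
  (forall B : set 'rV[R]_n, vol B = m (@row_of n @^-1` B)) /\
  forall A : set 'rV[R]_n.+1, borel A ->
  vol A = (\int[m]_t (@lebesgue_measure R) [set x : mR | A (pt x (row_of t))])%E.
Proof.
have [m [mE mE']] := vol_pair n; exists m; split=> // A mA.
have mA' := borel_pair mA.
rewrite mE'.
have := @indic_fubini_tonelli _ _ _ _ R (@lebesgue_measure R) m _ mA'.
rewrite indic_fubini_tonelli_FE// indic_fubini_tonelli_GE//.
set F := (X in X = _ -> _); set G := (X in _ = X -> _) => E.
have -> : (\int[m]_t (@lebesgue_measure R) [set x : mR | A (pt x (row_of t))])%E = G.
  apply: eq_integral => t _ /=; congr (_ _).
  by apply/seteqP; split => x; rewrite /ysection/= inE.
rewrite -E; apply: eq_integral => x _ /=; congr (m _).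
by apply/seteqP; split => t; rewrite /xsection/= inE.
Qed.

Lemma measurable_tnth_affine m (b : 'I_m -> R) (a : R) :
  measurable_fun setT ((fun t : m.-tuple mR => \sum_j tnth t j * b j + a) : m.-tuple mR -> mR).
Proof.
apply: (measurable_funD (f := fun t : m.-tuple mR => \sum_j (tnth t j : R) * b j)); last exact: measurable_cst.
apply: measurable_sum => j; apply: measurable_funM; last exact: measurable_cst.
exact: (@measurable_tnth _ mR m j).
Qed.

Lemma borel_affine m n (M : 'M[R]_(m, n)) (a : 'rV[R]_n) (A : set 'rV[R]_n) :
  borel A -> borel [set v | A (v *m M + a)].
Proof.
move=> mA.
pose f (t : m.-tuple mR) : n.-tuple mR := tuple_of_row (row_of t *m M + a).
have mf : measurable_fun setT f.
  apply/measurable_fun_tnthP => i /=.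
  rewrite (_ : _ \o _ = (fun t : m.-tuple mR => \sum_j tnth t j * M j i + a 0 i) :> (m.-tuple mR -> mR)).
    exact: measurable_tnth_affine.
  apply/funext => t /=; rewrite tnth_mktuple !mxE; congr (_ + _).
  by apply: eq_bigr => j _; rewrite mxE.
have := mf measurableT _ mA; rewrite setTI /borel; congr (measurable _).
by apply/seteqP; split => t; rewrite /f /preimage /= tuple_of_rowK.
Qed.

Lemma lebesgue_affine (c a : R) (f : mR -> \bar R) : 0 < c ->
  measurable_fun setT f -> (forall x, 0 <= f x)%E ->
  (\int[@lebesgue_measure R]_x f (c * x + a)%R =
   c^-1%:E * \int[@lebesgue_measure R]_x f x)%E.
Proof.
move=> c0 mf f0.
pose phi (x : mR) : mR := c * x + a.
have mphi : measurable_fun setT phi.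
  by apply: (@measurable_funD _ mR R setT (fun x => c * x) (fun=> a)) => //; exact: measurable_funM.
pose P : {measure set mR -> \bar R} :=
  measure_function_pushforward__canonical__measure_function_Measure (@lebesgue_measure R) mphi.
pose c' := NngNum (ltW c0).
have scale A : measurable A -> @lebesgue_measure R A = mscale c' P A.
  apply: lebesgue_measure_unique => _ [[u v] _ <-] /=.
  rewrite /mscale /= /pushforward.
  rewrite (_ : phi @^-1` _ = `](u - a) / c, (v - a) / c]%classic).
    rewrite !lebesgue_measure_itv /= !lte_fin ltr_pM2r ?invr_gt0// ltrD2r.
    case: ifP => _; rewrite ?mule0// -EFinD -EFinM -mulrBl mulrC divfK ?gt_eqF//.
    by congr (_%:E); lra.
  apply/seteqP; split=> x /=; rewrite !in_itv /= ltr_pdivrMr// ler_pdivlMr//;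
    by rewrite /phi ltrBlDr lerBrDr [x * c]mulrC.
have -> : (\int[@lebesgue_measure R]_x f x = c%:E * \int[P]_x f x)%E.
  rewrite (eq_measure_integral (mscale c' P)); last by move=> A mA _; exact: scale.
  by rewrite ge0_integral_mscale.
rewrite muleA -EFinM mulVf ?gt_eqF// mul1e.
by rewrite ge0_integral_pushforward//.
Qed.

Lemma ptD n x y (v w : 'rV[R]_n) : pt x v + pt y w = pt (x + y) (v + w).
Proof.
apply/rowP => i; rewrite [LHS]mxE.
by case: (unliftP ord0 i) => [j ->|->]; rewrite ?pt0// !ptS mxE.
Qed.

Lemma ptZ n c x (v : 'rV[R]_n) : c *: pt x v = pt (c * x) (c *: v).
Proof.
apply/rowP => i; rewrite [LHS]mxE.
by case: (unliftP ord0 i) => [j ->|->]; rewrite ?pt0// !ptS mxE.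
Qed.

Lemma ptP n (v : 'rV[R]_n.+1) : exists x w, v = pt x w.
Proof.
exists (v 0 ord0), (\row_i v 0 (lift ord0 i)); apply/rowP => i.
by case: (unliftP ord0 i) => [j ->|->]; rewrite ?pt0// ptS mxE.
Qed.

Lemma vol_affine n (c : R) (a : 'rV[R]_n) (A : set 'rV[R]_n) : 0 < c -> borel A ->
  vol [set v | A (c *: v + a)] = ((c ^- n)%:E * vol A)%E.
Proof.
move=> c0; elim: n => [|n IH] in a A *.
  move=> _; rewrite /= expr0 invr1 mul1e; congr (_%:E); rewrite !indicE.
  by congr (_%:R); congr nat_of_bool; apply/idP/idP; rewrite !inE /=; congr (A _);
    apply/rowP => -[].
have [x [w ->]] := ptP a => mA /=.
transitivity (\int[@lebesgue_measure R]_y ((c ^- n)%:E * vol [set v | A (pt (c * y + x) v)]))%E.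
  apply: eq_integral => y _; rewrite -(IH w); last exact: borel_section.
  by congr vol; apply/seteqP; split=> v /=; rewrite -/(pt y v) ptZ ptD.
rewrite ge0_integralZl//; last by rewrite lee_fin invr_ge0 exprn_ge0// ltW.
- rewrite (lebesgue_affine x (f := fun y => vol [set v | A (pt y v)]))//.
  + by rewrite muleA -EFinM -invfM -exprSr.
  + exact: measurable_vol_section.
  + by move=> y; exact: vol_ge0.
- have mphi : measurable_fun setT ((fun y => c * y + x) : mR -> mR).
    by apply: (@measurable_funD _ mR R setT (fun x => c * x) (fun=> x)) => //; exact: measurable_funM.
  exact: (measurableT_comp (measurable_vol_section mA) mphi).
- by move=> y _; exact: vol_ge0.
Qed.

Lemma vol_translate n (a : 'rV[R]_n) (A : set 'rV[R]_n) : borel A ->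
  vol [set v | A (v + a)] = vol A.
Proof.
move=> mA; have := vol_affine a ltr01 mA; rewrite expr1n invr1 mul1e => <-.
by congr vol; apply/seteqP; split=> v /=; rewrite scale1r.
Qed.

Lemma shear_mxE n (a : 'rV[R]_n) (v : 'rV[R]_n.+1) :
  v *m (1%:M + (delta_mx ord0 0 : 'cV_n.+1) *m pt 0 a) + 0 =
  v + v 0 ord0 *: pt 0 a.
Proof.
rewrite addr0 mulmxDr mulmx1 mulmxA -colE; congr (_ + _).
by rewrite [col _ _]mx11_scalar mxE mul_scalar_mx.
Qed.

Lemma borel_shear n (a : 'rV[R]_n) (A : set 'rV[R]_n.+1) : borel A ->
  borel [set v : 'rV[R]_n.+1 | A (v + v 0 ord0 *: pt 0 a)].
Proof.
move=> /(borel_affine (1%:M + (delta_mx ord0 0 : 'cV_n.+1) *m pt 0 a) 0).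
by congr borel; apply/seteqP; split=> v /=; rewrite shear_mxE.
Qed.

Lemma vol_shear n (a : 'rV[R]_n) (A : set 'rV[R]_n.+1) : borel A ->
  vol [set v : 'rV[R]_n.+1 | A (v + v 0 ord0 *: pt 0 a)] = vol A.
Proof.
move=> mA /=; apply: eq_integral => x _.
rewrite -(vol_translate (x *: a) (borel_section x mA)).
congr vol; apply/seteqP; split=> v /=;
  by rewrite -/(pt x v) pt0 ptZ ptD mulr0 addr0.
Qed.

(** A volume preserving shear turns the lines of direction [pt 1 a] into lines
parallel to the first axis. *)
Lemma vol_fibres n (a : 'rV[R]_n) :
  exists m : {sigma_finite_measure set (n.-tuple mR) -> \bar R},
  (forall B : set 'rV[R]_n, vol B = m (@row_of n @^-1` B)) /\
  forall A : set 'rV[R]_n.+1, borel A ->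
  measurable_fun setT (fun t => (@lebesgue_measure R)
    [set x : mR | A (pt x (row_of t + x *: a))]) /\
  vol A = (\int[m]_t (@lebesgue_measure R) [set x : mR | A (pt x (row_of t + x *: a))])%E.
Proof.
have [m [mE volE]] := vol_fubini n.
exists m; split=> // A mA.
have mA' := borel_shear a mA.
have FE : (fun t : n.-tuple mR => (@lebesgue_measure R) [set x : mR | A (pt x (row_of t + x *: a))]) =
    (fun t => (@lebesgue_measure R)
      [set x : mR | [set v : 'rV[R]_n.+1 | A (v + v 0 ord0 *: pt 0 a)] (pt x (row_of t))]).
  apply/funext => t; congr (_ _).
  by apply/seteqP; split=> x /=; rewrite pt0 ptZ ptD mulr0 addr0.
rewrite FE -(vol_shear a mA) volE//; split=> //.
have := measurable_fun_ysection (@lebesgue_measure R) (borel_pair mA').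
apply: eq_measurable_fun => t _ /=; congr (_ _).
by apply/seteqP; split => x; rewrite /ysection/= inE.
Qed.

(** A point belongs to the closed set [A] if and only if, at each scale
1 / (k + 1), some rational point is close both to it and to [A]; this is a
countable combination of boxes. *)
Lemma borel_closed n (A : set 'rV[R]_n) : closed A -> borel A.
Proof.
move=> cA.
pose D k (q : 'rV[rat]_n) : set (n.-tuple mR) :=
  [set t | forall i, `|tnth t i - ratr (q 0 i)| < k.+1%:R^-1].
have mD k q : measurable (D k q).
  rewrite (_ : D k q = \bigcap_(i in [set: 'I_n])
      (@tnth n mR ^~ i @^-1` [set x | `|x - ratr (q 0 i)| < k.+1%:R^-1])).
    apply: fin_bigcap_measurable => // i _.
    rewrite -[X in measurable X]setTI; apply: (@measurable_tnth _ mR n i) => //.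
    rewrite (_ : mkset _ = ball (ratr (q 0 i) : R) k.+1%:R^-1); first exact: measurable_ball.
    by apply/seteqP; split => x; rewrite /ball/= distrC.
  by apply/seteqP; split=> t; [move=> h i _; exact: h|move=> h i; exact: (h i)].
pose near_A k (q : 'rV[rat]_n) :=
  exists2 y, A y & forall i, `|y 0 i - ratr (q 0 i)| < k.+1%:R^-1.
rewrite /borel (_ : _ @^-1` _ =
    \bigcap_k \bigcup_q (if `[< near_A k q >] then D k q else set0)).
  apply: bigcapT_measurable => k; apply: countable_bigcupT_measurable => [|q].
    exact: countableP.
  by case: ifP.
apply/seteqP; split=> [t At k _|t h].
  have /choice[q qE] : forall i : 'I_n, exists q : rat, `|tnth t i - ratr q| < k.+1%:R^-1.
    move=> i; have k0 : (0 : R) < k.+1%:R^-1 by rewrite invr_gt0.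
    have /rat_in_itvoo[q] : tnth t i - k.+1%:R^-1 < tnth t i + k.+1%:R^-1.
      by rewrite ltrD2l; apply: lt_trans k0; rewrite oppr_lt0.
    rewrite in_itv /= => /andP[q1 q2]; exists q.
    by rewrite distrC ltr_distl q1 q2.
  exists (\row_i q i) => //.
  rewrite (_ : `[< _ >]); first by move=> i; rewrite mxE.
  by apply/asboolP; exists (row_of t) => // i; rewrite !mxE.
apply: cA => B /nbhs_ballP[e /= e0 eB].
have [k ke] : exists k : nat, 2 * k.+1%:R^-1 < e.
  have e2 : 0 < e / 2 by rewrite divr_gt0.
  have [k _ kP] := near_infty_natSinv_lt (PosNum e2).
  exists k; have := kP k (leqnn k) => /= ke.
  by rewrite mulrC -ltr_pdivlMr.
have [q _] := h k I; case: asboolP => // -[y Ay yq] tq.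
exists y; split => //; apply: eB; split=> // i j; rewrite (ord1 i) /ball /= mxE.
apply: lt_trans ke; rewrite mulrDl mul1r.
rewrite -(subrKA (ratr (q 0 j))); apply: le_lt_trans (ler_normD _ _) _.
by rewrite ltrD// distrC.
Qed.

End VolumeMeasure.

(** * Compact sets of rows *)

Section Compact.
Local Open Scope classical_set_scope.
Local Open Scope ring_scope.
Variable R : realType.
Let mR := measurableTypeR R.

Lemma continuous_row (T : topologicalType) n (f : T -> 'rV[R]_n) :
  (forall i, continuous (fun x => f x 0 i)) -> continuous f.
Proof.
move=> cf x B [P PB sub].
have h : \forall y \near x, forall i : 'I_n, P 0 i (f y 0 i).
  by apply: filter_forall => i; apply: cf; exact: PB.
by apply: filterS h => y h; apply: sub => i j; rewrite (ord1 i).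
Qed.

Lemma continuous_sum (T : topologicalType) I (s : seq I) (P : pred I) (f : I -> T -> R) :
  (forall i, continuous (f i)) -> continuous (fun x => \sum_(i <- s | P i) f i x).
Proof.
move=> cf; elim: s => [|i s IH].
  rewrite (_ : (fun _ => _) = cst 0); last by apply/funext => y; rewrite big_nil.
  by move=> x; exact: cvg_cst.
rewrite (_ : (fun _ => _) = (fun x => (if P i then f i x else 0) + \sum_(j <- s | P j) f j x)).
  by move=> x; apply: cvgD; [case: (P i); [exact: cf|exact: cvg_cst]|exact: IH].
by apply/funext => y; rewrite big_cons; case: ifP; rewrite ?add0r.
Qed.

Lemma continuous_coord n (i : 'I_n) : continuous (fun v : 'rV[R]_n => v 0 i).
Proof. exact: coord_continuous. Qed.

Lemma continuous_mulmx m n (M : 'M[R]_(m, n)) : continuous (fun v : 'rV[R]_m => v *m M).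
Proof.
apply: continuous_row => i; under eq_fun do rewrite mxE.
by apply: continuous_sum => j x; apply: continuousM; [exact: continuous_coord|exact: cst_continuous].
Qed.

Lemma compact_image (T : topologicalType) n (f : T -> 'rV[R]_n) (K : set T) :
  continuous f -> compact K -> compact (f @` K).
Proof.
by move=> cf; apply: continuous_compact; exact: continuous_subspaceT.
Qed.

Lemma compact_mulmx m n (M : 'M[R]_(m, n)) (K : set 'rV[R]_m) :
  compact K -> compact [set v *m M | v in K].
Proof. exact/compact_image/continuous_mulmx. Qed.

Lemma compact_closed_rV n (K : set 'rV[R]_n) : compact K -> closed K.
Proof. by apply: compact_closed; exact: norm_hausdorff. Qed.

Lemma borel_compact n (K : set 'rV[R]_n) : compact K -> borel K.
Proof. by move=> /compact_closed_rV/borel_closed. Qed.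

Lemma closed_coord n (i : 'I_n) (x : R) : closed [set v : 'rV[R]_n | v 0 i = x].
Proof.
have /continuous_closedP h := @continuous_coord n i.
apply: (h [set y | y = x]); exact: closed_eq.
Qed.

Lemma compact_section n (K : set 'rV[R]_n.+1) x : compact K -> compact [set v | K (pt x v)].
Proof.
move=> cK; pose M : 'M[R]_(n.+1, n) := \matrix_(i, j) (i == lift ord0 j)%:R.
have ME y (v : 'rV[R]_n) : pt y v *m M = v.
  have Mx i j : M i j = (i == lift ord0 j)%:R by rewrite mxE.
  apply/rowP => j; rewrite [LHS]mxE (bigD1 (lift ord0 j))//= ptS Mx eqxx mulr1.
  by rewrite big1 ?addr0// => i ij; rewrite Mx (negbTE ij) mulr0.
rewrite (_ : mkset _ = [set v *m M | v in K `&` [set v | v 0 ord0 = x]]).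
  by apply/compact_mulmx/compact_closedI => //; exact: closed_coord.
apply/seteqP; split=> v /=.
  by move=> Kv; exists (pt x v); rewrite ?ME// pt0.
by move=> [w [Kw w0] <-]; have [y [u wE]] := ptP w; move: Kw w0; rewrite wE ME pt0 => + <-.
Qed.

Definition box n (c : R) := [set v : 'rV[R]_n | forall i, `|v 0 i| <= c].

Lemma compact_box n (c : R) : compact (@box n c).
Proof.
rewrite (_ : box _ = [set v : 'rV[R]_n | forall i, `[- c, c]%classic (v ord0 i)]).
  by apply: (@rV_compact _ _ (fun=> `[- c, c]%classic)) => _; exact: segment_compact.
by apply/seteqP; split=> v /= h i; have := h i; rewrite in_itv /= ler_norml.
Qed.

Lemma vol_box n (c : R) : 0 <= c -> vol (@box n c) = ((2 * c) ^+ n)%:E.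
Proof.
move=> c0; elim: n => [|n IH] /=.
  by rewrite indicE expr0 mem_set// => -[].
transitivity (\int[@lebesgue_measure R]_x (((2 * c) ^+ n)%:E * (\1_(`[- c, c]%classic : set mR) x)%:E))%E.
  apply: eq_integral => x _; rewrite -/(pt x _) indicE.
  have [xc|xc] := boolP (x \in `[- c, c]).
    rewrite mem_set// mule1 -IH; congr vol; apply/seteqP; split=> v h i.
      by have := h (lift ord0 i); rewrite -/(pt x v) ptS.
    rewrite -/(pt x v); case: (unliftP ord0 i) => [j ->|->]; first by rewrite ptS.
    by rewrite pt0; move: xc; rewrite in_itv /= ler_norml.
  rewrite memNset ?mule0; last by move=> /= xc'; rewrite xc' in xc.
  rewrite (_ : mkset _ = set0) ?vol_set0//; apply/seteqP; split=> // v /(_ ord0).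
  by rewrite -/(pt x v) pt0 => h; move: xc; rewrite in_itv /= -ler_norml h.
have mI : measurable (`[- c, c]%classic : set mR) by exact: (measurable_itv `[- c, c]).
rewrite ge0_integralZl//.
- rewrite integral_indic//.
  rewrite setIT /= lebesgue_measure_itv /= lte_fin.
  case: ltP => cc; rewrite -EFinM; first by rewrite exprSr; congr (_ * _)%:E; lra.
  have -> : c = 0 by lra.
  by rewrite mulr0 !mulr0 expr0n.
- by exact/measurable_EFinP/measurable_indic.
- by rewrite lee_fin exprn_ge0// mulr_ge0.
Qed.

Lemma norm_coord_le n (v : 'rV[R]_n) i : `|v 0 i| <= `|v|.
Proof.
have /mapP[j Hj ->] : `|v ord0 i| \in [seq `|v x.1 x.2| | x : 'I_1 * 'I_n].
  by apply/mapP; exists (ord0, i) => //=; rewrite mem_enum.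
by rewrite -[leRHS]/(mx_norm v) mx_normrE; apply/bigmax_geP; right => /=; exists j.
Qed.

Lemma compact_sub_box n (K : set 'rV[R]_n) : compact K ->
  exists2 c, 0 <= c & K `<=` @box n c.
Proof.
move=> /compact_bounded[M [_ hM]]; exists (`|M| + 1); first by rewrite addr_ge0.
move=> v Kv i; apply: le_trans (norm_coord_le _ _) _.
by apply: hM => //; rewrite ltr_pwDr// ler_norm.
Qed.

Lemma vol_compact n (K : set 'rV[R]_n) : compact K -> vol K \is a fin_num.
Proof.
move=> cK; rewrite ge0_fin_numE ?vol_ge0//.
have [c c0 Kc] := compact_sub_box cK.
apply: le_lt_trans (le_vol (borel_compact cK) (borel_compact (@compact_box n c)) Kc) _.
by rewrite vol_box// ltry.
Qed.

End Compact.

(** * Convex hulls of finite families *)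

Section Hull.
Local Open Scope classical_set_scope.
Local Open Scope ring_scope.
Variable R : realType.

Definition cvx n (K : set 'rV[R]_n) :=
  forall x y t, K x -> K y -> 0 <= t -> t <= 1 -> K (t *: x + (1 - t) *: y).

Definition hull N n (p : 'I_N -> 'rV[R]_n) (J : {set 'I_N}) : set 'rV[R]_n :=
  [set x | exists l : 'I_N -> R,
    [/\ forall i, 0 <= l i, \sum_(i in J) l i = 1 & x = \sum_(i in J) l i *: p i]].

Lemma cvx_hull N n (p : 'I_N -> 'rV[R]_n) (J : {set 'I_N}) : cvx (hull p J).
Proof.
move=> _ _ t [l [l0 l1 ->]] [m [m0 m1 ->]] t0 t1.
exists (fun i => t * l i + (1 - t) * m i); split.
- by move=> i; rewrite addr_ge0// mulr_ge0// subr_ge0.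
- by rewrite big_split/= -!mulr_sumr l1 m1; lra.
- rewrite !scaler_sumr -big_split/=; apply: eq_bigr => i _.
  by rewrite !scalerA -scalerDl.
Qed.

Lemma hull_point N n (p : 'I_N -> 'rV[R]_n) (J : {set 'I_N}) i : i \in J -> hull p J (p i).
Proof.
move=> iJ; exists (fun j => (j == i)%:R); split=> //.
- by rewrite (bigD1 i)//= eqxx big1 ?addr0// => j /andP[_ /negbTE ->].
- rewrite (bigD1 i)//= eqxx scale1r big1 ?addr0// => j /andP[_ /negbTE ->].
  by rewrite scale0r.
Qed.

Lemma hull_min N n (p : 'I_N -> 'rV[R]_n) (J : {set 'I_N}) (A : set 'rV[R]_n) : cvx A ->
  (forall i, i \in J -> A (p i)) -> hull p J `<=` A.
Proof.
move=> cA; elim/setU1_ind : J => [|a J aJ IH] Ap _ [l [l0 + ->]].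
  by rewrite big_set0 => /esym/eqP; rewrite oner_eq0.
rewrite !big_setU1//= => l1.
have ApJ i : i \in J -> A (p i) by move=> iJ; apply: Ap; rewrite finset.inE iJ orbT.
have Aa : A (p a) by apply: Ap; rewrite finset.setU11.
have s0 : 0 <= \sum_(i in J) l i by apply: sumr_ge0.
have [sE|s1] := eqVneq (\sum_(i in J) l i) 0.
  rewrite big1 ?addr0.
    by move: l1; rewrite sE addr0 => ->; rewrite scale1r.
  move=> i iJ; have /eqP := sE; rewrite psumr_eq0// => /allP/(_ i).
  by rewrite mem_index_enum iJ => /(_ isT)/eqP ->; rewrite scale0r.
set s := \sum_(i in J) l i in s0 s1 l1.
have AJ : A (\sum_(i in J) (l i / s) *: p i).
  apply: IH => //; exists (fun i => l i / s); split=> //.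
    by move=> i; rewrite divr_ge0.
  by rewrite -mulr_suml mulfV.
have -> : \sum_(i in J) l i *: p i = (1 - l a) *: \sum_(i in J) (l i / s) *: p i.
  have sE : 1 - l a = s by rewrite -l1 addrAC subrr add0r.
  rewrite scaler_sumr; apply: eq_bigr => i _; rewrite scalerA sE.
  by rewrite [s * _]mulrC divfK.
by apply: cA => //; rewrite -l1 lerDl.
Qed.

Lemma hull_ofE N n (p : 'I_N -> 'rV[R]_n) (J : {set 'I_N}) : hull_of p J = hull p J.
Proof.
apply/seteqP; split.
  move=> x; apply; split.
    move=> /= y z t; rewrite !inE => hy hz.
    by apply: (cvx_hull hy hz).
  by move=> _ [i iJ <-]; exact: hull_point.
move=> x hx A [cA pA]; move: x hx; apply: hull_min => //.
  move=> x y t Ax Ay t0 t1; have := cA x y (Itv01 t0 t1).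
  by rewrite !inE; apply.
by move=> i iJ; apply: pA; exists i.
Qed.

Lemma hull_mulmx N m n (p : 'I_N -> 'rV[R]_m) (J : {set 'I_N}) (M : 'M[R]_(m, n)) :
  [set v *m M | v in hull p J] = hull (fun i => p i *m M) J.
Proof.
apply/seteqP; split=> [_ [_ [l [l0 l1 ->]] <-]|_ [l [l0 l1 ->]]].
  exists l; split=> //; rewrite mulmx_suml.
  by apply: eq_bigr => i _; rewrite scalemxAl.
exists (\sum_(i in J) l i *: p i); first by exists l.
by rewrite mulmx_suml; apply: eq_bigr => i _; rewrite scalemxAl.
Qed.

(** The hull is a linear image of a simplex. *)
Lemma compact_hull N n (p : 'I_N -> 'rV[R]_n) (J : {set 'I_N}) : compact (hull p J).
Proof.
pose S := [set l : 'rV[R]_N | \sum_(i in J) l 0 i = 1] `&`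
  [set l : 'rV[R]_N | forall i, `[0, 1]%classic (l ord0 i)].
pose M : 'M[R]_(N, n) := \matrix_(i, j) (if i \in J then p i 0 j else 0).
have ME (l : 'rV[R]_N) : l *m M = \sum_(i in J) l 0 i *: p i.
  apply/rowP => j; rewrite mxE summxE [RHS]big_mkcond/=; apply: eq_bigr => i _.
  by rewrite mxE; case: ifP; rewrite ?mulr0 ?mxE.
rewrite (_ : hull p J = [set l *m M | l in S]).
  apply: compact_mulmx; rewrite /S setIC; apply: compact_closedI.
    by apply: (@rV_compact _ N (fun=> `[0 : R, 1]%classic)) => _; exact: segment_compact.
  have /continuous_closedP h : continuous (fun l : 'rV[R]_N => \sum_(i in J) l 0 i).
    by apply: continuous_sum => i; exact: continuous_coord.
  by apply: (h [set y | y = 1]); exact: closed_eq.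
apply/seteqP; split=> [_ [l [l0 l1 ->]]|_ [l [l1 l0] <-]].
  exists (\row_i (if i \in J then l i else 0)); last first.
    by rewrite ME; apply: eq_bigr => i iJ; rewrite mxE iJ.
  split=> /=; first by rewrite -l1; apply: eq_bigr => i iJ; rewrite mxE iJ.
  move=> i; rewrite mxE in_itv/=; case: ifP => iJ; rewrite ?lexx ?ler01// l0/=.
  by rewrite -l1 (bigD1 i)//= lerDl sumr_ge0.
exists (fun i => l 0 i); split=> //; first by move=> i; have := l0 i; rewrite /= in_itv/= => /andP[].
Qed.

End Hull.

(** * Adding a segment to a convex body *)

Section SegmentSum.
Local Open Scope classical_set_scope.
Local Open Scope ring_scope.
Variable R : realType.
Let mR := measurableTypeR R.

Lemma volS n (A : set 'rV[R]_n.+1) :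
  vol A = (\int[@lebesgue_measure R]_x vol [set v | A (pt x v)])%E.
Proof. by []. Qed.

Definition seg_sum n (K : set 'rV[R]_n) (a : 'rV[R]_n) (t : R) : set 'rV[R]_n :=
  [set y | exists x s, [/\ K x, `|s| <= t & y = x + s *: a]].

Lemma compact_seg_sum n (K : set 'rV[R]_n) a t : compact K -> compact (seg_sum K a t).
Proof.
move=> cK.
rewrite (_ : seg_sum K a t = [set xs.1 + xs.2 *: a | xs in K `*` `[- t, t]]).
  apply: compact_image; last by apply: compact_setX => //; exact: segment_compact.
  apply: continuous_row => i; have -> :
      (fun xs : 'rV[R]_n * R => (xs.1 + xs.2 *: a) 0 i) = (fun xs => xs.1 0 i + xs.2 * a 0 i).
    by apply/funext => ys; rewrite !mxE.
  move=> xs.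
  apply: (@continuousD R R^o _ (fun xs : 'rV[R]_n * R => xs.1 0 i) (fun xs => xs.2 * a 0 i)).
    apply: (@continuous_comp _ _ _ fst (fun v : 'rV[R]_n => v 0 i)); first exact: cvg_fst.
    exact: continuous_coord.
  apply: (@continuousM R _ (fun xs : 'rV[R]_n * R => xs.2) (fun=> a 0 i)).
    exact: cvg_snd.
  exact: cst_continuous.
apply/seteqP; split=> [_ [x [s [Kx st ->]]]|_ [[x s] [Kx /= st] <-]].
  by exists (x, s) => //; split=> //=; rewrite in_itv/= -ler_norml.
by exists x, s; split=> //; move: st; rewrite in_itv/= -ler_norml.
Qed.

Lemma cvx_seg_sum n (K : set 'rV[R]_n) a t : cvx K -> cvx (seg_sum K a t).
Proof.
move=> cK _ _ u [x [s [Kx st ->]]] [y [r [Ky rt ->]]] u0 u1.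
exists (u *: x + (1 - u) *: y), (u * s + (1 - u) * r); split; first exact: cK.
  apply: le_trans (ler_normD _ _) _; rewrite !normrM ger0_norm// (ger0_norm (x := 1 - u)) ?subr_ge0//.
  have -> : t = u * t + (1 - u) * t by ring.
  by rewrite lerD// ler_wpM2l// subr_ge0.
by rewrite !scalerDr !scalerA addrACA -scalerDl.
Qed.

Lemma seg_sum_mulmx m n (K : set 'rV[R]_m) a t (M : 'M[R]_(m, n)) :
  [set v *m M | v in seg_sum K a t] = seg_sum [set v *m M | v in K] (a *m M) t.
Proof.
apply/seteqP; split=> [_ [_ [x [s [Kx st ->]]] <-]|_ [_ [s [[x Kx <-] st ->]]]].
  by exists (x *m M), s; split=> //; [exists x|rewrite mulmxDl scalemxAl].
exists (x + s *: a); first by exists x, s.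
by rewrite mulmxDl scalemxAl.
Qed.

Lemma cvx_section n (K : set 'rV[R]_n.+1) x : cvx K -> cvx [set v | K (pt x v)].
Proof.
move=> cK v w t /= Kv Kw t0 t1; have := cK _ _ _ Kv Kw t0 t1.
by rewrite !ptZ ptD -mulrDl (addrC t) subrK mul1r.
Qed.

(** A nonempty compact convex set of reals is a segment, which gains [r] at each
end. *)
Lemma lebesgue_thicken (L : set R) (r : R) : compact L -> L !=set0 -> 0 <= r ->
  (forall x y t, L x -> L y -> 0 <= t -> t <= 1 -> L (t * x + (1 - t) * y)) ->
  @lebesgue_measure R [set x : mR | exists2 y, L y & `|x - y| <= r] =
  (@lebesgue_measure R L + (2 * r)%:E)%E.
Proof.
move=> cL L0 r0 convL.
have [q] := compact_EVT_max L0 cL (@continuous_subspaceT _ _ _ (@idfun R) (fun x => @cvg_id _ (nbhs x))).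
rewrite inE /= => Lq qmax.
have [p] := compact_EVT_min L0 cL (@continuous_subspaceT _ _ _ (@idfun R) (fun x => @cvg_id _ (nbhs x))).
rewrite inE /= => Lp pmin.
have pq : p <= q by have := pmin q; rewrite inE; apply.
have LE : L = `[p, q]%classic.
  apply/seteqP; split=> x /=; rewrite in_itv /=.
    by move=> Lx; rewrite pmin ?qmax ?inE.
  move=> /andP[px xq]; have [pqE|pq'] := eqVneq p q.
    by have -> : x = q by lra.
  have pq1 : 0 < q - p by rewrite subr_gt0 lt_neqAle pq'.
  have -> : x = (q - x) / (q - p) * p + (1 - (q - x) / (q - p)) * q.
    by field; rewrite gt_eqF.
  apply: convL => //; first by rewrite divr_ge0 ?subr_ge0.
  by rewrite ler_pdivrMr// mul1r lerB.
rewrite (_ : mkset _ = `[p - r, q + r]%classic); last first.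
  apply/seteqP; split=> x /=; rewrite in_itv /=.
    move=> [y]; rewrite LE /= in_itv/= ler_norml => /andP[py yq] /andP[h1 h2].
    by apply/andP; split; lra.
  move=> /andP[h1 h2]; have [xp|px] := ltP x p.
    by exists p => //; rewrite ler_norml; apply/andP; split; lra.
  have [xq|qx] := ltP q x.
    by exists q => //; rewrite ler_norml; apply/andP; split; lra.
  by exists x; rewrite ?subrr ?normr0// LE /= in_itv/= px qx.
rewrite LE !lebesgue_measure_itv /= !lte_fin.
case: ltP => h1; case: ltP => h2; rewrite -?EFinD ?add0e; try (by congr (_%:E); lra).
Qed.

(** Cavalieri's principle in the direction of [a].  A line of this direction that
meets [K] does so in a segment, which becomes longer by a fixed multiple of [t];
the lines that meet [K] are parametrized by the projection of [K] along [a]. *)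
Lemma vol_seg_sum_transverse n (a : 'rV[R]_n.+1) : a 0 ord0 != 0 ->
  exists (P : 'M[R]_(n.+1, n)) (c : R), 0 <= c /\
  forall (K : set 'rV[R]_n.+1) (t : R), compact K -> cvx K -> 0 <= t ->
    vol (seg_sum K a t) = (vol K + (t * c)%:E * vol [set v *m P | v in K])%E.
Proof.
have [a0 [a' ->]] := ptP a; rewrite pt0 => a0n0 {a}.
have [b abE] : exists b, a0 *: b = a'.
  by exists (a0^-1 *: a'); rewrite scalerA mulfV// scale1r.
(* [P] slides a point along [a] to the hyperplane where the first coordinate is 0. *)
pose P : 'M[R]_(n.+1, n) := (col_mx (- b) 1%:M : 'M[R]_(1 + n, n)).
have PE x (v : 'rV[R]_n) : pt x v *m P = v - x *: b.
  have := @mul_row_col R 1 1 n n x%:M v (- b) 1%:M.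
  by rewrite mulmx1 mul_scalar_mx scalerN addrC => <-.
exists P, (2 * `|a0|); split; first by rewrite mulr_ge0.
move=> K t cK cvK t0.
have cS := compact_seg_sum (a := pt a0 a') (t := t) cK.
have [m [mE volE]] := vol_fibres b.
have bK := borel_compact cK; have bS := borel_compact cS.
have [mK volK] := volE _ bK; have [mS ->] := volE _ bS.
have bPK := borel_compact (compact_mulmx (M := P) cK).
pose L t := [set x : R | K (pt x (row_of t + x *: b))].
rewrite volK mE.
rewrite -[X in m X]setIT -integral_indic//.
rewrite -ge0_integralZl//; last 2 first.
- exact/measurable_EFinP/measurable_indic.
- by rewrite lee_fin !mulr_ge0.
rewrite -ge0_integralD//; last 2 first.
- by move=> w _; rewrite -EFinM lee_fin !mulr_ge0.
- by apply: measurable_funeM; exact/measurable_EFinP/measurable_indic.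
apply: eq_integral => w _.
have -> : [set x : mR | seg_sum K (pt a0 a') t (pt x (row_of w + x *: b))] =
    [set x : mR | exists2 y, L w y & `|x - y| <= t * `|a0|].
  apply/seteqP; split=> [x [z [s [Kz st /eqP]]]|x [y Ly xy]].
    rewrite -subr_eq => /eqP zE; exists (x - s * a0).
      move: Kz; rewrite -zE -scaleNr ptZ ptD /L /=; congr K; rewrite mulNr; congr pt.
      by rewrite -abE scalerA -addrA -scalerDl mulNr.
    by rewrite opprB addrC subrK normrM ler_wpM2r.
  exists (pt y (row_of w + y *: b)), ((x - y) / a0); split=> //.
    by rewrite normrM normfV ler_pdivrMr ?normr_gt0.
  rewrite ptZ ptD divfK// -abE scalerA divfK// -addrA -scalerDl.
  by rewrite (addrC y) subrK.
rewrite indicE; have [L0|L0] := pselect (L w !=set0); last first.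
  have -> : [set x : mR | exists2 y, L w y & `|x - y| <= t * `|a0|] = set0.
    by apply/seteqP; split=> // x [y Ly]; exfalso; apply: L0; exists y.
  rewrite memNset; last first.
    move=> [v Kv vw]; apply: L0; have [x [u vE]] := ptP v; exists x.
    by rewrite /L /= -vw vE PE subrK -vE.
  rewrite mule0 adde0; congr (_ _); apply/seteqP; split=> // x Lx.
  by exfalso; apply: L0; exists x.
have -> : (@lebesgue_measure R) [set x : mR | K (pt x (row_of w + x *: b))] =
  (@lebesgue_measure R) (L w) by [].
rewrite mem_set ?mule1; last first.
  case: L0 => x Lx; exists (pt x (row_of w + x *: b)) => //.
  by rewrite PE addrK.
rewrite lebesgue_thicken//.
- by congr (_ + _%:E)%E; ring.
- have -> : L w = (fun v : 'rV[R]_n.+1 => v 0 ord0) @` (K `&` [set v | v *m P = row_of w]).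
    apply/seteqP; split=> [x Lx|_ [v [Kv vw] <-]].
      by exists (pt x (row_of w + x *: b)); rewrite ?pt0//; split=> //=; rewrite PE addrK.
    have [x [u vE]] := ptP v; rewrite /L /= -vw vE pt0 PE subrK -vE//.
  apply: continuous_compact; first exact/continuous_subspaceT/continuous_coord.
  apply: compact_closedI => //.
  have /continuous_closedP h := @continuous_mulmx R _ _ P.
  by apply: (h [set row_of w]); apply: compact_closed_rV; exact: compact_set1.
- by rewrite mulr_ge0.
- move=> x y u Lx Ly u0 u1; have := cvK _ _ u Lx Ly u0 u1.
  rewrite /L /= !ptZ ptD; congr (K (pt _ _)).
  rewrite !scalerDr !scalerA addrACA -!scalerDl [u + _]addrC subrK scale1r.
  by rewrite [u * x]mulrC.
Qed.

Lemma seg_sum0 n (K : set 'rV[R]_n) t : 0 <= t -> seg_sum K 0 t = K.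
Proof.
move=> t0; apply/seteqP; split=> [_ [x [s [Kx _ ->]]]|x Kx].
  by rewrite scaler0 addr0.
by exists x, 0; rewrite normr0 scaler0 addr0.
Qed.

(** If the first coordinate of [a] is 0, the segment is added within each slice of
constant first coordinate, where the formula holds by induction. *)
Lemma vol_seg_sum n (a : 'rV[R]_n.+1) :
  exists (P : 'M[R]_(n.+1, n)) (c : R), 0 <= c /\
  forall (K : set 'rV[R]_n.+1) (t : R), compact K -> cvx K -> 0 <= t ->
    vol (seg_sum K a t) = (vol K + (t * c)%:E * vol [set v *m P | v in K])%E.
Proof.
elim: n a => [|n IH] a; (have [a0|] := eqVneq (a 0 ord0) 0; last exact: vol_seg_sum_transverse).
  have -> : a = 0 by apply/rowP => i; rewrite (ord1 i) a0 mxE.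
  by exists 0, 0; split=> // K t _ _ t0; rewrite seg_sum0// mulr0 mul0e adde0.
have [x [a' aE]] := ptP a; rewrite aE pt0 in a0; rewrite {}a0 in aE; rewrite {}aE.
have [P [c [c0 PE]]] := IH a'; clear IH.
pose Q : 'M[R]_(n.+2, n.+1) :=
  (block_mx (1%:M : 'M[R]_1) (0 : 'M[R]_(1, n)) (0 : 'M[R]_(n.+1, 1)) P : 'M[R]_(1 + n.+1, 1 + n)).
have QE y (v : 'rV[R]_n.+1) : pt y v *m Q = pt y (v *m P).
  have := @mul_row_block R 1 1 n.+1 1 n y%:M v 1%:M 0 0 P.
  by rewrite !mulmx0 mulmx1 addr0 add0r; apply.
exists Q, c; split=> // K t cK cvK t0.
have bK := borel_compact cK.
have bQK := borel_compact (compact_mulmx (M := Q) cK).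
have secQ y : [set v | [set v *m Q | v in K] (pt y v)] = [set v *m P | v in [set v | K (pt y v)]].
  apply/seteqP; split=> [v [w Kw]|_ [v Kv <-]].
    have [z [u wE]] := ptP w; rewrite wE QE => E.
    have zy : z = y by rewrite -(pt0 z (u *m P)) E pt0.
    exists u; first by rewrite /= -zy -wE.
    by apply/rowP => i; rewrite -(ptS z) E ptS.
  by exists (pt y v) => //; rewrite QE.
rewrite !volS.
transitivity (\int[@lebesgue_measure R]_y
   (vol [set v | K (pt y v)] + (t * c)%:E * vol [set v | [set v *m Q | v in K] (pt y v)]))%E.
  apply: eq_integral => y _; rewrite secQ -PE//.
  - congr vol; apply/seteqP; split=> [v [w [s [Kw st E]]]|_ [v [s [Kv st ->]]]].
      have [z [u wE]] := ptP w; move: E; rewrite wE ptZ ptD mulr0 addr0 => E.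
      have zy : y = z by rewrite -(pt0 y v) E pt0.
      exists u, s; split=> //; first by rewrite /= zy -wE.
      by apply/rowP => i; rewrite -(ptS y) E ptS.
    by exists (pt y v), s; split=> //; rewrite ptZ ptD mulr0 addr0.
  - exact: compact_section.
  - exact: cvx_section.
rewrite ge0_integralD//.
- rewrite ge0_integralZl//.
  + exact: measurable_vol_section.
  + by move=> y _; exact: vol_ge0.
  + by rewrite lee_fin mulr_ge0.
- by move=> y _; exact: vol_ge0.
- exact: measurable_vol_section.
- by move=> y _; apply: mule_ge0; rewrite ?lee_fin ?mulr_ge0//; exact: vol_ge0.
- by apply: measurable_funeM; exact: measurable_vol_section.
Qed.

Lemma vol_hyperplane n (u : 'cV[R]_n) (c : 'M[R]_1) (A : set 'rV[R]_n) : u != 0 -> borel A ->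
  (forall v, A v -> v *m u = c) -> vol A = 0%E.
Proof.
elim: n u c A => [|n IH] u c A u0 bA Au.
  by exfalso; move/eqP: u0; apply; apply/colP => -[].
pose u' : 'M[R]_(1 + n, 1) := u.
have ptu x (v : 'rV[R]_n) : pt x v *m u = x *: usubmx u' + v *m dsubmx u'.
  have := @mul_row_col R 1 1 n 1 x%:M v (usubmx u') (dsubmx u').
  by rewrite vsubmxK mul_scalar_mx => <-.
have [ud|ud] := eqVneq (dsubmx u') 0; last first.
  rewrite volS integral0_eq// => x _; apply: (IH _ (c - x *: usubmx u') _ ud).
    exact: borel_section.
  by move=> v /= /Au; rewrite ptu => <-; rewrite addrAC subrr add0r.
have uu : usubmx u' 0 0 != 0.
  apply: contraNneq u0 => u0; rewrite -[u]/u' -(vsubmxK u') ud.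
  rewrite [usubmx _]mx11_scalar u0; apply/eqP/matrixP => i j; rewrite !mxE.
  by case: splitP => k _; rewrite !mxE ?mul0rn.
have [m [mE volE]] := vol_fibres (0 : 'rV[R]_n); have [mA ->] := volE _ bA.
rewrite integral0_eq// => t _.
apply/eqP; rewrite -measure_le0.
have -> : 0%E = @lebesgue_measure R [set (c 0 0 / usubmx u' 0 0)] by rewrite lebesgue_measure_set1.
apply: le_outer_measure => x /= /Au; rewrite ptu ud mulmx0 addr0 => <-.
by rewrite mxE mulfK.
Qed.

End SegmentSum.

(** * Volumes of the hulls of subfamilies *)

(** This is the limit e -> 0, made quantitative by Bernoulli's inequality. *)
Lemma scaling_limit (F : realFieldType) n (V S : F) : 0 <= V ->
  (forall e, 0 < e -> e < 1 -> (1 - e) ^+ n * V <= S) -> V <= S.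
Proof.
move=> V0 VS.
have bern (e : F) k : 0 < e -> e < 1 -> 1 - k%:R * e <= (1 - e) ^+ k.
  move=> e0 e1; elim: k => [|k IH]; first by rewrite mul0r subr0 expr0.
  rewrite exprSr; apply: le_trans (ler_wpM2r _ IH); last by lra.
  rewrite -natr1; have : 0 <= k%:R * e * e by rewrite !mulr_ge0// ltW.
  by nra.
have n0 : 0 < n.+2%:R :> F by rewrite ltr0n.
apply/ler_addgt0Pr => d d0.
(* The margin is chosen so that e * (n + 2) * (V + d) = d. *)
pose e := d / ((V + d) * n.+2%:R).
have Vd : 0 < V + d by rewrite ltr_wpDl.
have e0 : 0 < e by rewrite divr_gt0 ?mulr_gt0.
have eE : e * (V + d) * n.+2%:R = d by rewrite -mulrA divfK// gt_eqF ?mulr_gt0.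
have eVd : 0 < e * (V + d) by rewrite mulr_gt0.
have e1 : e < 1.
  rewrite ltr_pdivrMr ?mulr_gt0// mul1r.
  have : (V + d) * 2 <= (V + d) * n.+2%:R by rewrite ler_pM2l// ler_nat.
  lra.
apply: le_trans (_ : S + n%:R * (e * V) <= _).
  have := le_trans (ler_wpM2r V0 (bern e n e0 e1)) (VS e e0 e1).
  by rewrite mulrBl mul1r -mulrA; lra.
rewrite lerD2l -eE mulrC; apply: ler_pM; rewrite ?ler0n//.
- by rewrite mulr_ge0// ltW.
- by rewrite ler_pM2l// lerDl ltW.
- by rewrite ler_nat -addn2 leq_addr.
Qed.

Section HullEuler.
Local Open Scope classical_set_scope.
Local Open Scope ring_scope.
Variable R : realType.
Let mR := measurableTypeR R.

Definition fvol n (A : set 'rV[R]_n) : R := fine (vol A).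

Lemma fvolE n (A : set 'rV[R]_n) : compact A -> vol A = (fvol A)%:E.
Proof. by move=> cA; rewrite fineK// vol_compact. Qed.

Lemma fvol_ge0 n (A : set 'rV[R]_n) : 0 <= fvol A.
Proof. by rewrite fine_ge0// vol_ge0. Qed.

Variables (N n : nat) (p : 'I_N -> 'rV[R]_n).
Implicit Types (I J : {set 'I_N}) (x : 'rV[R]_n).

Let q x i := p i - x.

(** Dividing a relation by the sum of its coefficients gives barycentric
coordinates of [x]. *)
Lemma dependent_hull x J : dependent (q x) 0 J <-> hull p J x.
Proof.
split=> [[l [l0 [i iJ li]]]|[l [l0 l1 ->]]].
  rewrite submx0 => /eqP; under eq_bigr do rewrite scalerBr.
  rewrite sumrB -scaler_suml => /eqP; rewrite subr_eq0 => /eqP E.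
  have s0 : 0 < \sum_(i in J) l i.
    rewrite (bigD1 i)//= ltr_pwDl ?sumr_ge0//.
    - by rewrite lt_def li l0.
    - by move=> j /andP[jJ _]; exact: l0.
  set s := \sum_(i in J) l i in E s0.
  exists (fun i => if i \in J then l i / s else 0); split.
  - by move=> j; case: ifP => // jJ; rewrite divr_ge0 ?l0// ltW.
  - under eq_bigr => j jJ do rewrite jJ.
    by rewrite -mulr_suml mulfV// gt_eqF.
  - have -> : x = s^-1 *: (s *: x) by rewrite scalerA mulVf ?scale1r// gt_eqF.
    rewrite -E scaler_sumr; apply: eq_bigr => j jJ.
    by rewrite jJ scalerA mulrC.
exists l; split=> //.
  apply/exists_inP; apply: contraT => /exists_inPn h; move: l1.
  by rewrite big1 => [/esym/eqP|i /h/negPn/eqP//]; rewrite oner_eq0.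
rewrite submx0; under eq_bigr do rewrite scalerBr.
by rewrite sumrB -scaler_suml l1 scale1r subrr.
Qed.

Lemma balanced_hull x I : I != finset.set0 -> balanced (q x) 0 I -> hull p I x.
Proof. by move=> I0 /(balanced_dependent I0)/dependent_hull. Qed.

(** The image of the hull under the homothety of ratio [1 - e] centred at the mean
of the points, written as a preimage.  Mixing in the mean makes all barycentric
coordinates positive. *)
Definition shrunk_hull I (e : R) : set 'rV[R]_n :=
  [set x | hull p I ((1 - e)^-1 *: x
    - ((1 - e)^-1 * e) *: (#|I|%:R^-1 *: \sum_(i in I) p i))].

Lemma shrunk_balanced x I e : I != finset.set0 -> 0 < e -> e < 1 ->
  shrunk_hull I e x -> balanced (q x) 0 I.
Proof.
move=> I0 e0 e1 [l [l0 l1 lE]].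
have cI : 0 < #|I|%:R :> R by rewrite ltr0n card_gt0.
have e1' : 0 < 1 - e by rewrite subr_gt0.
exists (fun i => (1 - e) * l i + e * #|I|%:R^-1).
  move=> i iI; apply: ltr_wpDl; first by rewrite mulr_ge0 ?l0// ltW.
  by rewrite mulr_gt0// invr_gt0.
have sum1 : \sum_(i in I) ((1 - e) * l i + e * #|I|%:R^-1) = 1.
  rewrite big_split/= -mulr_sumr l1 sumr_const mulr1 -[X in _ + X]mulr_natr.
  by rewrite -mulrA mulVf ?gt_eqF// mulr1 subrK.
rewrite submx0; under eq_bigr do rewrite scalerBr.
rewrite sumrB -scaler_suml sum1 scale1r subr_eq0.
under eq_bigr do rewrite scalerDl -!scalerA.
rewrite big_split/= -!scaler_sumr -lE scalerBr !scalerA mulfV ?gt_eqF// scale1r.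
rewrite (_ : (1 - e) * _ = e / #|I|%:R) ?subrK//.
by rewrite !mulrA mulfV ?mul1r// gt_eqF.
Qed.

Lemma vol_shrunk_hull I e : 0 < e -> e < 1 ->
  vol (shrunk_hull I e) = ((1 - e) ^+ n * fvol (hull p I))%:E.
Proof.
move=> e0 e1; have e1' : 0 < (1 - e)^-1 by rewrite invr_gt0 subr_gt0.
rewrite /shrunk_hull.
have := vol_affine (- (((1 - e)^-1 * e) *: (#|I|%:R^-1 *: \sum_(i in I) p i))) e1' (borel_compact (compact_hull (p := p) (J := I))).
move=> ->; rewrite fvolE; last exact: compact_hull.
by rewrite exprVn invrK -EFinM.
Qed.

Lemma borel_shrunk_hull I e : borel (shrunk_hull I e).
Proof.
have := borel_affine ((1 - e)^-1%:M) (- (((1 - e)^-1 * e) *: (#|I|%:R^-1 *: \sum_(i in I) p i))) (borel_compact (compact_hull (p := p) (J := I))).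
by congr borel; apply/seteqP; split=> x; rewrite /shrunk_hull /= mul_mx_scalar.
Qed.

(* The row space of [D I] is the direction of the affine hull of the points. *)
Let D I : 'M[R]_n := (\sum_(i in I) \sum_(j in I) <<p i - p j>>)%MS.

Let subD I i j : i \in I -> j \in I -> (p i - p j <= D I)%MS.
Proof.
move=> iI jI; apply: (sumsmx_sup i) => //; apply: (sumsmx_sup j) => //.
by rewrite genmxE.
Qed.

(** The points with index in [I] lie in a hyperplane, an equation of which is a
nonzero column of the cokernel. *)
Lemma hull_flat I : I != finset.set0 -> (\rank (D I) < n)%N ->
  forall J, J \subset I -> fvol (hull p J) = 0.
Proof.
move=> /finset.set0Pn[k kI] rD J JI.
have : cokermx (D I) != 0 by rewrite -mxrank_eq0 mxrank_coker -lt0n subn_gt0.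
move=> cD0; have [j uj] : exists j, col j (cokermx (D I)) != 0.
  apply/existsP; apply: contraNT cD0 => /existsPn h; apply/eqP/matrixP => a b.
  by have /negPn/eqP/colP/(_ a) := h b; rewrite !mxE.
rewrite /fvol (vol_hyperplane (c := p k *m col j (cokermx (D I))) uj (borel_compact (compact_hull (p:=p) (J:=J))))//.
move=> _ [l [l0 l1 ->]]; apply/eqP; rewrite -subr_eq0 -mulmxBl.
rewrite -[p k]scale1r -l1 scaler_suml -sumrB mulmx_suml big1// => i iJ.
have iI := fintype.subsetP JI _ iJ.
have /submxP[w E] := subD iI kI.
rewrite -scalerBr -scalemxAl E -mulmxA colE (mulmxA (D I)) mulmx_coker mul0mx mulmx0 scaler0//.
Qed.

Lemma hull_set0 : hull p finset.set0 = set0.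
Proof.
by apply/seteqP; split=> // x [l [_]]; rewrite big_set0 => /esym/eqP; rewrite oner_eq0.
Qed.

Let s J : R := - ((-1) ^+ n * (-1) ^+ #|J|).

(** This is Euler's relation for the vectors from [x] to the points.  It counts the
subsets [J] whose hull misses [x]; those whose hull contains [x] are obtained
from the vanishing of the alternating sum over all [J]. *)
Lemma hull_euler_pointwise I x : I != finset.set0 -> \rank (D I) = n ->
  \sum_(J : {set 'I_N} | J \subset I) s J * \1_(hull p J) x = `[< balanced (q x) 0 I >]%:R.
Proof.
move=> I0 rD.
have rk : \rank (span_over (q x) 0 I) = n.
  apply/eqP; rewrite eqn_leq rank_leq_row /= -{1}rD; apply: mxrankS.
  apply/sumsmx_subP => i iI; apply/sumsmx_subP => j jI; rewrite genmxE.
  have -> : p i - p j = q x i - q x j by rewrite /q opprB addrA subrK.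
  by rewrite addmx_sub ?eqmx_opp// (submx_trans _ (addsmxSr _ _))//; [apply: (sumsmx_sup i)|apply: (sumsmx_sup j)]; rewrite ?genmxE.
have := cone_euler (q x) 0 I; rewrite /cone_euler_at /euler_sum rk mxrank0 addn0 => E.
have -> : `[< balanced (q x) 0 I >]%:R = (-1) ^+ n * ((-1) ^+ n * `[< balanced (q x) 0 I >]%:R) :> R.
  by rewrite mulrA -expr2 sqrr_sign mul1r.
rewrite -E.
have := alternating_sum_subset R I; rewrite (negbTE I0) => E0.
transitivity (\sum_(J : {set 'I_N} | J \subset I) s J * \1_(hull p J) x +
    (-1) ^+ n * \sum_(J : {set 'I_N} | J \subset I) (-1) ^+ #|J|).
  by rewrite E0 mulr0 addr0.
rewrite !mulr_sumr -big_split /=.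
apply: eq_bigr => J _; rewrite /s indicE.
have -> : (x \in hull p J) = `[< dependent (q x) 0 J >].
  apply/idP/asboolP; first by rewrite inE => /dependent_hull.
  by move/dependent_hull; rewrite inE.
by case: `[< _ >] => /=; ring.
Qed.

(** Integrate [hull_euler_pointwise].  Its right-hand side is the indicator of the
interior of [hull p I]; it lies between the indicators of the hull and of its
shrunk copies, whose volumes tend to that of the hull. *)
Lemma fvol_hull_euler I :
  \sum_(J : {set 'I_N} | J \subset I) (-1) ^+ #|J| * fvol (hull p J) =
  - ((-1) ^+ n * fvol (hull p I)).
Proof.
have [->|I0] := eqVneq I finset.set0.
  rewrite (eq_bigl _ _ (fun J => finset.subset0 J)) big_pred1_eq hull_set0.
  by rewrite /fvol vol_set0 !mulr0 oppr0.
have [rD|rD] := ltnP (\rank (D I)) n.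
  rewrite big1 => [|J JI]; rewrite (hull_flat I0 rD) ?mulr0 ?oppr0//.
have {rD} rD : \rank (D I) = n by apply/eqP; rewrite eqn_leq rD rank_leq_row.
set V := fvol (hull p I).
suff : \sum_(J : {set 'I_N} | J \subset I) s J * fvol (hull p J) = V.
  move=> <-; rewrite mulr_sumr -sumrN; apply: eq_bigr => J _.
  by rewrite /s mulNr mulrN opprK -!mulrA mulrA -expr2 sqrr_sign mul1r.
set S := \sum_(J | _) _.
have [m mE] := vol_measure R n.
pose g (t : n.-tuple mR) := \sum_(J : {set 'I_N} | J \subset I) s J * \1_(hull p J) (row_of t).
have integI (A : set 'rV[R]_n) : borel A -> (\int[m]_t (\1_A (row_of t))%:E = vol A)%E.
  move=> bA; rewrite mE; have := integral_indic m measurableT bA.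
  by rewrite setIT.
have intI (A : set 'rV[R]_n) : borel A -> vol A \is a fin_num ->
    m.-integrable setT (fun t => (\1_A (row_of t))%:E).
  move=> bA fA; apply/integrableP; split.
    by apply/measurable_EFinP; exact: (measurable_indic bA).
  under eq_integral do rewrite gee0_abs ?lee_fin//.
  by rewrite integI// -ge0_fin_numE ?vol_ge0.
have bH J : borel (hull p J) by apply: borel_compact; exact: compact_hull.
have fH J : vol (hull p J) \is a fin_num by apply: vol_compact; exact: compact_hull.
have gsum t : (g t)%:E = (\sum_(J : {set 'I_N} | J \subset I) (s J)%:E * (\1_(hull p J) (row_of t))%:E)%E.
  by rewrite sumEFin.
have intsJ J : m.-integrable setT (fun t => (s J)%:E * (\1_(hull p J) (row_of t))%:E)%E.
  exact/integrableZl/intI.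
have intg : m.-integrable setT (fun t => (g t)%:E).
  under eq_fun do rewrite gsum; exact: integrable_sum.
have gS : (\int[m]_t (g t)%:E = S%:E)%E.
  under eq_integral do rewrite gsum.
  rewrite integral_sum// -sumEFin; apply: eq_bigr => J _.
  rewrite integralZl ?integI// ?fvolE//; first exact: compact_hull.
  exact: intI.
have gE t : g t = `[< balanced (q (row_of t)) 0 I >]%:R by apply: hull_euler_pointwise.
have SV : S <= V.
  rewrite -lee_fin -gS -fvolE; last exact: compact_hull.
  rewrite -integI//; apply: le_integral => // [|t _]; first exact: intI.
  rewrite gE indicE lee_fin; case: asboolP => //= /(balanced_hull I0) h.
  by rewrite mem_set.
have VS e : 0 < e -> e < 1 -> (1 - e) ^+ n * V <= S.
  move=> e0 e1; rewrite -lee_fin -gS -vol_shrunk_hull// -integI; last exact: borel_shrunk_hull.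
  apply: le_integral => // [|t _].
    apply: intI; first exact: borel_shrunk_hull.
    by rewrite vol_shrunk_hull.
  rewrite gE indicE lee_fin; have [|] := boolP (_ \in _) => //.
  by rewrite inE => /(shrunk_balanced I0 e0 e1) h; rewrite (_ : `[< _ >])//; exact/asboolP.
apply/eqP; rewrite eq_le SV /=.
exact: scaling_limit (fvol_ge0 _) VS.
Qed.

End HullEuler.

(** * Adding a zonotope to a polytope *)

Section Zonotope.
Local Open Scope classical_set_scope.
Local Open Scope ring_scope.
Variable R : realType.

Definition add_segments n (K : set 'rV[R]_n) (l : seq 'rV[R]_n) (t : R) :=
  foldr (fun a A => seg_sum A a t) K l.

Lemma compact_add_segments n (K : set 'rV[R]_n) l t : compact K -> compact (add_segments K l t).
Proof. by move=> cK; elim: l => //= a l; exact: compact_seg_sum. Qed.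

Lemma cvx_add_segments n (K : set 'rV[R]_n) l t : cvx K -> cvx (add_segments K l t).
Proof. by move=> cK; elim: l => //= a l; exact: cvx_seg_sum. Qed.

Lemma add_segments_mulmx m n (K : set 'rV[R]_m) l t (M : 'M[R]_(m, n)) :
  [set v *m M | v in add_segments K l t] =
  add_segments [set v *m M | v in K] [seq a *m M | a <- l] t.
Proof. by elim: l => //= a l IH; rewrite seg_sum_mulmx IH. Qed.

(** The segment [a] adds to the polynomial of [J] the product of the variable and
the polynomial of the projected family, up to a constant.  The law survives
because the variable changes its sign under t |-> - t and the projected family
lives in one dimension less. *)
Lemma steiner_zonotope N n (p : 'I_N -> 'rV[R]_n) (l : seq 'rV[R]_n) :
  exists w : {set 'I_N} -> {poly R}, [/\ forall J, (size (w J) <= n.+1)%N,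
    forall J t, 0 <= t -> vol (add_segments (hull p J) l t) = ((w J).[t])%:E &
    forall (I : {set 'I_N}) (t : R), \sum_(J : {set 'I_N} | J \subset I) (-1) ^+ #|J| * (w J).[t] =
      - ((-1) ^+ n * (w I).[- t])].
Proof.
move: {2}(size l) (erefl (size l)) => m; elim: m n p l => [|m IH] n p l.
  move/size0nil => -> /=; exists (fun J => (fvol (hull p J))%:P); split.
  - by move=> J; apply: leq_trans (size_polyC_leq1 _) _.
  - by move=> J t _; rewrite hornerC; apply: fvolE; exact: compact_hull.
  - by move=> I t; under eq_bigr do rewrite hornerC; rewrite fvol_hull_euler hornerC.
case: l => // a l /= [lm]; have [w1 [s1 v1 e1]] := IH n p l lm.
case: n => [|n] in p a l lm w1 s1 v1 e1 *.
  have -> : a = 0 by apply/rowP => -[].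
  by exists w1; split=> // J t t0; rewrite seg_sum0// v1.
have [P [c [c0 PE]]] := vol_seg_sum a.
have [|w2 [s2 v2 e2]] := IH n (fun i => p i *m P) [seq b *m P | b <- l].
  by rewrite size_map.
exists (fun J => w1 J + c *: ('X * w2 J)); split.
- move=> J; apply: leq_trans (size_polyD _ _) _; rewrite geq_max s1 /=.
  apply: leq_trans (size_scale_leq _ _) _; rewrite mulrC.
  have [->|w0] := eqVneq (w2 J) 0; first by rewrite mul0r size_poly0.
  by rewrite size_mulX// ltnS.
- move=> J t t0; rewrite PE//; last 2 first.
  + exact/compact_add_segments/compact_hull.
  + exact/cvx_add_segments/cvx_hull.
  rewrite v1// add_segments_mulmx hull_mulmx v2// -EFinM -EFinD !(hornerD, hornerZ, hornerM, hornerX).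
  by congr (_%:E); ring.
- move=> I t; under eq_bigr do rewrite !(hornerD, hornerZ, hornerM, hornerX) mulrDr.
  rewrite big_split/= e1 !(hornerD, hornerZ, hornerM, hornerX).
  have -> : \sum_(J : {set 'I_N} | J \subset I) (-1) ^+ #|J| * (c * (t * (w2 J).[t])) =
      c * t * \sum_(J : {set 'I_N} | J \subset I) (-1) ^+ #|J| * (w2 J).[t].
    by rewrite mulr_sumr; apply: eq_bigr => J _; ring.
  by rewrite e2 exprS; ring.
Qed.

End Zonotope.

(** * First absolute moment of a random walk *)

Section RandomWalk.
Local Open Scope classical_set_scope.
Local Open Scope ring_scope.
Variable R : realType.
Implicit Types (F D : R -> R) (ys zs : seq R) (x y : R).

(** The mean of [F] after one step of [y] or [- y] from [x], with equal
probabilities.  Iterated, it gives the means over all choices of signs along a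
walk without any reference to a probability space. *)
Definition smear y F x := (F (x + y) + F (x - y)) / 2.

Definition walk ys F := foldr smear F ys.

Lemma walk_cat ys zs F : walk (ys ++ zs) F = walk ys (walk zs F).
Proof. by rewrite /walk foldr_cat. Qed.

Lemma smear_dist y F D c : (forall x, `|F x - D x| <= c) ->
  forall x, `|smear y F x - smear y D x| <= c.
Proof.
move=> FD x; rewrite /smear -mulrBl opprD addrACA normrM (ger0_norm (x := 2^-1)); last by lra.
have := ler_normD (F (x + y) - D (x + y)) (F (x - y) - D (x - y)).
by have := FD (x + y); have := FD (x - y); lra.
Qed.

Lemma walk_dist ys F D c : (forall x, `|F x - D x| <= c) ->
  forall x, `|walk ys F x - walk ys D x| <= c.
Proof. by move=> FD; elim: ys => [//|y ys IH]; exact: smear_dist. Qed.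

(** [D] stands for the second derivative of [F].  These two estimates are all that
the replacement method uses, and unlike derivatives they pass to averages at
once.  The constants fit [smooth_abs]. *)
Definition taylor2 F D :=
  (forall x y, `|D x - D y| <= 4 * `|x - y|) /\
  (forall x y, `|smear y F x - F x - y ^+ 2 / 2 * D x| <= `|y| ^+ 3).

Lemma taylor2_smear z F D : taylor2 F D -> taylor2 (smear z F) (smear z D).
Proof.
move=> [lipD tayF]; split=> x y.
  have -> : smear z D x - smear z D y = ((D (x + z) - D (y + z)) + (D (x - z) - D (y - z))) / 2.
    by rewrite /smear; ring.
  rewrite normrM (ger0_norm (x := 2^-1)); last by lra.
  have := ler_normD (D (x + z) - D (y + z)) (D (x - z) - D (y - z)).
  have := lipD (x + z) (y + z); have := lipD (x - z) (y - z).
  have -> : x - z - (y - z) = x - y by ring.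
  have -> : x + z - (y + z) = x - y by ring.
  by lra.
set e := (X in `|X|).
have -> : e = ((smear y F (x + z) - F (x + z) - y ^+ 2 / 2 * D (x + z)) +
               (smear y F (x - z) - F (x - z) - y ^+ 2 / 2 * D (x - z))) / 2.
  rewrite /e /smear (addrAC x z y) (addrAC x z (- y)) (addrAC x (- z) y) (addrAC x (- z) (- y)); ring.
rewrite normrM (ger0_norm (x := 2^-1)); last by lra.
apply: le_trans (ler_wpM2r _ (ler_normD _ _)) _; first by lra.
by have := tayF (x + z) y; have := tayF (x - z) y; lra.
Qed.

Lemma taylor2_walk ys F D : taylor2 F D -> taylor2 (walk ys F) (walk ys D).
Proof. by move=> FD; elim: ys => //= y ys; exact: taylor2_smear. Qed.

Lemma walk_lipschitz ys D b : (forall x y, `|D x - D y| <= 4 * `|x - y|) ->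
  (forall y, y \in ys -> `|y| <= b) ->
  forall x, `|walk ys D x - D x| <= 4 * (size ys)%:R * b.
Proof.
move=> lipD; elim: ys => [|y ys IH] yb x /=.
  by rewrite subrr normr0 mulr0 mul0r.
have yb' : `|y| <= b by apply: yb; rewrite inE eqxx.
have {}IH := IH (fun z zys => yb z (mem_behead (s := y :: ys) zys)).
have := smear_dist y IH x.
have : `|smear y D x - D x| <= 4 * b.
  rewrite /smear; have -> : (D (x + y) + D (x - y)) / 2 - D x =
    ((D (x + y) - D x) + (D (x - y) - D x)) / 2 by field.
  rewrite normrM (ger0_norm (x := 2^-1)); last by lra.
  have := ler_normD (D (x + y) - D x) (D (x - y) - D x).
  have := lipD (x + y) x; have := lipD (x - y) x.
  by rewrite [x + y]addrC addrK [x - y]addrC addrK normrN; lra.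
have := ler_normD (smear y (walk ys D) x - smear y D x) (smear y D x - D x).
by rewrite addrA subrK -natr1; lra.
Qed.

(** The error, in units of the cube of the largest step, in the second-order
expansion of a walk of [n] steps: each step contributes 1 by its Taylor
remainder and at most [2 * n] by the variation of the second derivative. *)
Definition swap_cost (n : nat) : R := n%:R * (1 + 2 * n%:R).

(** The steps are expanded one at a time; the second derivative varies little along
the walk by [walk_lipschitz]. *)
Lemma walk_taylor2 ys F D b : taylor2 F D -> 0 <= b ->
  (forall y, y \in ys -> `|y| <= b) -> forall x,
  `|walk ys F x - F x - (\sum_(y <- ys) y ^+ 2) / 2 * D x|
    <= swap_cost (size ys) * b ^+ 3.
Proof.
move=> FD b0; elim: ys => [|y ys IH] yb x.
  by rewrite big_nil /= subrr /swap_cost !mul0r subr0 normr0.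
have yb' : `|y| <= b by apply: yb; rewrite inE eqxx.
have ysb z : z \in ys -> `|z| <= b by move=> zys; apply: yb; rewrite inE zys orbT.
have {}IH := IH ysb x; rewrite /swap_cost in IH *.
have [_ /(_ x y) h1] := taylor2_walk ys FD.
have h2 := walk_lipschitz FD.1 ysb x.
rewrite big_cons /= mulrDl (mulrDl _ _ (D x)).
set s := (\sum_(_ <- _) _) / 2 * D x in IH *.
set W := walk ys F in IH h1 *; set V := walk ys D in h1 h2.
set n := (size ys)%:R in IH h2 *.
have -> : (size ys).+1%:R = n + 1 by rewrite -natr1.
have n0 : 0 <= n by exact: ler0n.
have -> : smear y W x - F x - (y ^+ 2 / 2 * D x + s) =
  (smear y W x - W x - y ^+ 2 / 2 * V x) + (W x - F x - s) + y ^+ 2 / 2 * (V x - D x) by ring.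
have y3 : `|y| ^+ 3 <= b ^+ 3 by rewrite lerXn2r ?nnegrE.
have y2 : `|y ^+ 2 / 2 * (V x - D x)| <= b ^+ 2 / 2 * (4 * n * b).
  rewrite normrM; apply: ler_pM => //.
  rewrite normrM (ger0_norm (x := 2^-1)); last by lra.
  by rewrite ler_wpM2r// normrX lerXn2r ?nnegrE.
have b3 : 0 <= b ^+ 3 by rewrite exprn_ge0.
have nb3 : 0 <= n * b ^+ 3 by rewrite mulr_ge0.
apply: le_trans (ler_normD _ _) _; apply: le_trans (lerD (ler_normD _ _) (lexx _)) _.
have E : b ^+ 2 / 2 * (4 * n * b) = 2 * (n * b ^+ 3) by rewrite !exprS expr0; field.
rewrite E in y2; have := le_trans h1 y3 => h1'.
have -> : (n + 1) * (1 + 2 * (n + 1)) * b ^+ 3 =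
  n * (1 + 2 * n) * b ^+ 3 + 4 * (n * b ^+ 3) + 3 * b ^+ 3 by ring.
lra.
Qed.

Lemma walk_swap ys zs F D b x : taylor2 F D -> 0 <= b ->
  (forall y, y \in ys -> `|y| <= b) -> (forall y, y \in zs -> `|y| <= b) ->
  \sum_(y <- ys) y ^+ 2 = \sum_(y <- zs) y ^+ 2 ->
  `|walk ys F x - walk zs F x| <= (swap_cost (size ys) + swap_cost (size zs)) * b ^+ 3.
Proof.
move=> FD b0 yb zb yz.
have h1 := walk_taylor2 FD b0 yb x; have h2 := walk_taylor2 FD b0 zb x.
rewrite -yz in h2; rewrite distrC in h2.
set s := (\sum_(_ <- _) _) / 2 * D x in h1 h2.
have -> : walk ys F x - walk zs F x =
  (walk ys F x - F x - s) + (s - (walk zs F x - F x)) by ring.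
by rewrite mulrDl; apply: le_trans (ler_normD _ _) (lerD h1 h2).
Qed.

(** Lindeberg's replacement: the blocks [ys] are replaced by [zs] one at a time, and
each replacement costs only a third-order error because the sums of squares
agree. *)
Lemma walk_swap_iter ys zs F D b m x : taylor2 F D -> 0 <= b ->
  (forall y, y \in ys -> `|y| <= b) -> (forall y, y \in zs -> `|y| <= b) ->
  \sum_(y <- ys) y ^+ 2 = \sum_(y <- zs) y ^+ 2 ->
  `|walk (flatten (nseq m ys)) F x - walk (flatten (nseq m zs)) F x|
     <= m%:R * ((swap_cost (size ys) + swap_cost (size zs)) * b ^+ 3).
Proof.
move=> FD b0 yb zb yz; elim: m x => [|m IH] x /=; first by rewrite subrr normr0 mul0r.
rewrite !walk_cat.
have FD' := taylor2_walk (flatten (nseq m zs)) FD.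
have h1 := walk_swap x FD' b0 yb zb yz.
have h2 := walk_dist ys IH x.
rewrite -natr1 mulrDl mul1r.
apply: le_trans (lerD h2 h1).
set u := walk ys _ x; set v := walk zs _ x; set w := walk ys _ x.
by have -> : u - v = (u - w) + (w - v); [ring|exact: ler_normD].
Qed.

Let cube x y : 0 <= x -> 0 <= y ->
  `| `|x + y| ^+ 3 + `|x - y| ^+ 3 - 2 * `|x| ^+ 3 - 6 * `|x| * y ^+ 2| <= 2 * `|y| ^+ 3.
Proof.
move=> x0 y0; rewrite (ger0_norm (x := x + y)) ?addr_ge0// (ger0_norm x0) (ger0_norm y0).
have [xy|yx] := leP y x.
  rewrite (ger0_norm (x := x - y)) ?subr_ge0//.
  have -> : (x + y) ^+ 3 + (x - y) ^+ 3 - 2 * x ^+ 3 - 6 * x * y ^+ 2 = 0 by ring.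
  by rewrite normr0 mulr_ge0// exprn_ge0.
rewrite (ltr0_norm (x := x - y)) ?subr_lt0//.
have -> : (x + y) ^+ 3 + (- (x - y)) ^+ 3 - 2 * x ^+ 3 - 6 * x * y ^+ 2 = 2 * (y - x) ^+ 3 by ring.
have yx0 : 0 <= y - x by rewrite subr_ge0 ltW.
rewrite ger0_norm ?mulr_ge0 ?exprn_ge0//.
by rewrite ler_pM2l// lerXn2r ?nnegrE// gerBl.
Qed.

Lemma cube_second_difference x y :
  `| `|x + y| ^+ 3 + `|x - y| ^+ 3 - 2 * `|x| ^+ 3 - 6 * `|x| * y ^+ 2| <= 2 * `|y| ^+ 3.
Proof.
wlog x0 : x y / 0 <= x => [H|].
  have [/H//|x0] := leP 0 x.
  have /(H _ y) : 0 <= - x by rewrite oppr_ge0 ltW.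
  rewrite -(normrN (- x + y)) -(normrN (- x - y)) !opprD !opprK normrN.
  by rewrite [`|x - y| ^+ 3 + _]addrC.
wlog y0 : y / 0 <= y => [H|]; last exact: cube.
have [/H//|y0] := leP 0 y.
have /H : 0 <= - y by rewrite oppr_ge0 ltW.
by rewrite opprK normrN sqrrN [`|x - y| ^+ 3 + _]addrC.
Qed.

(** The convolution of the absolute value with the hat function on [-1, 1];
[smooth_abs2] is its second derivative. *)
Definition smooth_abs x := (`|x + 1| ^+ 3 - 2 * `|x| ^+ 3 + `|x - 1| ^+ 3) / 6.
Definition smooth_abs2 x := `|x + 1| - 2 * `|x| + `|x - 1|.

Lemma taylor2_smooth_abs : taylor2 smooth_abs smooth_abs2.
Proof.
split=> x y.
  rewrite /smooth_abs2.
  have := ler_dist_dist (x + 1) (y + 1); have := ler_dist_dist (x - 1) (y - 1).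
  have := ler_dist_dist x y.
  have -> : x - 1 - (y - 1) = x - y by ring.
  have -> : x + 1 - (y + 1) = x - y by ring.
  by rewrite !ler_norml => /andP[? ?] /andP[? ?] /andP[? ?]; apply/andP; split; lra.
have := cube_second_difference (x + 1) y; have := cube_second_difference x y.
have := cube_second_difference (x - 1) y.
rewrite /smear /smooth_abs /smooth_abs2.
rewrite !(addrAC x _ y) !(addrAC x _ (- y)) !ler_norml.
have y3 : 0 <= `|y| ^+ 3 by rewrite exprn_ge0.
by move=> /andP[? ?] /andP[? ?] /andP[? ?]; apply/andP; split; lra.
Qed.

Lemma smooth_abs_dist x : `|smooth_abs x - `|x| | <= 1.
Proof.
rewrite /smooth_abs; have [x0|x0] := leP 0 x.
  rewrite (ger0_norm x0) (ger0_norm (x := x + 1)); last lra.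
  have [x1|x1] := leP 1 x.
    rewrite (ger0_norm (x := x - 1)); last lra.
    rewrite (_ : _ / 6 - x = 0); last by field.
    by rewrite normr0.
  rewrite (ltr0_norm (x := x - 1)); last lra.
  rewrite (_ : _ / 6 - x = (1 - x) ^+ 3 / 3); last by field.
  rewrite ger0_norm; last by rewrite divr_ge0// exprn_ge0//; lra.
  have : (1 - x) ^+ 3 <= 1 by apply: exprn_ile1; lra.
  lra.
rewrite (ltr0_norm x0) (ltr0_norm (x := x - 1)); last lra.
have [x1|x1] := leP x (- 1).
  rewrite (ler0_norm (x := x + 1)); last lra.
  rewrite (_ : _ / 6 - - x = 0); last by field.
  by rewrite normr0.
rewrite (gtr0_norm (x := x + 1)); last lra.
rewrite (_ : _ / 6 - - x = (1 + x) ^+ 3 / 3); last by field.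
rewrite ger0_norm; last by rewrite divr_ge0// exprn_ge0//; lra.
have : (1 + x) ^+ 3 <= 1 by apply: exprn_ile1; lra.
lra.
Qed.

Lemma walk_abs_swap ys zs b m : 0 <= b ->
  (forall y, y \in ys -> `|y| <= b) -> (forall y, y \in zs -> `|y| <= b) ->
  \sum_(y <- ys) y ^+ 2 = \sum_(y <- zs) y ^+ 2 ->
  `|walk (flatten (nseq m ys)) Num.norm 0 - walk (flatten (nseq m zs)) Num.norm 0|
     <= 2 + m%:R * ((swap_cost (size ys) + swap_cost (size zs)) * b ^+ 3).
Proof.
move=> b0 yb zb yz.
have h := walk_swap_iter m 0 taylor2_smooth_abs b0 yb zb yz.
have hy := walk_dist (flatten (nseq m ys)) smooth_abs_dist 0.
have hz := walk_dist (flatten (nseq m zs)) smooth_abs_dist 0.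
move: h hy hz; rewrite !ler_norml => /andP[? ?] /andP[? ?] /andP[? ?].
by apply/andP; split; lra.
Qed.

Lemma walk_sqr m b x : walk (nseq m b) (fun x => x ^+ 2) x = x ^+ 2 + m%:R * b ^+ 2.
Proof.
elim: m x => [|m IH] x /=; first by rewrite mul0r addr0.
by rewrite /smear !IH -natr1; field.
Qed.

Lemma walk_4 m b x : walk (nseq m b) (fun x => x ^+ 4) x =
  x ^+ 4 + 6 * m%:R * b ^+ 2 * x ^+ 2 + (3 * m%:R ^+ 2 - 2 * m%:R) * b ^+ 4.
Proof.
elim: m x => [|m IH] x /=; first by rewrite !(mulr0, mul0r, expr0n, subr0, addr0).
by rewrite /smear !IH -natr1; field.
Qed.

Lemma walk_le ys F D x : (forall x, F x <= D x) -> walk ys F x <= walk ys D x.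
Proof.
move=> FD; elim: ys x => [//|y ys IH] x /=; rewrite /smear.
by have := IH (x + y); have := IH (x - y); lra.
Qed.

Lemma walk_lin ys F D (a c : R) x :
  walk ys (fun x => a * F x + c * D x) x = a * walk ys F x + c * walk ys D x.
Proof. by elim: ys x => [//|y ys IH] x /=; rewrite /smear !IH; ring. Qed.

(** The first absolute moment is bounded below by the second and the fourth, thanks
to |x| >= x^2 / s - x^4 / (4 s^3) with s the standard deviation of the walk. *)
Lemma walk_abs_lower j b : 0 < b -> (0 < j)%N ->
  j%:R * b / 4 <= walk (nseq (j ^ 2) b) Num.norm 0.
Proof.
move=> b0 j0; pose s : R := j%:R * b.
have s0 : 0 < s by rewrite mulr_gt0// ltr0n.
have low x : s^-1 * x ^+ 2 + (- (4 * s ^+ 3)^-1) * x ^+ 4 <= `|x|.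
  have [y y0 xs] : exists2 y, 0 <= y & `|x| = s * y.
    by exists (`|x| / s); [rewrite divr_ge0// ltW|rewrite mulrC divfK// gt_eqF].
  have -> : x ^+ 4 = `|x| ^+ 4 by rewrite -[LHS]ger0_norm ?exprn_even_ge0// normrX.
  rewrite -(real_normK (num_real x)) xs.
  have -> : s^-1 * (s * y) ^+ 2 + - (4 * s ^+ 3)^-1 * (s * y) ^+ 4 = s * (y ^+ 2 - y ^+ 4 / 4).
    by field; rewrite gt_eqF.
  (* It remains to see that y (y^3 - 4 y + 4) >= 0.  For y <= 2 the second factor
     is (y - 1)^2 (y + 2) + (2 - y). *)
  rewrite ler_pM2l//; have [y2|y2] := leP y 2.
    have : 0 <= y * (y - 1) ^+ 2 * (y + 2) + y * (2 - y).
      by apply: addr_ge0; [apply: mulr_ge0; [rewrite mulr_ge0// sqr_ge0|]|apply: mulr_ge0 => //]; lra.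
    rewrite (_ : _ + _ = 4 * y - 4 * y ^+ 2 + y ^+ 4); [lra|ring].
  have : 0 <= y * y * (y - 2) * (y + 2) by rewrite !mulr_ge0//; lra.
  rewrite (_ : _ * (y + 2) = y ^+ 4 - 4 * y ^+ 2); [lra|ring].
have := walk_le (nseq (j ^ 2) b) 0 low.
rewrite walk_lin walk_sqr walk_4; apply: le_trans.
rewrite !expr0n /= !(mulr0, add0r) natrX.
have -> : j%:R * b / 4 = s / 4 by [].
have -> : j%:R ^+ 2 * b ^+ 2 = s ^+ 2 by rewrite exprMn.
have j1 : 1 <= j%:R :> R by rewrite ler1n.
have : (3 * (j%:R ^+ 2) ^+ 2 - 2 * j%:R ^+ 2) * b ^+ 4 <= 3 * s ^+ 4.
  rewrite /s [X in _ <= _ * X]exprMn [leRHS]mulrA; apply: ler_wpM2r; first by rewrite exprn_ge0// ltW.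
  have := sqr_ge0 (j%:R : R); rewrite -exprM; lra.
move=> h; have s3 : 0 < (4 * s ^+ 3)^-1 by rewrite invr_gt0 mulr_gt0// exprn_gt0.
have := ler_wpM2l (ltW s3) h.
have -> : (4 * s ^+ 3)^-1 * (3 * s ^+ 4) = 3 / 4 * s by field; rewrite gt_eqF.
have -> : s^-1 * s ^+ 2 = s by field; rewrite gt_eqF.
lra.
Qed.

End RandomWalk.

(** * Vectors with almost constant sum of projections *)

Section ZonotopeBall.
Local Open Scope classical_set_scope.
Local Open Scope ring_scope.
Variable R : realType.

Definition dot n (u v : 'rV[R]_n) := \sum_i u 0 i * v 0 i.

Lemma dotC n (u v : 'rV[R]_n) : dot u v = dot v u.
Proof. by apply: eq_bigr => i _; rewrite mulrC. Qed.

Lemma dotDr n (u v w : 'rV[R]_n) : dot u (v + w) = dot u v + dot u w.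
Proof. by rewrite -big_split; apply: eq_bigr => i _; rewrite mxE mulrDr. Qed.

Lemma dotZr n (u v : 'rV[R]_n) c : dot u (c *: v) = c * dot u v.
Proof. by rewrite mulr_sumr; apply: eq_bigr => i _; rewrite mxE mulrCA. Qed.

Lemma dotNr n (u v : 'rV[R]_n) : dot u (- v) = - dot u v.
Proof. by rewrite -scaleN1r dotZr mulN1r. Qed.

Lemma dot0r n (u : 'rV[R]_n) : dot u 0 = 0.
Proof. by rewrite -(scale0r 0) dotZr mul0r. Qed.

Lemma dotDl n (u v w : 'rV[R]_n) : dot (v + w) u = dot v u + dot w u.
Proof. by rewrite !(dotC _ u) dotDr. Qed.

Lemma dotZl n (u v : 'rV[R]_n) c : dot (c *: v) u = c * dot v u.
Proof. by rewrite !(dotC _ u) dotZr. Qed.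

Lemma dotNl n (u v : 'rV[R]_n) : dot (- v) u = - dot v u.
Proof. by rewrite !(dotC _ u) dotNr. Qed.

Lemma dot_ge0 n (u : 'rV[R]_n) : 0 <= dot u u.
Proof. by apply: sumr_ge0 => i _; rewrite -expr2 sqr_ge0. Qed.

Lemma enorm_sqr n (u : 'rV[R]_n) : enorm u ^+ 2 = dot u u.
Proof. by rewrite sqr_sqrtr; [|rewrite sumr_ge0// => i _; exact: sqr_ge0]. Qed.

Lemma enorm_ge0 n (u : 'rV[R]_n) : 0 <= enorm u.
Proof. exact: sqrtr_ge0. Qed.

Lemma dot_eq0 n (u : 'rV[R]_n) : dot u u = 0 -> u = 0.
Proof.
move=> /eqP; rewrite psumr_eq0 => [/allP h|i _]; last by rewrite -expr2 sqr_ge0.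
apply/rowP => i; have := h i (mem_index_enum i); rewrite /= -expr2 sqrf_eq0 mxE.
by move/eqP.
Qed.

Lemma enormZ n (u : 'rV[R]_n) c : enorm (c *: u) = `|c| * enorm u.
Proof.
apply/eqP; rewrite -(eqrXn2 (n := 2)) ?mulr_ge0 ?enorm_ge0//.
by rewrite exprMn !enorm_sqr dotZl dotZr real_normK ?num_real// mulrA expr2.
Qed.

Lemma cauchy_schwarz n (u v : 'rV[R]_n) : dot u v <= enorm u * enorm v.
Proof.
have [v0|v0] := eqVneq (enorm v) 0.
  have /dot_eq0 -> : dot v v = 0 by rewrite -enorm_sqr v0 expr0n.
  by rewrite dot0r mulr_ge0 ?enorm_ge0.
have vv : 0 < dot v v by rewrite -enorm_sqr exprn_gt0// lt_neqAle eq_sym v0 enorm_ge0.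
have := dot_ge0 (dot v v *: u - dot u v *: v).
have -> : dot (dot v v *: u - dot u v *: v) (dot v v *: u - dot u v *: v) =
   dot v v * (dot u u * dot v v - dot u v ^+ 2).
  by rewrite dotDl !dotDr !(dotNl, dotNr, dotZl, dotZr) (dotC v u); ring.
rewrite pmulr_rge0// subr_ge0 -!enorm_sqr -exprMn => h.
apply: le_trans (ler_norm _) _.
rewrite -(ler_pXn2r (n := 2)) ?nnegrE ?mulr_ge0 ?enorm_ge0//.
by rewrite real_normK ?num_real.
Qed.

Fixpoint signed_sums n (S : seq 'rV[R]_n) : seq 'rV[R]_n :=
  if S is a :: S' then [seq a + b | b <- signed_sums S'] ++ [seq - a + b | b <- signed_sums S']
  else [:: 0].

(** A walk on the line whose steps are the products of [u] with given vectors is the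
image under [dot u] of a walk in space, whose end points are [signed_sums]. *)
Lemma walk_signed_sums n (S : seq 'rV[R]_n) u (F : R -> R) x :
  walk [seq dot u a | a <- S] F x =
  2 ^- size S * \sum_(b <- signed_sums S) F (x + dot u b).
Proof.
elim: S x => [|a S IH] x /=; first by rewrite expr0 invr1 mul1r big_seq1 dot0r addr0.
rewrite /smear !IH big_cat !big_map /= -mulrDr exprSr invfM.
rewrite [RHS]mulrAC; congr (_ * _ / _).
by congr (_ + _); apply: eq_bigr => b _; rewrite dotDr ?dotNr addrA.
Qed.

Lemma flatten_nseq1 (T : Type) m (x : T) : flatten (nseq m [:: x]) = nseq m x.
Proof. by elim: m => //= m ->. Qed.

(** Up to normalization, [l] consists of the end points of the walks in space that
make [m] steps of [eta] along each axis, for all choices of signs.  For a unit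
vector [u], the steps of one round project to steps on the line with sum of
squares [eta ^+ 2], so [walk_abs_swap] compares the mean of |<u, a>| with the
mean [c] for the walk of [m] steps [eta], which does not involve [u]. *)
Lemma almost_euclidean n (eps : R) : 0 < eps -> exists l : seq 'rV[R]_n,
  forall u, (1 - eps) * enorm u <= \sum_(a <- l) `|dot u a| <= (1 + eps) * enorm u.
Proof.
move=> eps0; pose C := swap_cost R n + swap_cost R 1.
have C0 : 0 <= C by rewrite addr_ge0// /swap_cost mulr_ge0// addr_ge0// mulr_ge0.
pose b := (Num.trunc (4 * (2 + C) / eps)).+1.
have bE : 4 * (2 + C) / eps <= b%:R.
  by apply/ltW/truncnS_gt.
(* With steps b^-2 and b^6 rounds, the replacement error m C eta^3 is C whereas
   [c] is at least b / 4. *)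
pose eta : R := b%:R ^- 2.
have b0 : 0 < b%:R :> R by rewrite ltr0n.
have eta0 : 0 < eta by rewrite invr_gt0 exprn_gt0.
pose j := (b ^ 3)%N; pose m := (j ^ 2)%N.
pose c := walk (nseq m eta) Num.norm 0.
have c_low : b%:R / 4 <= c.
  have := walk_abs_lower (b := eta) (j := j) eta0; rewrite expn_gt0 => /(_ isT).
  apply: le_trans; rewrite /j natrX /eta le_eqVlt; apply/orP; left; apply/eqP.
  by field; rewrite gt_eqF.
have c0 : 0 < c by apply: lt_le_trans c_low; rewrite divr_gt0.
pose S : seq 'rV[R]_n := flatten (nseq m [seq eta *: delta_mx 0 i | i <- enum 'I_n]).
pose h u := walk [seq dot u a | a <- S] Num.norm 0.
have hE u : dot u u = 1 -> (1 - eps) * c <= h u <= (1 + eps) * c.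
  move=> u1; pose ys := [seq eta * u 0 i | i <- enum 'I_n].
  have mapS : [seq dot u a | a <- S] = flatten (nseq m ys).
    rewrite /S map_flatten map_nseq; congr (flatten (nseq _ _)).
    rewrite -map_comp; apply: eq_map => i /=; rewrite dotZr; congr (_ * _).
    rewrite /dot (bigD1 i)//= mxE !eqxx mulr1 big1 ?addr0// => k ki.
    by rewrite mxE (negbTE ki) andbF mulr0.
  have ysb y : y \in ys -> `|y| <= eta.
    move=> /mapP[i _ ->]; rewrite normrM (gtr0_norm eta0) ler_piMr ?(ltW eta0)//.
    rewrite -(ler_pXn2r (n := 2)) ?nnegrE// expr1n real_normK ?num_real// -u1.
    rewrite /dot (bigD1 i)//= expr2 lerDl sumr_ge0// => k _.
    by rewrite -expr2 sqr_ge0.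
  have zsb y : y \in [:: eta] -> `|y| <= eta by rewrite inE => /eqP ->; rewrite gtr0_norm.
  have sums : \sum_(y <- ys) y ^+ 2 = \sum_(y <- [:: eta]) y ^+ 2.
    rewrite big_seq1 big_map big_enum /=; under eq_bigr do rewrite exprMn.
    rewrite -mulr_sumr -[RHS]mulr1; congr (_ * _).
    by rewrite -u1; apply: eq_bigr => i _; rewrite expr2.
  have := walk_abs_swap m (ltW eta0) ysb zsb sums.
  rewrite flatten_nseq1 -mapS -/(h u) -/c size_map size_enum_ord /= -/C.
  have -> : m%:R * (C * eta ^+ 3) = C.
    by rewrite /m /j /eta !natrX; field; rewrite gt_eqF.
  have : 2 + C <= eps * c.
    apply: le_trans (ler_wpM2l (ltW eps0) c_low).
    by move: bE; rewrite ler_pdivrMr//; lra.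
  by rewrite ler_norml => ? /andP[? ?]; apply/andP; split; lra.
pose l := [seq (c^-1 * 2 ^- size S) *: a | a <- signed_sums S].
have k0 : 0 <= c^-1 * 2 ^- size S.
  by rewrite mulr_ge0 ?invr_ge0 ?exprn_ge0// ltW.
have lE u : \sum_(a <- l) `|dot u a| = c^-1 * h u.
  rewrite /h walk_signed_sums big_map mulrA mulr_sumr; apply: eq_bigr => a _.
  by rewrite dotZr normrM (ger0_norm k0) add0r.
exists l => u; have [u0|u0] := eqVneq (enorm u) 0.
  have -> : u = 0 by apply: dot_eq0; rewrite -enorm_sqr u0 expr0n.
  rewrite big1 => [|a _]; last by rewrite dotC dot0r normr0.
  by rewrite -[X in enorm X](scale0r 0) enormZ normr0 mul0r !mulr0 lexx.
have nu : 0 < enorm u by rewrite lt_neqAle eq_sym u0 enorm_ge0.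
pose v := (enorm u)^-1 *: u.
have v1 : dot v v = 1.
  by rewrite dotZl dotZr -enorm_sqr expr2; field.
have -> : \sum_(a <- l) `|dot u a| = enorm u * \sum_(a <- l) `|dot v a|.
  rewrite mulr_sumr; apply: eq_bigr => a _.
  by rewrite dotZl normrM normfV (gtr0_norm nu) mulrA mulfV ?mul1r.
rewrite lE; have /andP[h1 h2] := hE v v1.
rewrite ![_ * enorm u]mulrC; apply/andP; split; rewrite ler_pM2l//.
- by rewrite ler_pdivlMl// mulrC.
- by rewrite ler_pdivrMl// mulrC.
Qed.

End ZonotopeBall.

(** * Zonotopes close to the ball *)

Section ZonotopeApproximation.
Local Open Scope classical_set_scope.
Local Open Scope ring_scope.
Variable R : realType.

Definition zonotope n (l : seq 'rV[R]_n) := add_segments [set 0] l 1.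

Lemma compact_zonotope n (l : seq 'rV[R]_n) : compact (zonotope l).
Proof. by apply: compact_add_segments; exact: compact_set1. Qed.

Lemma cvx_zonotope n (l : seq 'rV[R]_n) : cvx (zonotope l).
Proof.
by apply: cvx_add_segments => x y t -> -> _ _; rewrite !scaler0 addr0.
Qed.

Lemma add_segmentsE n (K : set 'rV[R]_n) l t : 0 <= t ->
  add_segments K l t = [set x + t *: z | x in K & z in zonotope l].
Proof.
move=> t0; elim: l => [|a l IH] /=.
  apply/seteqP; split=> [x Kx|_ [x Kx [_ -> <-]]]; last by rewrite scaler0 addr0.
  by exists x => //; exists 0; rewrite ?scaler0 ?addr0.
rewrite {}IH; apply/seteqP; split=> [_ [_ [s [[x Kx [z Zz <-]] st ->]]]|].
  exists x => //; exists (z + (s / t) *: a); last first.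
    rewrite scalerDr scalerA addrA; congr (_ + _ *: _).
    have [t0'|tn0] := eqVneq t 0; last by rewrite mulrC divfK.
    by move: st; rewrite t0' mul0r normr_le0 => /eqP.
  exists z, (s / t); split=> //.
  have [t0'|tn0] := eqVneq t 0; first by rewrite t0' invr0 mulr0 normr0.
  by rewrite normrM normfV (ger0_norm t0) ler_pdivrMr ?mul1r// lt_neqAle eq_sym tn0.
move=> _ [x Kx [_ [z [s [Zz s1 ->]]] <-]]; exists (x + t *: z), (t * s); split.
- by exists x => //; exists z.
- by rewrite normrM (ger0_norm t0) ler_piMr.
- by rewrite scalerDr scalerA addrA.
Qed.

Lemma zonotope_support n (l : seq 'rV[R]_n) u z :
  zonotope l z -> dot u z <= \sum_(a <- l) `|dot u a|.
Proof.
elim: l z => [|a l IH] z /=; first by move=> ->; rewrite big_nil dot0r.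
move=> [y [s [Zy s1 ->]]]; rewrite big_cons dotDr dotZr addrC.
apply: lerD; last exact: IH.
apply: le_trans (ler_norm _) _; rewrite normrM; exact: ler_piMl.
Qed.

Lemma zonotope_vertex n (l : seq 'rV[R]_n) u :
  exists2 z, zonotope l z & dot u z = \sum_(a <- l) `|dot u a|.
Proof.
elim: l => [|a l [z Zz zE]]; first by exists 0; rewrite ?big_nil ?dot0r.
exists (z + Num.sg (dot u a) *: a).
  exists z, (Num.sg (dot u a)); split=> //.
  by rewrite normr_sg; case: (_ != 0).
by rewrite big_cons dotDr dotZr zE addrC normrEsg.
Qed.

Lemma continuous_dist_sqr n (y : 'rV[R]_n) : continuous (fun z : 'rV[R]_n => dot (y - z) (y - z)).
Proof.
apply: continuous_sum => i z.
have c : {for z, continuous (fun z : 'rV[R]_n => (y - z) 0 i)}.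
  rewrite (_ : (fun z : 'rV[R]_n => (y - z) 0 i) = (fun z => y 0 i - z 0 i)); last first.
    by apply/funext => v; rewrite !mxE.
  by apply: (@continuousB R R^o); [exact: cst_continuous|exact: continuous_coord].
exact: continuousM.
Qed.

(** [u] is the vector from the nearest point of [K] to [y]. *)
Lemma separation n (K : set 'rV[R]_n) y : compact K -> cvx K -> K !=set0 -> ~ K y ->
  exists2 u, 0 < dot u u & forall z, K z -> dot u z <= dot u y - dot u u.
Proof.
move=> cK cvK K0 Ky.
have [z0] := compact_EVT_min K0 cK (continuous_subspaceT (@continuous_dist_sqr n y)).
rewrite inE => Kz0 zmin; exists (y - z0).
  rewrite lt_neqAle dot_ge0 andbT; apply/eqP => /esym/dot_eq0/eqP.
  by rewrite subr_eq0 => /eqP yz; apply: Ky; rewrite yz.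
move=> z Kz.
have [u uE] : exists u, y - z0 = u by exists (y - z0).
have [w wE] : exists w, z - z0 = w by exists (z - z0).
have z0E : z0 = y - u by rewrite -uE opprB addrC subrK.
have -> : dot (y - z0) y - dot (y - z0) (y - z0) = dot u z0 by rewrite uE z0E dotDr dotNr.
have zE : z = w + z0 by rewrite -wE subrK.
rewrite uE zE dotDr gerDr leNgt; apply/negP => d0.
set d := dot u w in d0; have ww := dot_ge0 w.
have wd : 0 < dot w w + d by rewrite ltr_wpDl.
pose s := d / (dot w w + d).
have s0 : 0 < s by rewrite divr_gt0.
have s1 : s <= 1 by rewrite ler_pdivrMr// mul1r lerDr.
have Kzs := cvK z z0 s Kz Kz0 (ltW s0) s1.
have := zmin (s *: z + (1 - s) *: z0); rewrite inE => /(_ Kzs).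
have -> : y - (s *: z + (1 - s) *: z0) = u - s *: w.
  by rewrite -uE -wE; apply/rowP => i; rewrite !mxE; ring.
have -> : dot (u - s *: w) (u - s *: w) = dot u u - 2 * (s * d) + s * (s * dot w w).
  by rewrite dotDl !dotDr !(dotNl, dotNr, dotZl, dotZr) (dotC w u) -/d; ring.
rewrite uE.
have sww : s * dot w w <= d.
  by rewrite /s mulrAC ler_pdivrMr// ler_pM2l// lerDl ltW.
apply/negP; rewrite -ltNge.
have : s * (s * dot w w) <= s * d by rewrite ler_pM2l.
have : 0 < s * d by rewrite mulr_gt0.
lra.
Qed.

Lemma zonotope_sub_ball n (l : seq 'rV[R]_n) c : 0 <= c ->
  (forall u, \sum_(a <- l) `|dot u a| <= c * enorm u) -> zonotope l `<=` @cball0 R n c.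
Proof.
move=> c0 h z Zz; rewrite /cball0 /=; have := le_trans (zonotope_support z Zz) (h z).
rewrite -enorm_sqr expr2; have [->//|z0] := eqVneq (enorm z) 0.
by rewrite ler_pM2r// lt_neqAle eq_sym z0 enorm_ge0.
Qed.

(** A point outside the zonotope is separated from it by some [u]; but in the
direction [u] the zonotope extends at least as far as the ball. *)
Lemma ball_sub_zonotope n (l : seq 'rV[R]_n) c :
  (forall u, c * enorm u <= \sum_(a <- l) `|dot u a|) -> @cball0 R n c `<=` zonotope l.
Proof.
move=> h y; rewrite /cball0 /= => yc; apply: contrapT => Zy.
have [z0 Zz0 _] := zonotope_vertex l 0.
have [u uu hu] := separation (@compact_zonotope _ l) (@cvx_zonotope _ l) (ex_intro _ z0 Zz0) Zy.
have [z Zz zE] := zonotope_vertex l u.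
have := hu z Zz; rewrite zE => h1.
have := le_trans (h u) h1; have := cauchy_schwarz u y.
have : enorm u * enorm y <= enorm u * c by rewrite ler_wpM2l// enorm_ge0.
by move: uu; rewrite [c * _]mulrC; lra.
Qed.

End ZonotopeApproximation.

(** * Steiner polynomials of polytopes *)

Section SteinerBall.
Local Open Scope classical_set_scope.
Local Open Scope ring_scope.
Variable R : realType.

Lemma compact_cball0 n r : 0 <= r -> compact (@cball0 R n r).
Proof.
move=> r0; apply: (subclosed_compact _ (@compact_box R n r)).
- have /continuous_closedP h : continuous (fun v : 'rV[R]_n => dot v v).
    apply: continuous_sum => i v; apply: continuousM; exact: continuous_coord.
  rewrite (_ : cball0 _ = [set v : 'rV[R]_n | dot v v <= r ^+ 2]).
    by apply: (h [set x | x <= r ^+ 2]); exact: closed_le.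
  by apply/seteqP; split=> v /=; rewrite /cball0 /= -enorm_sqr ler_pXn2r// ?nnegrE ?enorm_ge0.
- move=> v /= vr i; apply: le_trans vr.
  rewrite -(ler_pXn2r (n := 2)) ?nnegrE ?enorm_ge0// enorm_sqr real_normK ?num_real//.
  by rewrite /dot (bigD1 i)//= expr2 lerDl sumr_ge0// => k _; rewrite -expr2 sqr_ge0.
Qed.

Lemma compact_parallel_body n (K : set 'rV[R]_n) r : 0 <= r -> compact K ->
  compact (parallel_body K r).
Proof.
move=> r0 cK; rewrite (_ : parallel_body K r = [set xy.1 + xy.2 | xy in K `*` @cball0 R n r]).
  apply: compact_image; last by apply: compact_setX => //; exact: compact_cball0.
  apply: continuous_row => i; have -> :
      (fun xy : 'rV[R]_n * 'rV[R]_n => (xy.1 + xy.2) 0 i) = (fun xy => xy.1 0 i + xy.2 0 i).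
    by apply/funext => ys; rewrite !mxE.
  move=> xs.
  apply: (@continuousD R R^o _ (fun xs : 'rV[R]_n * 'rV[R]_n => xs.1 0 i) (fun xs => xs.2 0 i)).
    apply: (@continuous_comp _ _ _ fst (fun v : 'rV[R]_n => v 0 i)); first exact: cvg_fst.
    exact: continuous_coord.
  apply: (@continuous_comp _ _ _ snd (fun v : 'rV[R]_n => v 0 i)); first exact: cvg_snd.
  exact: continuous_coord.
apply/seteqP; split=> [_ [x Kx [y yr <-]]|_ [[x y] [Kx yr] <-]]; first by exists (x, y).
by exists x => //; exists y.
Qed.

Lemma le_fvol n (A B : set 'rV[R]_n) : compact A -> compact B -> A `<=` B -> fvol A <= fvol B.
Proof.
by move=> cA cB AB; rewrite -lee_fin -!fvolE//; apply: le_vol => //; exact: borel_compact.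
Qed.

(** The homothety of ratio [c] centred at a point of [K] maps [K] into itself and
balls of radius [r] to balls of radius [c * r]. *)
Lemma fvol_parallel_shrink n (K : set 'rV[R]_n) r c : compact K -> cvx K ->
  0 <= r -> 0 < c -> c <= 1 ->
  c ^+ n * fvol (parallel_body K r) <= fvol (parallel_body K (c * r)).
Proof.
move=> cK cvK r0 c0 c1.
have cr0 : 0 <= c * r by rewrite mulr_ge0// ltW.
have [[x0 Kx0]|K0] := pselect (K !=set0); last first.
  rewrite (_ : parallel_body K r = set0); last first.
    by apply/seteqP; split=> // y [x Kx _]; exfalso; apply: K0; exists x.
  by rewrite /fvol vol_set0 mulr0 fvol_ge0.
have cA := compact_parallel_body r0 cK; have cB := compact_parallel_body cr0 cK.
have ci0 : 0 < c^-1 by rewrite invr_gt0.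
set a := - ((c^-1 * (1 - c)) *: x0).
rewrite -lee_fin EFinM -!fvolE//.
have := vol_affine a ci0 (borel_compact cA); rewrite exprVn invrK => <-.
apply: le_vol; last 2 first.
- exact: borel_compact.
- move=> y [k Kk [b br E]].
  have yE : y = (c *: k + (1 - c) *: x0) + c *: b.
    rewrite addrAC -scalerDr E scalerDr scalerA mulfV ?gt_eqF// scale1r /a.
    by rewrite scalerN scalerA mulrA mulfV ?gt_eqF// mul1r subrK.
  exists (c *: k + (1 - c) *: x0); first exact: (cvK _ _ c Kk Kx0 (ltW c0) c1).
  exists (c *: b); last by rewrite -yE.
  by rewrite /cball0 /= enormZ (gtr0_norm c0) ler_pM2l.
have := borel_affine (c^-1%:M) a (borel_compact cA).
by congr borel; apply/seteqP; split=> v /=; rewrite mul_mx_scalar.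
Qed.

Lemma parallel_body_sub_zonotope n (K : set 'rV[R]_n) l c r : 0 <= r -> 0 <= c ->
  @cball0 R n c `<=` zonotope l -> parallel_body K (c * r) `<=` add_segments K l r.
Proof.
move=> r0 c0 cZ _ [x Kx [y + <-]]; rewrite add_segmentsE// /cball0 /= => yr.
exists x => //; exists (r^-1 *: y).
  apply: cZ; rewrite /cball0 /= enormZ ger0_norm ?invr_ge0//.
  have [->|rn0] := eqVneq r 0; first by rewrite invr0 mul0r.
  by rewrite mulrC ler_pdivrMr// lt_neqAle eq_sym rn0.
have [r0'|rn0] := eqVneq r 0; last by rewrite scalerA mulfV// scale1r.
have -> : y = 0; last by rewrite !scaler0.
apply: dot_eq0; rewrite -enorm_sqr (_ : enorm y = 0) ?expr0n//.
by apply/eqP; rewrite eq_le enorm_ge0 andbT (le_trans yr)// r0' mulr0.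
Qed.

Lemma zonotope_sub_parallel_body n (K : set 'rV[R]_n) l c r : 0 <= r ->
  zonotope l `<=` @cball0 R n c -> add_segments K l r `<=` parallel_body K (c * r).
Proof.
move=> r0 Zc y; rewrite add_segmentsE// => -[x Kx [z /Zc zc <-]].
exists x => //; exists (r *: z) => //.
by rewrite /cball0 /= enormZ ger0_norm// mulrC ler_wpM2r.
Qed.

Lemma fvol_zonotope_bounds n (K : set 'rV[R]_n) l e r : compact K -> cvx K ->
  0 <= r -> 0 < e -> e < 1 ->
  (forall u, (1 - e) * enorm u <= \sum_(a <- l) `|dot u a| <= (1 + e) * enorm u) ->
  (1 - e) ^+ n * fvol (parallel_body K r) <= fvol (add_segments K l r)
    <= (1 + e) ^+ n * fvol (parallel_body K r).
Proof.
move=> cK cvK r0 e0 e1 hl.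
have e1' : 0 < 1 - e by rewrite subr_gt0.
have e1'' : 0 < 1 + e by rewrite addr_gt0.
have Z1 : @cball0 R n (1 - e) `<=` zonotope l.
  by apply: ball_sub_zonotope => u; have /andP[] := hl u.
have Z2 : zonotope l `<=` @cball0 R n (1 + e).
  by apply: zonotope_sub_ball; [exact: ltW|move=> u; have /andP[] := hl u].
have cS := compact_add_segments (l := l) (t := r) cK.
apply/andP; split.
  apply: le_trans (fvol_parallel_shrink cK cvK r0 e1' _) _; first by rewrite gerBl ltW.
  apply: le_fvol => //; last exact: parallel_body_sub_zonotope (ltW e1') Z1.
  by apply: compact_parallel_body => //; rewrite mulr_ge0// ltW.
have er0 : 0 <= (1 + e) * r by rewrite mulr_ge0// ltW.
apply: (@le_trans _ _ (fvol (parallel_body K ((1 + e) * r)))).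
  apply: le_fvol => //; last exact: zonotope_sub_parallel_body.
  exact: compact_parallel_body.
have := fvol_parallel_shrink (c := (1 + e)^-1) cK cvK er0.
rewrite invr_gt0 invf_le1// lerDl mulrA mulVf ?gt_eqF// mul1r exprVn.
by move=> /(_ e1'' (ltW e0)); rewrite ler_pdivrMl// exprn_gt0.
Qed.

Lemma cvg_sumr I (s : seq I) (P : pred I) (f : I -> nat -> R) (a : I -> R) :
  (forall i, f i @ \oo --> a i) ->
  (\sum_(i <- s | P i) f i m) @[m --> \oo] --> \sum_(i <- s | P i) a i.
Proof.
move=> fa; elim: s => [|i s IH].
  rewrite big_nil (_ : (fun m => _) = cst 0); first exact: cvg_cst.
  by apply/funext => m; rewrite big_nil.
rewrite big_cons (_ : (fun m => _) = (fun m => if P i then f i m + \sum_(j <- s | P j) f j m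
    else \sum_(j <- s | P j) f j m)); last by apply/funext => m; rewrite big_cons.
by case: (P i) => //; apply: cvgD => //; exact: fa.
Qed.

(** Choose zonotopes tending to the ball.  The polynomials of [steiner_zonotope]
converge at nonnegative numbers to the volumes of the parallel bodies; by
interpolation at [n.+1] nodes they converge at every real number, to a
polynomial, and the law holds in the limit. *)
Theorem steiner_ball N n (p : 'I_N -> 'rV[R]_n) :
  exists w : {set 'I_N} -> {poly R}, [/\ forall J, (size (w J) <= n.+1)%N,
    forall J r, 0 <= r -> vol (parallel_body (hull p J) r) = ((w J).[r])%:E &
    forall (I : {set 'I_N}) (t : R), \sum_(J : {set 'I_N} | J \subset I) (-1) ^+ #|J| * (w J).[t] =
      - ((-1) ^+ n * (w I).[- t])].
Proof.
pose e (m : nat) : R := 2^-1 * m.+1%:R^-1.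
have e0 m : 0 < e m by rewrite mulr_gt0 ?invr_gt0.
have e1 m : e m < 1.
  have m1 : m.+1%:R^-1 <= 1 :> R by rewrite invf_le1// ler1n.
  rewrite /e; move: m1; set x := m.+1%:R^-1 => m1; lra.
have eto0 : e @ \oo --> 0.
  rewrite -(mulr0 (2^-1 : R)); apply: cvgMr; exact: cvg_harmonic.
have /choice[l hl] m := almost_euclidean n (e0 m).
have /choice[w hw] m := steiner_zonotope p (l m).
pose v J r := fvol (parallel_body (hull p J) r).
have wv J r : 0 <= r -> (w m J).[r] @[m --> \oo] --> v J r.
  move=> r0.
  (* The bounds of [fvol_zonotope_bounds] are values at [e m] of the polynomials
     (1 - X)^n and (1 + X)^n. *)
  have cvgp (q : {poly R}) : q.[0] = 1 -> (q.[e m] * v J r) @[m --> \oo] --> v J r.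
    move=> q0; rewrite -[X in _ --> X]mul1r -q0; apply: cvgMl.
    by apply: continuous_cvg => //; exact: continuous_horner.
  have q0 s : ((1%:P + s%:P * 'X) ^+ n : {poly R}).[0] = 1.
    by rewrite horner_exp hornerD hornerM !hornerC hornerX mulr0 addr0 expr1n.
  apply: (squeeze_cvgr _ (cvgp _ (q0 (-1))) (cvgp _ (q0 1))).
  near=> m; have [_ volE _] := hw m.
  have -> : (w m J).[r] = fvol (add_segments (hull p J) (l m) r) by rewrite /fvol volE.
  rewrite !horner_exp !hornerD !hornerM !hornerC !hornerX mulN1r mul1r.
  by apply: fvol_zonotope_bounds => //; [exact: compact_hull|exact: cvx_hull].
pose node (i : nat) : R := i%:R.
have node_inj : injective node by move=> i j /eqP; rewrite eqr_nat => /eqP.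
pose L (i : 'I_n.+1) : {poly R} := (tnth (lagrange n.+1 node) i : {poly R}).
pose W J : {poly R} := \sum_(i < n.+1) (v J (node i))%:P * L i.
have wW J t : (w m J).[t] @[m --> \oo] --> (W J).[t].
  have wE m : (w m J).[t] = \sum_(i < n.+1) (w m J).[node i] * (L i).[t].
    have [sw _ _] := hw m.
    rewrite {1}(lagrange_gen (ltn0Sn n) node_inj (sw J)) horner_sum.
    by apply: eq_bigr => i _; rewrite hornerM hornerC.
  under eq_fun do rewrite wE.
  have -> : (W J).[t] = \sum_(i < n.+1) v J (node i) * (L i).[t].
    by rewrite horner_sum; apply: eq_bigr => i _; rewrite hornerM hornerC.
  apply: cvg_sumr => i; apply: cvgMl; apply: wv; exact: ler0n.
exists W; split.
- move=> J; apply: leq_trans (size_sum _ _ _) _; apply/bigmax_leqP => i _.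
  by rewrite mul_polyC (leq_trans (size_scale_leq _ _))// size_lagrange_.
- move=> J r r0; rewrite fvolE; last by apply: compact_parallel_body => //; exact: compact_hull.
  congr (_%:E); apply: (cvg_unique _ (wv J r r0) (wW J r)); exact: norm_hausdorff.
- move=> I t.
  have h1 : (\sum_(J : {set 'I_N} | J \subset I) (-1) ^+ #|J| * (w m J).[t]) @[m --> \oo] -->
      \sum_(J : {set 'I_N} | J \subset I) (-1) ^+ #|J| * (W J).[t].
    by apply: cvg_sumr => J; apply: cvgMr; exact: wW.
  have h2 : (\sum_(J : {set 'I_N} | J \subset I) (-1) ^+ #|J| * (w m J).[t]) @[m --> \oo] -->
      - ((-1) ^+ n * (W I).[- t]).
    have -> : (fun m => \sum_(J : {set 'I_N} | J \subset I) (-1) ^+ #|J| * (w m J).[t]) =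
        (fun m => - ((-1) ^+ n * (w m I).[- t])).
      by apply/funext => m; have [_ _ ->] := hw m.
    by apply: cvgN; apply: cvgMr; exact: wW.
  apply: (cvg_unique _ h1 h2); exact: norm_hausdorff.
Unshelve. all: by end_near.
Qed.

End SteinerBall.

(** * Moebius inversion over subsets *)

Section Moebius.
Variables (T : finType) (R : comPzRingType).
Implicit Types (A B S : {set T}) (H : {set T} -> R).

Lemma alternating_sum_interval A B : A \subset B ->
  \sum_(S : {set T} | (A \subset S) && (S \subset B)) (-1) ^+ #|S| =
  (-1) ^+ #|A| * (A == B)%:R :> R.
Proof.
move=> AB.
rewrite (reindex_onto (fun S => A :|: S)%SET (fun S => S :\: A)%SET); last first.
  by move=> S /andP[AS _]; rewrite -[in RHS](finset.setID S A) (finset.setIidPr AS).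
transitivity (\sum_(S : {set T} | S \subset B :\: A) (-1) ^+ #|A| * (-1) ^+ #|S| : R).
  apply: eq_big => [S|S /andP[_ /eqP SE]]; last first.
    have dis : [disjoint A & S] by rewrite -SE disjoint_sym finset.disjoints_subset finset.subsetDr.
    by rewrite -exprD finset.cardsU disjoint_setI0// finset.cards0 subn0.
  rewrite finset.subsetUl/= finset.subUset AB /= finset.subsetD finset.setDUl finset.setDv finset.set0U.
  congr (_ && _); apply/eqP/idP => [<-|]; first by rewrite finset.disjoints_subset finset.subsetDr.
  by move/finset.setDidPl.
rewrite -mulr_sumr alternating_sum_subset; congr (_ * (nat_of_bool _)%:R).
by rewrite finset.setD_eq0; apply/idP/eqP => [BA|->//]; apply/eqP; rewrite finset.eqEsubset AB.
Qed.

Lemma moebius_sum H B :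
  \sum_(S : {set T} | S \subset B) \sum_(A : {set T} | A \subset S)
     (-1) ^+ #|S| * (-1) ^+ #|A| * H A = H B.
Proof.
rewrite (exchange_big_dep (fun A : {set T} => A \subset B)) /=; last first.
  by move=> S A SB AS; exact: fintype.subset_trans AS SB.
transitivity (\sum_(A : {set T} | A \subset B) (A == B)%:R * H A).
  apply: eq_bigr => A AB; under eq_bigr do rewrite -mulrA.
  rewrite -mulr_suml mulrA; congr (_ * _).
  rewrite (eq_bigl (fun S : {set T} => (A \subset S) && (S \subset B))); last first.
    by move=> S; rewrite andbC.
  by rewrite alternating_sum_interval// mulrAC -expr2 sqrr_sign mul1r.
rewrite (bigD1 B)//= eqxx mul1r big1 ?addr0// => A /andP[_ /negbTE ->].
by rewrite mul0r.
Qed.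

Lemma moebius_inversion H S :
  \sum_(A : {set T} | A \subset S) (-1) ^+ #|S| * (-1) ^+ #|A| *
     (\sum_(B : {set T} | B \subset A) H B) = H S.
Proof.
under eq_bigr do rewrite mulr_sumr.
rewrite (exchange_big_dep (fun B : {set T} => B \subset S)) /=; last first.
  by move=> A B AS BA; exact: fintype.subset_trans BA AS.
transitivity (\sum_(B : {set T} | B \subset S) (B == S)%:R * H B).
  apply: eq_bigr => B BS; rewrite -mulr_suml -mulr_sumr; congr (_ * _).
  rewrite (eq_bigl (fun A : {set T} => (B \subset A) && (A \subset S))); last first.
    by move=> A; rewrite andbC.
  rewrite alternating_sum_interval// mulrA; case: eqP => [->|_]; last by rewrite mulr0.
  by rewrite mulr1 -expr2 sqrr_sign.
rewrite (bigD1 S)//= eqxx mul1r big1 ?addr0// => A /andP[_ /negbTE ->].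
by rewrite mul0r.
Qed.

End Moebius.

(** * Zero-weight extensions and contraduals *)

Section BooleanPart.
Variables (R : realType) (N : nat) (hN : (1 <= N)%N).
Implicit Types (f g : freeBA N) (I J S A B : {set 'I_N}).

Let i0 : 'I_N := Ordinal hN.

Lemma inC_set0 : inC (finset.set0 : freeBA N).
Proof. by rewrite -(finset.setDv (bvar i0)); apply: inC_diff; exact: inC_var. Qed.

Lemma inC_bigcup (P : pred 'I_N) (F : 'I_N -> freeBA N) :
  (forall i, P i -> inC (F i)) -> inC (\bigcup_(i | P i) F i)%SET.
Proof.
move=> PF; elim/big_ind : _ => //; [exact: inC_set0|by move=> f g; exact: inC_cup].
Qed.

(** An atom is cut out of one of its variables, by removing the part of it outside
the other variables of [S] and the variables that are not in [S].  For the empty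
[S] there is no variable to start from. *)
Lemma inC_set1 S : S != finset.set0 -> inC ([set S]%SET : freeBA N).
Proof.
move=> /finset.set0Pn[i iS].
have -> : [set S]%SET = (bvar i :\: \bigcup_(j in S) (bvar i :\: bvar j)
    :\: \bigcup_(j | j \notin S) bvar j)%SET :> freeBA N.
  apply/finset.setP => A; rewrite !finset.inE; apply/eqP/idP => [->|].
    rewrite iS andbT; apply/andP; split; apply/finset.bigcupP => -[j jS].
      by rewrite finset.inE (negbTE jS).
    by rewrite !finset.inE jS.
  move=> /and3P[h1 h2 iA]; apply/finset.setP => j; apply/idP/idP => jA.
    by apply: contraNT h1 => jS; apply/finset.bigcupP; exists j; rewrite ?finset.inE.
  by apply: contraNT h2 => jS; apply/finset.bigcupP; exists j; rewrite // !finset.inE jS.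
apply: inC_diff; last by apply: inC_bigcup => j _; exact: inC_var.
apply: inC_diff; first exact: inC_var.
by apply: inC_bigcup => j _; apply: inC_diff; exact: inC_var.
Qed.

(** Unions, intersections and differences of sets that avoid the empty valuation
avoid it as well; conversely, such a set is a union of the atoms of
[inC_set1]. *)
Lemma inCP f : inC f <-> finset.set0 \notin f.
Proof.
split.
  elim=> [i|f1 g _ + _|f1 g _ + _|f1 g _ + _]; rewrite !finset.inE //.
  - by move=> /negbTE -> /negbTE ->.
  - by move=> /negbTE ->.
  - by move=> /negbTE ->; rewrite andbF.
elim/setU1_ind : f => [_|S f Sf IH]; first exact: inC_set0.
rewrite !finset.inE negb_or eq_sym => /andP[S0 f0].
by apply: inC_cup; [exact: inC_set1|exact: IH].
Qed.

Lemma additive_set0 (mu : freeBA N -> R) : additive_on_C mu -> mu finset.set0 = 0.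
Proof.
move=> /(_ _ _ inC_set0 inC_set0 (finset.setI0 _)).
by rewrite finset.setU0 => /eqP; rewrite -subr_eq0 opprD addrA subrr sub0r oppr_eq0 => /eqP.
Qed.

Lemma additive_atoms (mu : freeBA N -> R) f : additive_on_C mu -> inC f ->
  mu f = \sum_(S in f) mu [set S]%SET.
Proof.
move=> amu /inCP; elim/setU1_ind : f => [_|S f Sf IH].
  by rewrite big_set0 additive_set0.
rewrite !finset.inE negb_or eq_sym => /andP[S0 f0].
rewrite big_setU1//= -IH//; apply: amu; [exact: inC_set1|exact/inCP|].
by apply/finset.setP => A; rewrite !finset.inE; case: eqP => // ->; rewrite (negbTE Sf).
Qed.

Lemma bjoinE I S : (S \in bjoin I) = ~~ (S \subset ~: I)%SET.
Proof.
rewrite -finset.disjoints_subset -setI_eq0; apply/finset.bigcupP/finset.set0Pn => -[i].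
  by move=> iI; rewrite finset.inE => iS; exists i; rewrite finset.inE iI iS.
by rewrite finset.inE => /andP[iS iI]; exists i; rewrite ?finset.inE.
Qed.

Lemma inC_bjoin I : inC (bjoin I).
Proof. by apply/inCP; rewrite bjoinE finset.sub0set. Qed.

(** The coefficient of [U I] in the Moebius inversion that computes the weight of
the atom [S]. *)
Definition moebius_coef (S I : {set 'I_N}) : int :=
  if (~: I \subset S)%SET then - ((-1) ^+ #|S| * (-1) ^+ #|~: I|%SET) else 0.

Lemma weights_moebius (om : {set 'I_N} -> R) (U : {set 'I_N} -> R) S :
  (forall B, \sum_(A : {set 'I_N} | A \subset B) om A = - U (~: B)%SET) ->
  om S = \sum_(I : {set 'I_N}) (moebius_coef S I)%:~R * U I.
Proof.
move=> omU; rewrite -(moebius_inversion om S).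
under eq_bigr do rewrite omU.
rewrite (reindex_inj (@finset.setC_inj _)) /= big_mkcond /=; apply: eq_bigr => I _.
rewrite /moebius_coef finset.setCK; case: ifP => _; last by rewrite mul0r.
by rewrite rmorphN rmorphM !rmorphXn rmorphN1 mulNr mulrN.
Qed.

(** The values of [mu] do not concern the atom of the empty valuation.  Giving it the
weight that makes the total mass 0 turns [mu (bjoin I)] into minus the mass of
the atoms inside the complement of [I], and Moebius inversion then recovers all
weights. *)
Lemma coef_exists f : inC f -> exists m : {set 'I_N} -> int,
  forall mu : freeBA N -> R, additive_on_C mu ->
    mu f = \sum_(I : {set 'I_N} | I != finset.set0) (m I)%:~R * mu (bjoin I).
Proof.
move=> Cf; exists (fun I => \sum_(S in f) moebius_coef S I) => mu amu.
rewrite (additive_atoms amu Cf).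
pose U I := mu (bjoin I).
pose om S := if S == finset.set0 then - U finset.setT else mu [set S]%SET.
have UE I : U I = \sum_(S : {set 'I_N} | ~~ (S \subset ~: I)%SET) om S.
  rewrite /U (additive_atoms amu (inC_bjoin I)); apply: eq_big => [S|S].
    exact: bjoinE.
  by rewrite bjoinE /om; case: eqP => // ->; rewrite finset.sub0set.
have om0 : \sum_(S : {set 'I_N}) om S = 0.
  rewrite (bigD1 finset.set0)//= {1}/om eqxx UE; apply/eqP; rewrite addrC subr_eq0; apply/eqP.
  by apply: eq_bigl => S; rewrite finset.setCT finset.subset0.
have omU B : \sum_(A : {set 'I_N} | A \subset B) om A = - U (~: B)%SET.
  apply/eqP; rewrite -addr_eq0 UE finset.setCK -[X in _ == X]om0.
  by rewrite [X in _ == X](bigID (fun A : {set 'I_N} => A \subset B)) /=.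
have U0 : U finset.set0 = 0.
  by rewrite UE big1// => S; rewrite finset.setC0 finset.subsetT.
transitivity (\sum_(S in f) \sum_(I : {set 'I_N}) (moebius_coef S I)%:~R * U I).
  apply: eq_bigr => S Sf; rewrite -(weights_moebius S omU) /om; case: eqP => // S0.
  by move/inCP: Cf; rewrite -S0 Sf.
rewrite exchange_big /= (bigD1 finset.set0)//= U0 big1 ?add0r; last by move=> S _; rewrite mulr0.
by apply: eq_bigr => I _; rewrite -mulr_suml rmorph_sum.
Qed.

Lemma coefP f : inC f -> forall mu : freeBA N -> R, additive_on_C mu ->
  mu f = \sum_(I : {set 'I_N} | I != finset.set0) (coef R f I)%:~R * mu (bjoin I).
Proof. by move=> /coef_exists Cf; exact: (xgetPex (fun=> 0) Cf). Qed.

Section Extension.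
Variable U : {set 'I_N} -> R.
Hypothesis U0 : U finset.set0 = 0.

(** The Moebius inverse of [fun B => - U (~: B)]: the weights of the measure on
atoms with total mass 0 that takes the value [U I] on [bjoin I]. *)
Definition weight S : R := \sum_(A : {set 'I_N} | A \subset S)
  (-1) ^+ #|S| * (-1) ^+ #|A| * - U (~: A)%SET.

Lemma sum_weight B : \sum_(S : {set 'I_N} | S \subset B) weight S = - U (~: B)%SET.
Proof. exact: (moebius_sum (fun A => - U (~: A)%SET)). Qed.

Lemma weight_total : \sum_(S : {set 'I_N}) weight S = 0.
Proof.
have := sum_weight finset.setT; rewrite finset.setCT U0 oppr0 => E; rewrite -[RHS]E.
by apply: eq_bigl => S; rewrite finset.subsetT.
Qed.

Definition weighted f : R := \sum_(S in f) weight S.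

Lemma weightedU f g : weighted (f :|: g)%SET = weighted f + weighted g - weighted (f :&: g)%SET.
Proof.
have E h : weighted h = \sum_(S : {set 'I_N}) (S \in h)%:R * weight S.
  by rewrite /weighted big_mkcond; apply: eq_bigr => S _; case: ifP; rewrite ?mul1r ?mul0r.
rewrite !E -big_split -sumrB; apply: eq_bigr => S _ /=.
by rewrite !finset.inE; case: (_ \in f); case: (_ \in g); rewrite /= ?mul0r ?mul1r; ring.
Qed.

Lemma weightedT : weighted finset.setT = 0.
Proof. by rewrite -weight_total; apply: eq_bigl => S; rewrite finset.inE. Qed.

Lemma weightedC f : weighted (~: f)%SET = - weighted f.
Proof.
apply/eqP; rewrite -addr_eq0 -weight_total (bigID (mem f)) /= addrC; apply/eqP.
by congr (_ + _); apply: eq_bigl => S; rewrite finset.inE.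
Qed.

Lemma weighted_additive : additive_on_C weighted.
Proof.
by move=> f g _ _ fg; rewrite weightedU fg /weighted big_set0 subr0.
Qed.

Lemma weighted_bjoin I : weighted (bjoin I) = U I.
Proof.
rewrite /weighted (eq_bigl _ _ (bjoinE I)).
have := weight_total; rewrite (bigID (fun S : {set 'I_N} => S \subset ~: I)%SET) /=.
by rewrite sum_weight finset.setCK => /eqP; rewrite addrC subr_eq0 => /eqP.
Qed.

(** On [inC] both sides are determined by their values on the [bjoin I].  The other
elements are complements of elements of [inC], and modularity together with the
value 0 on the greatest element determines the extension there. *)
Lemma zero_weight_extE f :
  zero_weight_ext (fun g => \sum_(I : {set 'I_N} | I != finset.set0) (coef R g I)%:~R * U I) f
  = weighted f.
Proof.
set mu := fun g => _.
have wmu g : inC g -> weighted g = mu g.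
  move=> Cg; rewrite (coefP Cg weighted_additive); apply: eq_bigr => I _.
  by rewrite weighted_bjoin.
have [ext0 extU extT] : [set nu : freeBA N -> R |
    [/\ forall f, inC f -> nu f = mu f,
        forall f g, nu (f :|: g)%SET = nu f + nu g - nu (f :&: g)%SET &
        nu finset.setT = 0]]%classic (zero_weight_ext mu).
  by apply: xgetPex; exists weighted; split; [exact: wmu|exact: weightedU|exact: weightedT].
have [f0|/inCP Cf] := boolP (finset.set0 \in f); last by rewrite ext0// wmu.
have Cf : inC (~: f)%SET by apply/inCP; rewrite finset.inE f0.
have := extU f (~: f)%SET; rewrite finset.setUCr finset.setICr extT.
rewrite (ext0 _ Cf) (ext0 _ inC_set0) -(wmu _ Cf) -(wmu _ inC_set0).
have w0 : weighted finset.set0 = 0 by rewrite /weighted big_set0.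
by rewrite weightedC w0 subr0 => /eqP; rewrite eq_sym subr_eq0 => /eqP.
Qed.

(** Passing to the contradual exchanges the atoms [S] and [~: S], so the claim is a
relation between their weights.  By inclusion-exclusion, the hypothesis says that
the atoms containing [I] have mass [sigma * U I], while those inside [~: I] have
mass [- U I] by definition; Moebius inversion yields the relation. *)
Lemma weighted_contradual (sigma : R) f : sigma ^+ 2 = 1 ->
  (forall I, \sum_(J : {set 'I_N} | J \subset I) (-1) ^+ #|J| * U J = - (sigma * U I)) ->
  - weighted (contradual f) = sigma * weighted f.
Proof.
move=> s2 rec.
have upper I : \sum_(S : {set 'I_N} | I \subset S) weight S = sigma * U I.
  transitivity (\sum_(S : {set 'I_N}) (\sum_(J : {set 'I_N} | J \subset I :\: S) (-1) ^+ #|J|) * weight S).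
    rewrite big_mkcond; apply: eq_bigr => S _.
    by rewrite alternating_sum_subset finset.setD_eq0; case: ifP; rewrite ?mul1r ?mul0r.
  under eq_bigr do rewrite mulr_suml.
  rewrite (exchange_big_dep (fun J : {set 'I_N} => J \subset I)) /=; last first.
    by move=> S J _; rewrite finset.subsetD => /andP[].
  rewrite -[RHS]opprK -rec -sumrN; apply: eq_bigr => J JI.
  rewrite -mulr_sumr -mulrN; congr (_ * _).
  rewrite -[J in U J]finset.setCK -sum_weight; apply: eq_bigl => S.
  by rewrite finset.subsetD JI /= disjoint_sym finset.disjoints_subset.
have wE S : weight S = - (sigma * weight (~: S)%SET).
  rewrite -(moebius_inversion (fun S => - (sigma * weight (~: S)%SET)) S).
  rewrite -[LHS](moebius_inversion weight); apply: eq_bigr => A _; congr (_ * _).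
  rewrite sum_weight sumrN -mulr_sumr; congr (- _).
  rewrite (reindex_inj (@finset.setC_inj _)) /=.
  rewrite (eq_bigl (fun S : {set 'I_N} => (~: A)%SET \subset S)); last first.
    by move=> B; rewrite finset.subCset.
  under eq_bigr do rewrite finset.setCK.
  by rewrite upper mulrA -expr2 s2 mul1r.
rewrite /weighted mulr_sumr -sumrN (reindex_inj (@finset.setC_inj _)) /=.
apply: eq_big => [S|S _].
  rewrite finset.inE; congr (_ \in f); apply/finset.setP => i.
  by rewrite !finset.inE negbK.
by rewrite [in RHS]wE mulrN mulrA -expr2 s2 mul1r.
Qed.

End Extension.
End BooleanPart.

(** * Coefficients of Steiner polynomials *)

Section Coefficients.
Local Open Scope classical_set_scope.
Local Open Scope ring_scope.
Variable R : realType.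

Lemma poly_eq_nneg (p q : {poly R}) : (forall r, 0 <= r -> p.[r] = q.[r]) -> p = q.
Proof.
move=> pq; apply/eqP; rewrite -subr_eq0; apply/eqP.
apply: (@roots_geq_poly_eq0 _ _ [seq i%:R | i <- iota 0 (size (p - q))]).
- apply/allP => _ /mapP[i _ ->]; rewrite /root hornerD hornerN pq ?ler0n//.
  by rewrite subrr.
- rewrite map_inj_uniq ?iota_uniq// => i j /eqP; rewrite eqr_nat => /eqP//.
- by rewrite size_map size_iota.
Qed.

(** Steiner's formula holds for nonnegative radii only, but this determines its
coefficients. *)
Lemma coefs_unique d (e : 'I_d.+1 -> nat) (c : 'I_d.+1 -> R) (w : {poly R}) :
  injective e -> (forall r, 0 <= r -> w.[r] = \sum_k c k * r ^+ e k) ->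
  forall k, c k = w`_(e k).
Proof.
move=> ie wE k; have -> : w = \sum_k c k *: 'X^(e k).
  apply: poly_eq_nneg => r /wE ->; rewrite horner_sum; apply: eq_bigr => i _.
  by rewrite hornerZ hornerXn.
rewrite coef_sum (bigD1 k)//= coefZ coefXn eqxx mulr1 big1 ?addr0// => i ik.
by rewrite coefZ coefXn (inj_eq ie) eq_sym (negbTE ik) mulr0.
Qed.

(** The ball contains a cube. *)
Lemma kappa_gt0 n : 0 < kappa R n.
Proof.
have cB : compact (@cball0 R n 1) by exact: compact_cball0.
pose c : R := n.+1%:R^-1.
have c0 : 0 < c by rewrite invr_gt0.
rewrite /kappa -/(fvol _); apply: lt_le_trans (le_fvol (@compact_box R n c) cB _).
  by rewrite /fvol vol_box ?ltW//= exprn_gt0// mulr_gt0.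
move=> v vc; rewrite /cball0 /= -(ler_pXn2r (n := 2)) ?nnegrE ?enorm_ge0// enorm_sqr expr1n.
apply: (@le_trans _ _ (\sum_(i < n) c)).
  apply: ler_sum => i _; rewrite -expr2 -real_normK ?num_real//.
  have c1 : c <= 1 by rewrite invf_le1// ler1n.
  apply: le_trans (_ : c ^+ 2 <= _); first by rewrite lerXn2r ?nnegrE// ltW.
  by rewrite expr2 ler_piMl// ltW.
rewrite sumr_const card_ord -[X in X <= _]mulr_natl ler_pdivrMr// mul1r.
by rewrite ler_nat.
Qed.

Variables (N d : nat) (p : 'I_N -> 'rV[R]_d) (w : {set 'I_N} -> {poly R}).
Hypothesis size_w : forall J, (size (w J) <= d.+1)%N.
Hypothesis vol_w : forall J r, 0 <= r ->
  vol (parallel_body (hull p J) r) = ((w J).[r])%:E.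
Hypothesis w_rec : forall (I : {set 'I_N}) (t : R),
  \sum_(J : {set 'I_N} | J \subset I) (-1) ^+ #|J| * (w J).[t] =
  - ((-1) ^+ d * (w I).[- t]).

Lemma quermassE J k : quermass (hull_of p J) k = (w J)`_k / 'C(d, k)%:R.
Proof.
rewrite hull_ofE; set K := hull p J.
have bin_neq0 (i : 'I_d.+1) : 'C(d, i)%:R != 0 :> R.
  by rewrite pnatr_eq0 -lt0n bin_gt0 -ltnS.
have qP : [set W : 'I_d.+1 -> R | forall r : R, 0 <= r ->
    vol (parallel_body K r) = (\sum_(k < d.+1) 'C(d, k)%:R * W k * r ^+ k)%:E] (quermass K).
  apply: xgetPex; exists (fun i => (w J)`_i / 'C(d, i)%:R) => r r0.
  rewrite vol_w// (horner_coef_wide _ (size_w J)); congr (_%:E).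
  by apply: eq_bigr => i _; congr (_ * _); rewrite mulrC divfK.
apply/(mulfI (bin_neq0 k)); rewrite [RHS]mulrC divfK//.
apply: (coefs_unique (e := fun i : 'I_d.+1 => i : nat)
   (c := fun k : 'I_d.+1 => 'C(d, k)%:R * quermass K k)) => [i j /val_inj//|r r0].
by apply: EFin_inj; rewrite -vol_w// qP.
Qed.

Lemma intrinsic_volE J k : intrinsic_vol (hull_of p J) k = (w J)`_(d - k) / kappa R (d - k).
Proof.
rewrite hull_ofE; set K := hull p J.
have kappa_neq0 i : kappa R i != 0 by rewrite gt_eqF// kappa_gt0.
have qP : [set V : 'I_d.+1 -> R | forall r : R, 0 <= r ->
    vol (parallel_body K r) = (\sum_(k < d.+1) kappa R (d - k) * V k * r ^+ (d - k))%:E] (intrinsic_vol K).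
  apply: xgetPex; exists (fun i : 'I_d.+1 => (w J)`_(d - i) / kappa R (d - i)) => r r0.
  rewrite vol_w// (horner_coef_wide _ (size_w J)); congr (_%:E).
  rewrite (reindex_inj rev_ord_inj) /=.
  by apply: eq_bigr => i _; rewrite subSS; congr (_ * _); rewrite mulrC divfK.
apply/(mulfI (kappa_neq0 (d - k)%N)); rewrite [RHS]mulrC divfK//.
apply: (coefs_unique (e := fun i : 'I_d.+1 => (d - i)%N)
   (c := fun k => kappa R (d - k) * intrinsic_vol K k)) => [i j ij|r r0].
  apply: val_inj => /=; rewrite -[LHS](subKn (n := d)); last by rewrite -ltnS.
  by rewrite ij subKn// -ltnS.
by apply: EFin_inj; rewrite -vol_w// qP.
Qed.

Lemma coef_w_set0 i : (w finset.set0)`_i = 0.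
Proof.
have -> : w finset.set0 = 0; last by rewrite coef0.
apply: poly_eq_nneg => r r0; apply: EFin_inj; rewrite -vol_w// hull_set0 horner0.
rewrite (_ : parallel_body set0 r = set0) ?vol_set0//.
by apply/seteqP; split=> // x [].
Qed.

Lemma coef_w_rec (I : {set 'I_N}) (i : 'I_d.+1) :
  \sum_(J : {set 'I_N} | J \subset I) (-1) ^+ #|J| * (w J)`_i =
  - ((-1) ^+ d * (-1) ^+ i * (w I)`_i).
Proof.
rewrite (coefs_unique (e := fun i : 'I_d.+1 => i : nat)
  (c := fun i : 'I_d.+1 => - ((-1) ^+ d * (-1) ^+ i * (w I)`_i))
  (w := \sum_(J : {set 'I_N} | J \subset I) (-1) ^+ #|J| *: w J)); first last.
- move=> r r0; rewrite horner_sum; under eq_bigr do rewrite hornerZ.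
  rewrite w_rec (horner_coef_wide _ (size_w I)) mulr_sumr -sumrN.
  by apply: eq_bigr => j _; rewrite (exprNn r); ring.
- by move=> j j' /val_inj.
by rewrite coef_sum; apply: eq_bigr => J _; rewrite coefZ.
Qed.

End Coefficients.

Theorem proposition10 (R : realType) (N d : nat) (hN : (1 <= N)%N)
    (hd : (1 <= d)%N) (k : 'I_d.+1) (f : freeBA N) :
  (forall p : 'I_N -> 'rV[R]_d,
     bool_intrinsic_vol (dual f) k p =
       - bool_intrinsic_vol (contradual f) k p /\
     - bool_intrinsic_vol (contradual f) k p =
       (-1) ^+ k * bool_intrinsic_vol f k p) /\
  (forall p : 'I_N -> 'rV[R]_d,
     bool_quermass (dual f) k p = - bool_quermass (contradual f) k p /\
     - bool_quermass (contradual f) k p =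
       (-1) ^+ (d - k) * bool_quermass f k p).
Proof.
have kd : (k <= d)%N by rewrite -ltnS.
have sgnE : (-1) ^+ d = (-1) ^+ (d - k) * (-1) ^+ k :> R by rewrite -exprD subnK.
have sgn2 m : ((-1) ^+ m) ^+ 2 = 1 :> R by exact: sqrr_sign.
split=> p; have [w [size_w vol_w w_rec]] := steiner_ball p.
- pose U J := intrinsic_vol (hull_of p J) k.
  have U0 : U finset.set0 = 0.
    by rewrite /U (intrinsic_volE size_w vol_w) (coef_w_set0 vol_w) mul0r.
  rewrite /bool_intrinsic_vol !(zero_weight_extE hN U0); split.
    exact: weightedC.
  apply: weighted_contradual => //.
  move=> I; rewrite /U; under eq_bigr do rewrite (intrinsic_volE size_w vol_w) mulrA.
  rewrite -mulr_suml (intrinsic_volE size_w vol_w).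
  have dk : (d - k < d.+1)%N by rewrite ltnS leq_subr.
  rewrite (coef_w_rec size_w w_rec I (Ordinal dk)) /= sgnE.
  have -> : (-1) ^+ (d - k) * (-1) ^+ k * (-1) ^+ (d - k) = (-1) ^+ k :> R.
    by rewrite mulrAC -expr2 sgn2 mul1r.
  by rewrite mulNr mulrA.
- pose U J := quermass (hull_of p J) k.
  have U0 : U finset.set0 = 0.
    by rewrite /U (quermassE size_w vol_w) (coef_w_set0 vol_w) mul0r.
  rewrite /bool_quermass !(zero_weight_extE hN U0); split.
    exact: weightedC.
  apply: weighted_contradual => //.
  move=> I; rewrite /U; under eq_bigr do rewrite (quermassE size_w vol_w) mulrA.
  rewrite -mulr_suml (quermassE size_w vol_w) (coef_w_rec size_w w_rec) sgnE.
  have -> : (-1) ^+ (d - k) * (-1) ^+ k * (-1) ^+ k = (-1) ^+ (d - k) :> R.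
    by rewrite -mulrA -expr2 sgn2 mulr1.
  by rewrite mulNr mulrA.
Qed.
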